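(* Let $\Gamma$ be a countable discrete group that is weakly amenable or satisfies the Haagerup–Kraus approximation property, let $\beta$ be an action of $\Gamma$ by homeomorphisms on a second countable, locally compact, Hausdorff space $X$, and let $\mathcal{G}$ be the associated transformation groupoid with canonical cocycle $c:\mathcal{G}\to\Gamma$. For a closed two-sided ideal $I$ of $C_r^*(\mathcal{G})$, the following are equivalent: (a) $I$ is a dynamical ideal; (b) $I$ is $\alpha^c$-invariant when $\Gamma$ is abelian, or $\delta_c$-invariant when $\Gamma$ is nonabelian; (c) $I$ is generated (as a closed two-sided ideal) by $C_0(U)$ in $C_r^*(\mathcal{G})$ for some $\beta$-invariant open subset $U$ of $X$.
   Context: The transformation groupoid is $\mathcal{G}=\{(tx,t,x):t\in\Gamma,x\in X\}$ with $s(tx,t,x)=x$, $r(tx,t,x)=tx$, $((t_1t_2)x,t_1,t_2x)(t_2x,t_2,x)=((t_1t_2)x,t_1t_2,x)$, $(tx,t,x)^{-1}=(x,t^{-1},tx)$ and the subspace topology from $X\times\Gamma\times X$, where $tx=\beta_t(x)$; its unit space $\mathcal{G}^{(0)}$ is identified with $X$. The canonical continuous $1$-cocycle is $c(tx,t,x)=t$. $C_c(\mathcal{G})$ is a $*$-algebra with $f^*(\gamma)=\overline{f(\gamma^{-1})}$ and $(fg)(\gamma)=\sum_{\gamma'\in s^{-1}(s(\gamma))}f(\gamma\gamma'^{-1})g(\gamma')$; $C_r^*(\mathcal{G})$ is its completion in the norm $\|f\|_{\mathrm{red}}=\sup_{u\in\mathcal{G}^{(0)}}\|\mathrm{Ind}_u(f)\|$,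 where $\mathrm{Ind}_u(f)\xi(\gamma)=\sum_{\gamma'\in s^{-1}(u)}f(\gamma\gamma'^{-1})\xi(\gamma')$ on $\ell^2(s^{-1}(u))$. The inclusion $C_c(\mathcal{G})\subseteq C_0(\mathcal{G})$ extends to a norm-decreasing injective linear map $C_r^*(\mathcal{G})\to C_0(\mathcal{G})$, by which each $a\in C_r^*(\mathcal{G})$ is identified with a function $\gamma\mapsto a(\gamma)$. $C_0(X)=C_0(\mathcal{G}^{(0)})$ is regarded as a $C^*$-subalgebra of $C_r^*(\mathcal{G})$. A subset $U\subseteq\mathcal{G}^{(0)}$ is invariant if $U=r(s^{-1}(U))$; $\mathcal{G}|_U=s^{-1}(U)\cap r^{-1}(U)$; for open invariant $U$, $C_r^*(\mathcal{G}|_U)$ is identified with the closure of $C_c(\mathcal{G}|_U)$ in $C_r^*(\mathcal{G})$. A closed two-sided ideal $I$ is a dynamical ideal if $I=C_r^*(\mathcal{G}|_U)$ for some open invariant $U\subseteq\mathcal{G}^{(0)}$. If $\Gamma$ is abelian, $\alpha^c$ is the action of the dual group $\widehat\Gamma$ on $C_r^*(\mathcal{G})$ by automorphisms with $\alpha^c_\chi(a)(\gamma)=\chi(c(\gamma))a(\gamma)$; a closed subspace $M$ is $\alpha^c$-invariant if $\alpha^c_\chi(M)\subseteq M$ for all $\chi\in\widehat\Gamma$. If $\Gamma$ is nonabelian, with left regular representation $\lambda$, $\delta_c:C_r^*(\mathcal{G})\to C_r^*(\mathcal{G})\otimes_{\min}C_r^*(\Gamma)$ is the coaction (nondegenerate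 $*$-homomorphism) determined by $\delta_c(f)=f\otimes\lambda_t$ for $f\in C_c(\mathcal{G})$ with $\mathrm{supp}(f)\subseteq c^{-1}(t)$, $t\in\Gamma$; $M$ is $\delta_c$-invariant if $\delta_c(M)\subseteq\overline{\mathrm{span}}\{a\otimes b:a\in M,b\in C_r^*(\Gamma)\}$. *)

(* Defs.v *)
From HB Require Import structures.
From mathcomp Require Import all_boot all_order all_algebra.
From mathcomp Require Import all_classical all_reals all_analysis.
From mathcomp Require Import complex.

Set Implicit Arguments.
Unset Strict Implicit.
Unset Printing Implicit Defensive.

Import Order.TTheory GRing.Theory Num.Theory.
Import numFieldNormedType.Exports.
Import ComplexField.Normc.

Local Open Scope classical_set_scope.
Local Open Scope ring_scope.
Local Open Scope complex_scope.

(* [R[i]^o] is the field of complex numbers as a normed module over itself;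
   it is the [^o] alias that carries the usual topology. *)

Section Operators.
Variables (R : realType) (T : choiceType).
Implicit Types (A : set T) (xi : T -> R[i]^o).

(* Vectors of l^2(A) are given by functions on T of which only the values on
   A matter; the norm is +oo if xi is not square summable on A. *)
Definition l2norm A xi : \bar R :=
  sqrte (\esum_(i in A) ((normc (xi i)) ^+ 2)%:E).

Definition opnorm A (L : (T -> R[i]^o) -> (T -> R[i]^o)) : \bar R :=
  ereal_sup [set l2norm A (L xi) | xi in [set xi | (l2norm A xi <= 1)%E]].

End Operators.

Section Completion.
Variables (R : realType) (V : lmodType R[i]).

Definition lspan (S : set V) : set V :=
  [set v | exists (k : nat) (z : 'I_k -> R[i]) (w : 'I_k -> V),
     (forall i, S (w i)) /\ v = \sum_(i < k) z i *: w i].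

(* The completion of the subspace D of V in the norm N.  A point is given by a
   Cauchy sequence in D; two sequences at distance 0 give the same point.  A
   set of points is given by a set of Cauchy sequences; closed sets, the only
   ones that get compared, are saturated for the relation "distance 0". *)
Variables (D : set V) (N : V -> \bar R).
Implicit Types (a b : nat -> V) (M : set (nat -> V)).

Definition completion : set (nat -> V) :=
  [set a | (forall n, D (a n)) /\
     forall e : R, 0 < e -> exists n0 : nat, forall m n : nat,
       (n0 <= m)%N -> (n0 <= n)%N -> (N (a m - a n)%R < e%:E)%E].

Definition completion_norm a : \bar R := limn (fun n => N (a n)).

Definition completion_closure M : set (nat -> V) :=
  [set a | completion a /\
     forall e : R, 0 < e ->
       exists2 b, M b & (completion_norm (a - b)%R < e%:E)%E].

Definition closed_subspace M : Prop :=
  [/\ M `<=` completion, M 0,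
      forall (z : R[i]) a b, M a -> M b -> M (z *: a + b)
    & completion_closure M `<=` M].

End Completion.

Section DiscreteGroup.
Variables (R : realType) (Gam : groupType).
Implicit Types (g u : Gam -> R[i]^o).

Definition finsupp g : Prop := finite_set [set t | g t != 0].

(* The left regular representation: g stands for \sum_t g t * lambda_t. *)
Definition lreg g (xi : Gam -> R[i]^o) : Gam -> R[i]^o :=
  fun s => \sum_(t \in [set: Gam]) g t * xi (t^-1 * s)%g.

Definition grpnorm g : \bar R := opnorm [set: Gam] (lreg g).

Definition Cstar_grp : set (nat -> Gam -> R[i]^o) := completion finsupp grpnorm.

(* The element \sum_t F t (x) lambda_t of M_n(C) (x) C[Gam], acting on
   l^2(Gam x {0, ..., n-1}) *)
Definition lregmx n (F : Gam -> 'M[R[i]]_n) (xi : Gam * 'I_n -> R[i]^o) :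
    Gam * 'I_n -> R[i]^o :=
  fun p => \sum_(t \in [set: Gam])
             \sum_(j < n) F t p.2 j * xi ((t^-1 * p.1)%g, j).

Definition mxnorm n (F : Gam -> 'M[R[i]]_n) : \bar R :=
  opnorm [set: Gam * 'I_n] (lregmx F).

(* The completely bounded norm of the multiplier lambda_t |-> u t * lambda_t
   of C*_r(Gam), i.e. the Herz-Schur norm of u (+oo if u is not a completely
   bounded multiplier); the norm can be computed on C[Gam] by density. *)
Definition cbnorm u : \bar R :=
  ereal_sup [set ereal_sup
    [set mxnorm (fun t => u t *: F t) | F in
       [set F : Gam -> 'M[R[i]]_n |
         finite_set [set t | F t != 0] /\ (mxnorm F <= 1)%E]] | n in [set: nat]].

(* Nets are expressed by proper filters. *)
Definition weakly_amenable : Prop :=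
  exists (K : R) (Phi : set_system (Gam -> R[i]^o)),
    [/\ ProperFilter Phi,
        Phi [set phi | finsupp phi /\ (cbnorm phi <= K%:E)%E]
      & forall t : Gam, phi t @[phi --> Phi] --> (1 : R[i]^o)].

(* The predual Q(Gam) of the space M_0A(Gam) of completely bounded
   multipliers: the completion of C[Gam], as functionals on M_0A(Gam), in the
   dual norm.  (C[Gam] is dense in l^1(Gam), whose norm is larger.)  The values
   of omega outside M_0A(Gam) are irrelevant. *)
Definition predual (omega : (Gam -> R[i]^o) -> R[i]^o) : Prop :=
  forall e : R, 0 < e -> exists2 f, finsupp f &
    forall u, (cbnorm u < +oo)%E ->
      ((normc (omega u - \sum_(t \in [set: Gam]) f t * u t))%:E
         <= e%:E * cbnorm u)%E.

(* Haagerup-Kraus: a net of finitely supported functions converges to 1 in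
   the weak* topology sigma(M_0A(Gam), Q(Gam)). *)
Definition approximation_property : Prop :=
  exists Phi : set_system (Gam -> R[i]^o),
    [/\ ProperFilter Phi, Phi finsupp
      & forall omega, predual omega ->
          omega phi @[phi --> Phi] --> omega (fun=> 1)].

Definition character (chi : Gam -> R[i]^o) : Prop :=
  (forall s t, chi (s * t)%g = chi s * chi t) /\ forall t, normc (chi t) = 1.

Definition abelian_group : Prop := forall s t : Gam, (s * t = t * s)%g.

End DiscreteGroup.

Definition is_action_by_homeos (Gam : groupType) (X : topologicalType)
    (beta : Gam -> X -> X) : Prop :=
  [/\ forall x, beta 1%g x = x,
      forall s t x, beta (s * t)%g x = beta s (beta t x)
    & forall t, continuous (beta t)].

Section Groupoid.
Variables (Gam : groupType) (X : topologicalType) (beta : Gam -> X -> X).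

(* The triples (tx, t, x), with the subspace topology *)
Definition arrow : Type :=
  initial_topology (@sval (X * discrete_topology Gam * X)
    (fun p => p.1.1 == beta p.1.2 p.2)).

Definition rng (g : arrow) : X := (sval g).1.1.
Definition coc (g : arrow) : Gam := (sval g).1.2.
Definition src (g : arrow) : X := (sval g).2.
Definition src_fiber (u : X) : set arrow := src @^-1` [set u].

Definition mkarrow (t : Gam) (x : X) : arrow :=
  exist (fun p : X * discrete_topology Gam * X => p.1.1 == beta p.1.2 p.2)
    (beta t x, t, x) (eqxx _).

Definition unit_arrow (x : X) : arrow := mkarrow 1%g x.
(* meaningful when src g = rng h *)
Definition mul_arrow (g h : arrow) : arrow := mkarrow (coc g * coc h)%g (src h).
Definition inv_arrow (g : arrow) : arrow := mkarrow (coc g)^-1%g (rng g).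

Definition invariant (U : set X) : Prop := U = rng @` (src @^-1` U).

Definition reduction (U : set X) : set arrow := src @^-1` U `&` rng @^-1` U.

End Groupoid.
Arguments src_fiber {Gam X} beta u.
Arguments unit_arrow {Gam X} beta x.
Arguments invariant {Gam X} beta U.
Arguments reduction {Gam X} beta U.

Section GroupoidAlgebra.
Variables (R : realType) (Gam : groupType) (X : topologicalType).
Variable beta : Gam -> X -> X.
Local Notation G := (arrow beta).
Implicit Types (f g : G -> R[i]^o) (U : set X).
Implicit Types (a b : nat -> G -> R[i]^o) (M I : set (nat -> G -> R[i]^o)).

Definition supp f : set G := closure [set gam | f gam != 0].

Definition Cc : set (G -> R[i]^o) := [set f | continuous f /\ compact (supp f)].

(* Below, the sums over \in are sums of finitely supported families as long as
   f is in C_c(G), which holds wherever they are used. *)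
Definition convol f g : G -> R[i]^o :=
  fun gam => \sum_(gam' \in src_fiber beta (src gam))
               f (mul_arrow gam (inv_arrow gam')) * g gam'.

Definition Ind (u : X) f (xi : G -> R[i]^o) : G -> R[i]^o :=
  fun gam => \sum_(gam' \in src_fiber beta u)
               f (mul_arrow gam (inv_arrow gam')) * xi gam'.

Definition rednorm f : \bar R :=
  ereal_sup [set opnorm (src_fiber beta u) (Ind u f)
            | u in [set: X]].

Definition Cstar : set (nat -> G -> R[i]^o) := completion Cc rednorm.

Definition Cstar_mul a b : nat -> G -> R[i]^o := fun n => convol (a n) (b n).

Definition closed_ideal I : Prop :=
  closed_subspace Cc rednorm I /\
  forall a b, Cstar a -> I b -> I (Cstar_mul a b) /\ I (Cstar_mul b a).

(* C*_r(G|_U): the closure of C_c(G|_U), whose elements are extended by 0 and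
   identified with constant sequences *)
Definition Cstar_restr U : set (nat -> G -> R[i]^o) :=
  completion_closure Cc rednorm
    [set a | exists2 f, Cc f /\ supp f `<=` reduction beta U & a = fun=> f].

Definition dynamical_ideal I : Prop :=
  exists U : set X, [/\ open U, invariant beta U & I = Cstar_restr U].

(* C_0(U), extended by 0 to X *)
Definition C0fun U (h : X -> R[i]^o) : Prop :=
  [/\ continuous h, forall x, ~ U x -> h x = 0
    & forall e : R, 0 < e -> compact [set x | e <= normc (h x)]].

(* C_0(U) in C*_r(G): the elements whose associated function on G, the
   pointwise limit of the sequence, is carried by the unit space and is there
   in C_0(U) *)
Definition C0 U : set (nat -> G -> R[i]^o) :=
  [set a | Cstar a /\ exists2 h, C0fun U h &
     forall gam : G, a n gam @[n --> \oo] -->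
       (if gam == unit_arrow beta (src gam) then h (src gam) else 0 : R[i]^o)].

Definition ideal_generated (S : set (nat -> G -> R[i]^o)) :=
  smallest closed_ideal S.

(* The dual action; on C_c(G) it is (alpha_chi f) gam = chi (c gam) * f gam *)
Definition dual_action (chi : Gam -> R[i]^o) a : nat -> G -> R[i]^o :=
  fun n gam => chi (coc gam) * a n gam.

Definition dual_invariant M : Prop :=
  forall chi, character chi -> forall a, M a -> M (dual_action chi a).

(* C_c(G) (x) C[Gam] is identified with a space of functions on G x Gam; its
   completion for the spatial norm, given by the representations Ind_u (x)
   lambda on l^2(s^-1(u) x Gam), is the minimal tensor product of C*_r(G) and
   C*_r(Gam). *)
Definition tens f (g : Gam -> R[i]^o) : G * Gam -> R[i]^o :=
  fun p => f p.1 * g p.2.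

Definition algtens : set (G * Gam -> R[i]^o) :=
  lspan [set F | exists f (g : Gam -> R[i]^o),
                    [/\ Cc f, finsupp g & F = tens f g]].

Definition Indlreg (u : X) (F : G * Gam -> R[i]^o) (xi : G * Gam -> R[i]^o) :
    G * Gam -> R[i]^o :=
  fun p => \sum_(q \in src_fiber beta u `*` [set: Gam])
     F (mul_arrow p.1 (inv_arrow q.1), q.2) * xi (q.1, (q.2^-1 * p.2)%g).

Definition minnorm (F : G * Gam -> R[i]^o) : \bar R :=
  ereal_sup [set opnorm (src_fiber beta u `*` [set: Gam])
                        (Indlreg u F) | u in [set: X]].

(* delta_c on C_c(G): f is the sum of its restrictions to the clopen sets
   c^-1(t), and the restriction to c^-1(t) is tensored with lambda_t *)
Definition coaction_fun f : G * Gam -> R[i]^o :=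
  fun p => \sum_(t \in [set: Gam])
     tens (fun gam => if coc gam == t then f gam else 0)
          (fun s => if s == t then 1 else 0) p.

Definition coaction a : nat -> G * Gam -> R[i]^o :=
  fun n => coaction_fun (a n).

Definition coaction_invariant M : Prop :=
  coaction @` M `<=` completion_closure algtens minnorm
    (lspan [set F | exists a (b : nat -> Gam -> R[i]^o),
       [/\ M a, Cstar_grp b & F = fun n => tens (a n) (b n)]]).

End GroupoidAlgebra.
Arguments C0 {R Gam X} beta U.

(* Main.v *)
Require Import Defs.
From mathcomp Require Import all_boot all_order all_algebra finmap.
From mathcomp Require Import all_classical all_reals all_analysis.
From mathcomp Require Import complex ring lra.

Set Implicit Arguments.
Unset Strict Implicit.
Unset Printing Implicit Defensive.

Import Order.TTheory GRing.Theory Num.Theory.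
Import numFieldNormedType.Exports.
Import ComplexField.Normc.

Local Open Scope classical_set_scope.
Local Open Scope ring_scope.
Local Open Scope complex_scope.

(** Elements of the reduced algebra are Cauchy sequences in C_c(G), and norms are
    only used through upper bounds: [kbound k M] says that the matrix [k] has
    operator norm at most [M], as tested on its finite blocks, and [redbound f M]
    that the matrices of all [Ind_x f] have norm at most [M].

    The proof is Fourier analysis along the cocycle.  Let [coef t a] be the
    restriction of [a] to the cocycle value [t].

    A dynamical ideal is the closure of a space of functions in C_c(G) cut out by
    a condition on sources, hence stable under restriction to a cocycle value.  It
    is therefore invariant, since characters act by conjugation with diagonal
    unitaries ([redbound_character]) and since the coaction is contractive by
    Fell's absorption principle ([minbound_coaction]).

    Conversely, an invariant closed ideal [I] contains the coefficients of its
    elements: they are limits of means of translates under the dual action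
    ([dual_invariant_coef], where characters of an abelian group that separate its
    points come from Zorn's lemma), or slices of the coaction
    ([coaction_invariant_coef]).  Let [U] be the set of the sources of the arrows
    at which some element of [I] is nonzero.  The squared moduli of the
    coefficients are functions on the unit space that belong to [I], so by
    compactness [I] contains C_0(U) ([C0_ideal_support]); on the other hand every
    coefficient is close to a product with a function in C_0(U), so it lies in the
    ideal [J] generated by C_0(U) ([coef_mem_generated]).

    It remains to see that an element [a] whose coefficients lie in a closed
    subspace [J] lies in [J] ([fejer]).  For a finitely supported multiplier [phi]
    of the group, the multiple of [a] by [phi] is a finite combination of
    coefficients; and multipliers act on the reduced algebra with norm at most
    their completely bounded norm, because a finite block of [Ind_x f] is unitarily
    equivalent to a matrix over the group algebra ([herz_schur]).  If the group is
    weakly amenable, these multiples converge to [a] in norm.  Under the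
    approximation property they converge weakly, which suffices by the
    Hahn-Banach theorem ([fejer_approximation]).

    Finally, the ideal generated by C_0(U) is the dynamical ideal of [U]
    ([ideal_generated_C0]).  Cutoff functions are replaced throughout by the
    truncation of a function at a small positive modulus ([trunc]). *)

(** * Finite l^2 norms of complex families *)

Section ComplexModulus.
Variable R : realType.
Implicit Types z w : R[i].

(** The head of the type of [normc] is not [R]; fixing it lets algebraic lemmas
    about [R] apply. *)
Definition cmod (z : R[i]) : R := normc z.

Lemma cmod0 : cmod 0 = 0. Proof. exact: normc0. Qed.
Lemma cmod1 : cmod 1 = 1. Proof. exact: normc1. Qed.
Lemma cmodM z w : cmod (z * w) = cmod z * cmod w. Proof. exact: normcM. Qed.
Lemma cmodV z : cmod z^-1 = (cmod z)^-1. Proof. exact: normcV. Qed.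
Lemma cmod_eq0 z : cmod z = 0 -> z = 0. Proof. exact: eq0_normc. Qed.

Lemma cmod_ge0 z : 0 <= cmod z.
Proof. by case: z => a b; rewrite /cmod /normc sqrtr_ge0. Qed.

Lemma cmodD z w : cmod (z + w) <= cmod z + cmod w.
Proof. exact: (@le_normcD R z w). Qed.

Lemma cmodN z : cmod (- z) = cmod z.
Proof. exact: (@complex.normcN R z). Qed.

Lemma cmodB z w : cmod (z - w) <= cmod z + cmod w.
Proof. by rewrite -[cmod w]cmodN cmodD. Qed.

Lemma cmod_distC z w : cmod (z - w) = cmod (w - z).
Proof. by rewrite -cmodN opprB. Qed.

Lemma cmod_norm z : `|z| = (cmod z)%:C.
Proof. by case: z. Qed.

Lemma cmod_real (x : R) : cmod x%:C = `|x|.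
Proof. by rewrite /cmod /normc /= expr0n /= addr0 sqrtr_sqr. Qed.

Lemma cmod_conj z : cmod z^*%C = cmod z.
Proof. by case: z => a b; rewrite /cmod /normc /= sqrrN. Qed.

Lemma cmodX z n : cmod (z ^+ n) = cmod z ^+ n.
Proof.
by elim: n => [|n IH]; rewrite ?expr0 ?cmod1 // !exprS cmodM IH.
Qed.

Lemma conj_mulE z : z^*%C * z = (cmod z ^+ 2)%:C.
Proof. by rewrite rmorphXn /= -cmod_norm sqr_normc mulrC. Qed.

Lemma cmod_ReIm z : cmod z <= `|complex.Re z| + `|complex.Im z|.
Proof.
case: z => a b /=.
rewrite -(@ler_pXn2r _ 2) ?nnegrE ?sqrtr_ge0 ?addr_ge0 //.
rewrite sqr_sqrtr ?addr_ge0 ?sqr_ge0 // sqrrD !real_normK ?num_real //.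
by rewrite lerD2r lerDl mulrn_wge0 // mulr_ge0.
Qed.

Lemma Re_cmod z : `|complex.Re z| <= cmod z.
Proof.
case: z => a b /=; rewrite -sqrtr_sqr ler_wsqrtr //.
by rewrite lerDl sqr_ge0.
Qed.

Lemma cmod_sum (I : Type) (s : seq I) (P : pred I) (F : I -> R[i]) :
  cmod (\sum_(i <- s | P i) F i) <= \sum_(i <- s | P i) cmod (F i).
Proof.
elim/big_ind2: _ => // [|x1 x2 y1 y2 h1 h2]; first by rewrite cmod0.
exact: le_trans (cmodD _ _) (lerD h1 h2).
Qed.

End ComplexModulus.
Arguments cmod : simpl never.

Section L2.
Variables (R : realType) (T : choiceType).
Implicit Types (E F : {fset T}) (v w : T -> R[i]).

Definition l2 E v : R := Num.sqrt (\sum_(i <- E) cmod (v i) ^+ 2).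

Lemma l2_sum_ge0 E v : 0 <= \sum_(i <- E) cmod (v i) ^+ 2.
Proof. by apply: sumr_ge0 => i _; rewrite sqr_ge0. Qed.

Lemma l2_ge0 E v : 0 <= l2 E v.
Proof. exact: sqrtr_ge0. Qed.

Lemma l2_sqr E v : l2 E v ^+ 2 = \sum_(i <- E) cmod (v i) ^+ 2.
Proof. by rewrite sqr_sqrtr // l2_sum_ge0. Qed.

Lemma eq_l2 E v w : {in E, v =1 w} -> l2 E v = l2 E w.
Proof.
by move=> h; congr Num.sqrt; apply: eq_big_seq => i iE; rewrite h.
Qed.

Lemma l2_le E v w : {in E, forall i, cmod (v i) <= cmod (w i)} ->
  l2 E v <= l2 E w.
Proof.
move=> h; rewrite /l2 ler_wsqrtr // !big_seq ler_sum // => i iE.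
by rewrite ler_pXn2r ?nnegrE ?cmod_ge0 // h.
Qed.

Lemma l2_subset E F v : (E `<=` F)%fset -> l2 E v <= l2 F v.
Proof.
move=> EF; rewrite /l2 ler_wsqrtr //.
rewrite (eq_big_seq (fun i => if i \in E then cmod (v i) ^+ 2 else 0)); last first.
  by move=> i ->.
rewrite (big_fset_incl _ EF) => [|i _ /negPf -> //].
by apply: ler_sum => i _; case: ifP => // _; exact: sqr_ge0.
Qed.

Lemma l2_widen E F v : (E `<=` F)%fset -> (forall i, i \notin E -> v i = 0) ->
  l2 F v = l2 E v.
Proof.
move=> EF v0; congr Num.sqrt; rewrite -(big_fset_incl _ EF) // => i _ /v0 ->.
by rewrite cmod0 expr0n.
Qed.

Lemma l2Z E (c : R[i]) v : l2 E (fun i => c * v i) = cmod c * l2 E v.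
Proof.
rewrite -[cmod c]ger0_norm ?cmod_ge0 // -sqrtr_sqr -sqrtrM ?sqr_ge0 //.
by congr Num.sqrt; rewrite mulr_sumr; apply: eq_bigr => i _; rewrite cmodM exprMn.
Qed.

(** Minkowski's inequality: by induction, it reduces to the triangle inequality
    of the complex modulus, as [l2 (i, E) v] is the modulus of
    [cmod (v i) +i* l2 E v]. *)
Lemma l2D E v w : l2 E (fun i => v i + w i) <= l2 E v + l2 E w.
Proof.
rewrite /l2; elim: (E : seq T) => [|i s IH].
  by rewrite !big_nil sqrtr0 addr0.
rewrite !big_cons.
pose n u : R := Num.sqrt (\sum_(j <- s) cmod (u j) ^+ 2).
have nE u : \sum_(j <- s) cmod (u j) ^+ 2 = n u ^+ 2.
  by rewrite sqr_sqrtr // sumr_ge0 // => j _; rewrite sqr_ge0.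
rewrite !nE.
apply: le_trans (_ : cmod ((cmod (v i) +i* n v) + (cmod (w i) +i* n w)) <= _);
  last exact: cmodD.
rewrite /= ler_wsqrtr // lerD // ler_pXn2r ?nnegrE ?addr_ge0 ?cmod_ge0 ?sqrtr_ge0 //.
exact: cmodD.
Qed.

Lemma l2_entry E v i : i \in E -> cmod (v i) <= l2 E v.
Proof.
move=> iE; rewrite -[leLHS]ger0_norm ?cmod_ge0 // -sqrtr_sqr ler_wsqrtr //.
rewrite (big_fsetD1 i) //= lerDl sumr_ge0 // => j _; exact: sqr_ge0.
Qed.

Lemma l2_le_sum E v : l2 E v <= \sum_(i <- E) cmod (v i).
Proof.
have s0 (s : seq T) : 0 <= \sum_(i <- s) cmod (v i).
  by apply: sumr_ge0 => i _; exact: cmod_ge0.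
rewrite -[leRHS]ger0_norm // -sqrtr_sqr ler_wsqrtr //.
elim: (E : seq T) => [|i s IH]; first by rewrite !big_nil expr0n.
rewrite !big_cons sqrrD; apply: le_trans (lerD (lexx _) IH) _.
by rewrite -addrA lerD2l lerDr mulrn_wge0 // mulr_ge0 ?cmod_ge0.
Qed.

End L2.

Lemma l2_imfset (R : realType) (S T : choiceType) (p : S -> T) (E : {fset S})
    (v : T -> R[i]) : injective p -> l2 (p @` E)%fset v = l2 E (v \o p).
Proof. by move=> pI; rewrite /l2 big_imfset //= => i j _ _; exact: pI. Qed.

(** * Matrices over infinite index sets *)

Section KernelBounds.
Variable R : realType.

(** The matrix [k] has operator norm at most [M].  Only finite blocks are tested,
    so that the bound makes sense for every matrix, is compatible with entrywise
    limits, and can be transported along injections of index sets. *)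
Definition kbound (T : choiceType) (k : T -> T -> R[i]) (M : R) : Prop :=
  forall (E F : {fset T}) (xi : T -> R[i]),
    l2 E (fun i => \sum_(j <- F) k i j * xi j) <= M * l2 F xi.

Section Basic.
Variable T : choiceType.
Implicit Types (k : T -> T -> R[i]) (M : R).

Lemma eq_kbound k k' M : (forall i j, k i j = k' i j) ->
  kbound k M -> kbound k' M.
Proof. by move=> kk' h; rewrite (_ : k' = k) //; do 2 apply/funext => ?. Qed.

Lemma kbound_le k M M' : M <= M' -> kbound k M -> kbound k M'.
Proof.
move=> MM' h E F xi; apply: le_trans (h E F xi) _.
by rewrite ler_wpM2r // l2_ge0.
Qed.

Lemma kbound_entry k M i j : kbound k M -> cmod (k i j) <= M.
Proof.
move=> /(_ [fset i]%fset [fset j]%fset (fun=> 1)).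
have l1 v (l : T) : l2 [fset l]%fset v = cmod (v l).
  by rewrite /l2 big_seq_fset1 sqrtr_sqr ger0_norm // cmod_ge0.
by rewrite !l1 big_seq_fset1 mulr1 cmod1 mulr1.
Qed.

Lemma kboundD k k' M M' : kbound k M -> kbound k' M' ->
  kbound (fun i j => k i j + k' i j) (M + M').
Proof.
move=> h h' E F xi; rewrite mulrDl.
apply: le_trans (lerD (h E F xi) (h' E F xi)).
apply: le_trans (l2D _ _ _); rewrite le_eqVlt; apply/orP; left; apply/eqP.
apply: eq_l2 => i _; rewrite -big_split /=.
by apply: eq_bigr => j _; rewrite mulrDl.
Qed.

(** [c] and [d] are the diagonals of diagonal matrices of norm [C] and [1]. *)
Lemma kbound_diag k M (c d : T -> R[i]) (C : R) : 0 <= M -> 0 <= C ->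
  (forall i, cmod (c i) <= C) -> (forall i, cmod (d i) <= 1) ->
  kbound k M -> kbound (fun i j => c i * k i j * d j) (C * M).
Proof.
move=> M0 C0 hc hd h E F xi.
apply: le_trans (_ : C * (M * l2 F (fun j => d j * xi j)) <= _); last first.
  rewrite -mulrA; apply: ler_wpM2l => //; apply: ler_wpM2l => //.
  apply: l2_le => j _; rewrite cmodM.
  by rewrite ler_piMl // cmod_ge0.
apply: le_trans (_ : C * l2 E (fun i => \sum_(j <- F) k i j * (d j * xi j)) <= _);
  last by rewrite ler_wpM2l //; exact: h'.
rewrite -[C in leRHS](ger0_norm C0) -cmod_real -l2Z; apply: l2_le => i _.
rewrite cmodM cmod_real ger0_norm //.
rewrite (_ : \sum_(j <- F) _ = c i * \sum_(j <- F) k i j * (d j * xi j)).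
  by rewrite cmodM ler_wpM2r // cmod_ge0.
by rewrite mulr_sumr; apply: eq_bigr => j _; rewrite !mulrA.
Qed.

Lemma kboundZ k M (z : R[i]) : 0 <= M -> kbound k M ->
  kbound (fun i j => z * k i j) (cmod z * M).
Proof.
move=> M0 h.
apply: (eq_kbound (k := fun i j => (fun=> z) i * k i j * (fun=> 1) j)) => [i j|].
  by rewrite mulr1.
by apply: kbound_diag => // [|i]; rewrite ?cmod_ge0 ?cmod1.
Qed.

Lemma kboundN k M : kbound k M -> kbound (fun i j => - k i j) M.
Proof.
move=> h E F xi; rewrite (_ : l2 E _ = l2 E (fun i => \sum_(j <- F) k i j * xi j)) //.
apply/le_anti/andP; split; apply: l2_le => i _;
  by rewrite -[X in X <= _]cmodN -sumrN; under eq_bigr do rewrite -mulNr ?opprK.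
Qed.

Lemma kboundB k k' M M' : kbound k M -> kbound k' M' ->
  kbound (fun i j => k i j - k' i j) (M + M').
Proof. by move=> h /kboundN; exact: kboundD. Qed.

Lemma kbound0 : kbound (fun _ _ : T => 0) 0.
Proof.
move=> E F xi; rewrite mul0r /l2 big1 ?sqrtr0 // => i _.
by rewrite big1 ?cmod0 ?expr0n // => j _; rewrite mul0r.
Qed.

Lemma kbound_sum (I : Type) (s : seq I) (k : I -> T -> T -> R[i]) (M : I -> R) :
  (forall l, kbound (k l) (M l)) ->
  kbound (fun i j => \sum_(l <- s) k l i j) (\sum_(l <- s) M l).
Proof.
move=> h; elim: s => [|l s IH].
  by rewrite big_nil; apply: eq_kbound kbound0 => i j; rewrite big_nil.
rewrite big_cons; apply: eq_kbound (kboundD (h l) IH) => i j.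
by rewrite big_cons.
Qed.

(** Lower semicontinuity of the operator norm for entrywise convergence: the
    entries of a finite block can be approximated simultaneously. *)
Lemma kbound_limit k M :
  (forall (E F : {fset T}) (e : R), 0 < e -> exists2 k', kbound k' M &
     forall i j, i \in E -> j \in F -> cmod (k i j - k' i j) <= e) ->
  kbound k M.
Proof.
move=> h E F xi; apply/ler_addgt0Pr => e e0.
pose C : R := \sum_(i <- E) \sum_(j <- F) cmod (xi j).
have C0 : 0 <= C.
  by apply: sumr_ge0 => i _; apply: sumr_ge0 => j _; exact: cmod_ge0.
have C1 : 0 < C + 1 by rewrite ltr_wpDl.
have [k' hk' kk'] := h E F (e / (C + 1)) (divr_gt0 e0 C1).
have -> : l2 E (fun i => \sum_(j <- F) k i j * xi j) =
    l2 E (fun i => (\sum_(j <- F) k' i j * xi j)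
                   + \sum_(j <- F) (k i j - k' i j) * xi j).
  apply: eq_l2 => i _; rewrite -big_split /=; apply: eq_bigr => j _.
  by rewrite -mulrDl addrCA subrr addr0.
apply: le_trans (l2D _ _ _) _; apply: lerD => //.
apply: le_trans (l2_le_sum _ _) _.
apply: le_trans (_ : \sum_(i <- E) \sum_(j <- F) e / (C + 1) * cmod (xi j) <= _).
  rewrite !big_seq; apply: ler_sum => i iE.
  apply: le_trans (cmod_sum _ _ _) _; rewrite !big_seq; apply: ler_sum => j jF.
  by rewrite cmodM ler_wpM2r ?cmod_ge0 // kk'.
under eq_bigr do rewrite -mulr_sumr.
rewrite -mulr_sumr -/C mulrAC ler_pdivrMr // ler_wpM2l ?(ltW e0) //.
by rewrite lerDl.
Qed.

(** A weighted partial permutation matrix has the norm of its weights. *)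
Lemma kbound_perm k M (phi : T -> T) : 0 <= M -> injective phi ->
  (forall i j, k i j != 0 -> j = phi i) -> (forall i j, cmod (k i j) <= M) ->
  kbound k M.
Proof.
move=> M0 phi_inj kphi kM E F xi.
rewrite -(@ler_pXn2r _ 2) ?nnegrE ?mulr_ge0 ?l2_ge0 // exprMn !l2_sqr.
have row i : \sum_(j <- F) k i j * xi j =
    if phi i \in F then k i (phi i) * xi (phi i) else 0.
  case: ifPn => iF.
    rewrite (big_fsetD1 (phi i)) //= big_seq big1 ?addr0 // => j.
    rewrite !inE => /andP[/eqP jn _].
    by have [->|/kphi //] := eqVneq (k i j) 0; rewrite mul0r.
  rewrite big_seq big1 // => j jF.
  have [->|/kphi jE] := eqVneq (k i j) 0; first by rewrite mul0r.
  by rewrite -jE jF in iF.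
pose E' := [fset i in E | phi i \in F]%fset.
apply: le_trans (_ : \sum_(i <- E') M ^+ 2 * cmod (xi (phi i)) ^+ 2 <= _).
  rewrite (big_fsetID _ (fun i => phi i \in F)) /=.
  rewrite [X in _ + X]big_seq [X in _ + X]big1 ?addr0.
    rewrite !big_seq; apply: ler_sum => i; rewrite !inE /= => /andP[_ iF].
    rewrite row iF cmodM exprMn ler_wpM2r ?sqr_ge0 //.
    by rewrite ler_pXn2r ?nnegrE ?cmod_ge0.
  by move=> i; rewrite !inE /= row => /andP[_ /negPf ->]; rewrite cmod0 expr0n.
rewrite -mulr_sumr ler_wpM2l ?sqr_ge0 //.
have <- : \sum_(j <- (phi @` E')%fset) cmod (xi j) ^+ 2 =
          \sum_(i <- E') cmod (xi (phi i)) ^+ 2.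
  by rewrite big_imfset //= => i j _ _; exact: phi_inj.
have sub : ((phi @` E') `<=` F)%fset.
  by apply/fsubsetP => j /imfsetP[i /=]; rewrite !inE /= => /andP[_ iF] ->.
by rewrite -!l2_sqr ler_pXn2r ?nnegrE ?l2_ge0 // l2_subset.
Qed.

End Basic.

(** Taking different maps on rows and columns gives off-diagonal blocks too. *)
Lemma kbound_compress (T S : choiceType) (k : T -> T -> R[i]) (M : R)
    (p q : S -> T) : injective p -> injective q ->
  kbound k M -> kbound (fun i j => k (p i) (q j)) M.
Proof.
move=> pI qI h E F xi.
pose eta (t : T) : R[i] :=
  if pselect (exists j, q j = t) is left e then xi (projT1 (cid e)) else 0.
have etaE j : eta (q j) = xi j.
  by rewrite /eta; case: pselect => [e|[]]; [case: cid => /= l /qI -> | exists j].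
have := h (p @` E)%fset (q @` F)%fset eta; rewrite !l2_imfset //.
rewrite (_ : eta \o q = xi); last by apply/funext => j; rewrite /= etaE.
apply: le_trans; rewrite le_eqVlt; apply/orP; left; apply/eqP.
apply: eq_l2 => i _ /=; rewrite big_imfset /=; last by move=> ? ? _ _; exact: qI.
by apply: eq_bigr => j _; rewrite etaE.
Qed.

(** The matrix [k] is block diagonal with blocks [k0]; [bk w] parametrizes the
    block of class [w]. *)
Lemma kbound_blocks (T S W : choiceType) (k : T -> T -> R[i])
    (k0 : S -> S -> R[i]) (M : R) (cl : T -> W) (pr : T -> S)
    (bk : W -> S -> T) : 0 <= M -> (forall i, bk (cl i) (pr i) = i) ->
  (forall i j, k i j = if cl i == cl j then k0 (pr i) (pr j) else 0) ->
  kbound k0 M -> kbound k M.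
Proof.
move=> M0 bkK kE h E F xi.
rewrite -(@ler_pXn2r _ 2) ?nnegrE ?mulr_ge0 ?l2_ge0 // exprMn !l2_sqr.
pose G := (E `|` F)%fset.
pose W0 := (cl @` G)%fset.
have split_cl (A : {fset T}) (f : T -> R) : (A `<=` G)%fset ->
    \sum_(i <- A) f i = \sum_(w <- W0) \sum_(i <- A | cl i == w) f i.
  move=> AG; rewrite (exchange_big_dep predT) //= big_seq [RHS]big_seq.
  apply: eq_bigr => i iA.
  rewrite -big_filter (_ : [seq w <- W0 | cl i == w] = [:: cl i]) ?big_seq1 //.
  apply: perm_small_eq => //; apply: uniq_perm => //.
    by rewrite filter_uniq ?fset_uniq.
  move=> w; rewrite mem_filter !inE eq_sym; case: eqVneq => //= ->.
  by rewrite in_imfset //=; exact: (fsubsetP AG).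
rewrite (split_cl E) ?fsubsetUl // (split_cl F) ?fsubsetUr // mulr_sumr.
apply: ler_sum => w _.
pose Ew := [fset i in E | cl i == w]%fset.
pose Fw := [fset i in F | cl i == w]%fset.
have bigw (A : {fset T}) (V : nmodType) (f : T -> V) :
    \sum_(i <- A | cl i == w) f i = \sum_(i <- [fset i in A | cl i == w]%fset) f i.
  by rewrite big_fset_condE.
have pr_inj (A : {fset T}) : {in [fset i in A | cl i == w]%fset &, injective pr}.
  move=> i j; rewrite !inE /= => /andP[_ /eqP iw] /andP[_ /eqP jw] ij.
  by rewrite -(bkK i) -(bkK j) iw jw ij.
have img (A : {fset T}) (V : nmodType) (f : S -> V) : {in A &, injective pr} ->
    \sum_(p <- (pr @` A)%fset) f p = \sum_(i <- A) f (pr i).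
  by move=> prI; rewrite big_imfset.
rewrite !bigw -/Ew -/Fw.
have sq (x y : R) : 0 <= x -> 0 <= y -> x <= y -> x ^+ 2 <= y ^+ 2.
  by move=> x0 y0; rewrite ler_pXn2r.
have := h (pr @` Ew)%fset (pr @` Fw)%fset (xi \o bk w).
move=> /(sq _ _ (l2_ge0 _ _) (mulr_ge0 M0 (l2_ge0 _ _))).
rewrite exprMn !l2_sqr !img; try exact: pr_inj.
rewrite [X in _ <= _ * X -> _](_ : _ = \sum_(i <- Fw) cmod (xi i) ^+ 2).
  apply: le_trans; rewrite le_eqVlt; apply/orP; left; apply/eqP.
  apply: eq_big_seq => i; rewrite !inE /= => /andP[iE /eqP iw].
  rewrite img; last exact: pr_inj.
  congr (cmod _ ^+ 2) => /=.
  have -> : \sum_(j <- Fw) k0 (pr i) (pr j) * xi (bk w (pr j)) =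
      \sum_(j <- F | cl j == w) k0 (pr i) (pr j) * xi j.
    rewrite bigw; apply: eq_big_seq => j; rewrite !inE /= => /andP[_ /eqP <-].
    by rewrite bkK.
  rewrite [RHS]big_mkcond /=; apply: eq_bigr => j _.
  by rewrite kE iw eq_sym; case: ifP; rewrite ?mul0r.
by apply: eq_big_seq => j; rewrite !inE /= => /andP[_ /eqP <-]; rewrite bkK.
Qed.

(** Row finiteness of [k] reduces the product, on a finite block, to finite sums. *)
Lemma kbound_comp (T : choiceType) (k k' : T -> T -> R[i]) (kk : T -> T -> R[i])
    (M M' : R) : 0 <= M ->
  (forall i, exists2 Q : {fset T}, (forall q, q \notin Q -> k i q = 0) &
     forall j, kk i j = \sum_(q <- Q) k i q * k' q j) ->
  kbound k M -> kbound k' M' -> kbound kk (M * M').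
Proof.
move=> M0 rows h h' E F xi.
have /choice[Q hQ] : forall i, exists Q : {fset T},
    (forall q, q \notin Q -> k i q = 0) /\
    forall j, kk i j = \sum_(q <- Q) k i q * k' q j.
  by move=> i; have [Q] := rows i; exists Q.
have Q1 i q : q \notin Q i -> k i q = 0 by case: (hQ i) => + _; apply.
have Q2 i j : kk i j = \sum_(q <- Q i) k i q * k' q j by case: (hQ i).
pose G := (\bigcup_(i <- E) Q i)%fset.
pose eta q := \sum_(j <- F) k' q j * xi j.
rewrite -mulrA; apply: (@le_trans _ _ (M * l2 G eta)); last by rewrite ler_wpM2l //; exact: h'.
rewrite (@eq_l2 _ _ _ _ (fun i => \sum_(q <- G) k i q * eta q)); first exact: h.
move=> i iE.
have QG : (Q i `<=` G)%fset by exact: bigfcup_sup iE _.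
rewrite -(big_fset_incl _ QG) /=; last by move=> q _ /Q1 ->; rewrite mul0r.
under [RHS]eq_bigr do rewrite mulr_sumr.
rewrite exchange_big /=; apply: eq_bigr => j _.
by rewrite Q2 mulr_suml; apply: eq_bigr => q _; rewrite mulrA.
Qed.

End KernelBounds.

Section OpNorm.
Variables (R : realType) (T S : choiceType) (A : set T) (e : S -> T).
Hypotheses (e_inj : injective e) (Ae : A = range e).

Lemma l2norm_le (xi : T -> R[i]^o) (M : R) : 0 <= M ->
  (l2norm A xi <= M%:E)%E <-> forall E : {fset S}, l2 E (xi \o e) <= M.
Proof.
move=> M0.
have sqrtM : M%:E = sqrte (M ^+ 2)%:E by rewrite /sqrte sqrtr_sqr ger0_norm.
rewrite /l2norm sqrtM lee_sqrt ?lee_fin ?sqr_ge0 //.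
have bij : set_bij [set: S] A e.
  rewrite Ae; split => [s _|x y _ _|//]; [by exists s | exact: e_inj].
rewrite (reindex_esum [set: S] A e) //=.
have sumE (E : {fset S}) : (\sum_(s <- E) (normc (xi (e s)) ^+ 2)%:E)%E
                           = (l2 E (xi \o e) ^+ 2)%:E.
  by rewrite sumEFin l2_sqr.
split=> [h E|h].
  rewrite -(@ler_pXn2r _ 2) ?nnegrE ?l2_ge0 //.
  rewrite -lee_fin -sumE; apply: le_trans h; apply: ereal_sup_ubound.
  exists [set` E] => //=; by rewrite fsbig_finite //= set_fsetK.
apply: ge_ereal_sup => _ [F [finF _] <-].
by rewrite fsbig_finite //= sumE lee_fin ler_pXn2r ?nnegrE ?l2_ge0.
Qed.

(** The norm of a row-finite operator is tested on finite blocks: a finite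
    block acts on finitely supported vectors, and conversely a finite part of
    [L xi] only depends on a finite part of [xi]. *)
Lemma opnorm_kbound (L : (T -> R[i]^o) -> (T -> R[i]^o)) (k : S -> S -> R[i])
    (M : R) : 0 <= M ->
  (forall s, exists2 Q : {fset S}, (forall r, r \notin Q -> k s r = 0) &
     forall xi, L xi (e s) = \sum_(r <- Q) k s r * xi (e r)) ->
  (opnorm A L <= M%:E)%E <-> kbound k M.
Proof.
move=> M0 rows.
have /choice[Q hQ] : forall s, exists Q : {fset S},
    (forall r, r \notin Q -> k s r = 0) /\
    forall xi, L xi (e s) = \sum_(r <- Q) k s r * xi (e r).
  by move=> s; have [Q] := rows s; exists Q.
have LE s (G : {fset S}) xi : (Q s `<=` G)%fset ->
    L xi (e s) = \sum_(r <- G) k s r * xi (e r).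
  move=> QG; case: (hQ s) => k0 ->; apply: (big_fset_incl _ QG) => r _ /k0 ->.
  by rewrite mul0r.
split=> [h E F xi|h].
  pose eta (t : T) : R[i] :=
    if pselect (exists s, s \in F /\ e s = t) is left h then xi (projT1 (cid h)) else 0.
  have etaE s : eta (e s) = if s \in F then xi s else 0.
    rewrite /eta; case: pselect => [ex|nex]; last first.
      by case: ifP => // sF; case: nex; exists s.
    by case: cid => /= r [rF /e_inj <-]; rewrite rF.
  have LetaE s : L eta (e s) = \sum_(r <- F) k s r * xi r.
    rewrite (LE s (Q s `|` F)%fset) ?fsubsetUl //.
    rewrite -(big_fset_incl _ (fsubsetUr (Q s) F)) /=; last first.
      by move=> r _ /negPf rF; rewrite etaE rF mulr0.
    by apply: eq_big_seq => r rF; rewrite etaE rF.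
  have n0 : 0 <= l2 F xi by exact: l2_ge0.
  have eta_norm (E' : {fset S}) : l2 E' (eta \o e) <= l2 F xi.
    apply: le_trans (l2_subset _ (fsubsetUl E' F)) _.
    rewrite (@l2_widen _ _ F) ?fsubsetUr //; last first.
      by move=> s /negPf sF; rewrite /= etaE sF.
    by apply: l2_le => s sF; rewrite /= etaE sF.
  have [xi0|xi_neq0] := eqVneq (l2 F xi) 0.
    rewrite xi0 mulr0 (@eq_l2 _ _ _ _ (fun=> 0)); last first.
      move=> i _; rewrite big_seq big1 // => j jF.
      have := l2_entry xi jF; rewrite xi0 => xij.
      have -> : xi j = 0 by apply: cmod_eq0; apply/le_anti; rewrite xij cmod_ge0.
      by rewrite mulr0.
    by rewrite /l2 big1 ?sqrtr0 // => i _; rewrite cmod0 expr0n.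
  pose c : R[i] := ((l2 F xi)^-1)%:C.
  have cc : cmod c = (l2 F xi)^-1 by rewrite cmod_real ger0_norm // invr_ge0.
  pose eta' : T -> R[i]^o := fun t => c * eta t.
  have /(l2norm_le _ M0) : (l2norm A (L eta') <= M%:E)%E.
    apply: le_trans h; apply: ereal_sup_ubound; exists eta' => //=.
    apply/(l2norm_le _ ler01) => E'.
    rewrite (@eq_l2 _ _ _ _ (fun s => c * (eta \o e) s)) // l2Z cc.
    by rewrite ler_pdivrMl ?mulr1 // lt_neqAle eq_sym xi_neq0.
  move=> /(_ E).
  rewrite (@eq_l2 _ _ _ _ (fun s => c * (\sum_(j <- F) k s j * xi j))); last first.
    move=> s _ /=; rewrite -LetaE; case: (hQ s) => _ LQ; rewrite !LQ mulr_sumr.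
    by apply: eq_bigr => r _; rewrite mulrCA.
  by rewrite l2Z cc mulrC ler_pdivrMr ?mulr1 // lt_neqAle eq_sym xi_neq0.
apply: ge_ereal_sup => _ [xi /= xi1 <-]; apply/(l2norm_le _ M0) => E.
pose G := (\bigcup_(s <- E) Q s)%fset.
rewrite (@eq_l2 _ _ _ _ (fun s => \sum_(r <- G) k s r * xi (e r))); last first.
  move=> s sE /=; apply: LE; exact: bigfcup_sup sE _.
apply: le_trans (h E G (xi \o e)) _; rewrite ler_piMr //.
by move/(l2norm_le _ ler01): xi1; apply.
Qed.

Lemma opnorm_ge0 (L : (T -> R[i]^o) -> (T -> R[i]^o)) : (0 <= opnorm A L)%E.
Proof.
apply: le_trans (ereal_sup_ubound _); last first.
  exists (fun=> 0) => //=; apply/(l2norm_le _ ler01) => E.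
  rewrite /l2 big1 ?sqrtr0 // => i _; by rewrite cmod0 expr0n.
exact: sqrte_ge0.
Qed.

End OpNorm.

(** * The reduced norm of finitely supported families *)

Section Groupoid.
Variables (R : realType) (Gam : groupType) (X : topologicalType).
Variable beta : Gam -> X -> X.
Hypothesis beta_action : is_action_by_homeos beta.
Local Notation G := (arrow beta).
Local Notation mk := (mkarrow beta).
Implicit Types (f g : G -> R[i]^o) (x : X) (s r t : Gam).

Lemma action1 x : beta 1%g x = x. Proof. by case: beta_action. Qed.

Lemma actionM s t x : beta (s * t)%g x = beta s (beta t x).
Proof. by case: beta_action. Qed.

Lemma action_continuous t : continuous (beta t). Proof. by case: beta_action. Qed.

Lemma actionK t : cancel (beta t) (beta t^-1%g).
Proof. by move=> x; rewrite -actionM mulVg action1. Qed.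

Lemma actionVK t : cancel (beta t^-1%g) (beta t).
Proof. by move=> x; rewrite -actionM mulgV action1. Qed.

Lemma arrow_eta (gam : G) : mk (coc gam) (src gam) = gam.
Proof.
by case: gam => -[[y t] x] /= e; apply: val_inj; rewrite /= /src /coc /=; move/eqP: (e) => /= ->.
Qed.

Lemma mkarrow_inj x : injective (mk^~ x).
Proof. by move=> s t st; exact: (congr1 (@coc _ _ beta) st). Qed.

Lemma src_fiberE x : src_fiber beta x = range (mk^~ x).
Proof.
apply/seteqP; split=> [gam /= <-|_ [t _ <-] //].
by exists (coc gam) => //; rewrite arrow_eta.
Qed.

(** The matrix of [Ind_x f] in the basis of l^2(s^-1(x)) indexed by the group *)
Definition gker x f s r : R[i] := f (mk (s / r)%g (beta r x)).

(** The reduced norm of [f] is at most [M].  This is used for functions outside of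
    C_c(G), for which the operators [Ind_x f] are not defined by finite sums. *)
Definition redbound f (M : R) : Prop := forall x, kbound (gker x f) M.

(** [Q] contains the cocycle values at which [f] does not vanish. *)
Definition gsupp (Q : {fset Gam}) f : Prop := forall t x, t \notin Q -> f (mk t x) = 0.

Lemma fsbig_src_fiber (V : nmodType) x (F : G -> V) :
  \sum_(gam \in src_fiber beta x) F gam = \sum_(t \in [set: Gam]) F (mk t x).
Proof.
apply: reindex_fsbig; rewrite src_fiberE.
by split => [s _|s t _ _|//]; [exists s | exact: mkarrow_inj].
Qed.

Lemma fsbig_gsupp (Q : {fset Gam}) (F : Gam -> R[i]^o) :
  (forall t, t \notin Q -> F t = 0) -> \sum_(t \in [set: Gam]) F t = \sum_(t <- Q) F t.
Proof. by move=> FQ; exact: fsbigTE. Qed.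

(** Those [r] for which [s / r] lies in [Q] *)
Definition rowsupp (Q : {fset Gam}) s : {fset Gam} := [fset (q^-1 * s)%g | q in Q]%fset.

Lemma notin_rowsupp Q s r : r \notin rowsupp Q s -> (s / r)%g \notin Q.
Proof.
apply: contra => sr; apply/imfsetP; exists (s / r)%g => //.
by rewrite invgM invgK -mulgA mulVg mulg1.
Qed.

Lemma gker_rows Q f x s r : gsupp Q f -> r \notin rowsupp Q s -> gker x f s r = 0.
Proof. by move=> fQ /notin_rowsupp; exact: fQ. Qed.

Lemma rednorm_le Q f (M : R) : 0 <= M -> gsupp Q f ->
  (rednorm f <= M%:E)%E <-> redbound f M.
Proof.
move=> M0 fQ.
have key x : (opnorm (src_fiber beta x) (Ind x f) <= M%:E)%E <-> kbound (gker x f) M.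
  apply: (opnorm_kbound (@mkarrow_inj x) (src_fiberE x)) => // s.
  exists (rowsupp Q s) => [r|xi]; first exact: gker_rows.
  rewrite /Ind fsbig_src_fiber; apply: fsbig_gsupp => r /(gker_rows x fQ) h.
  by rewrite [X in X * _]h mul0r.
split=> [h x|h].
  by apply/key; apply: le_trans h; apply: ereal_sup_ubound; exists x.
by apply: ge_ereal_sup => _ [x _ <-]; apply/key.
Qed.

Lemma convol_mk f g t x :
  convol f g (mk t x) = \sum_(q \in [set: Gam]) f (mk (t / q)%g (beta q x)) * g (mk q x).
Proof. by rewrite /convol fsbig_src_fiber. Qed.

Lemma convol_gsuppr Q f g t x : gsupp Q g ->
  convol f g (mk t x) = \sum_(q <- Q) f (mk (t / q)%g (beta q x)) * g (mk q x).
Proof.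
by move=> gQ; rewrite convol_mk (fsbig_gsupp (Q := Q)) // => q /gQ ->; rewrite mulr0.
Qed.

Lemma gsupp_convol Q Q' f g : gsupp Q f -> gsupp Q' g ->
  gsupp [fset (q * q')%g | q in Q, q' in Q']%fset (convol f g).
Proof.
move=> fQ gQ t x tn; rewrite (convol_gsuppr _ _ _ gQ) big_seq big1 // => q qQ.
rewrite fQ ?mul0r //; apply: contra tn => tq.
by apply/imfset2P; exists (t / q)%g => //; exists q => //; rewrite mulgVK.
Qed.

Lemma redbound_convol Q Q' f g (M M' : R) : 0 <= M -> gsupp Q f -> gsupp Q' g ->
  redbound f M -> redbound g M' -> redbound (convol f g) (M * M').
Proof.
move=> M0 fQ gQ fM gM x; apply: kbound_comp (fM x) (gM x) => // s.
exists (rowsupp Q s) => [q|r]; first exact: gker_rows.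
rewrite {1}/gker convol_mk (reindex_fsbigT (fun q => q / r)%g) /=; last first.
  by exists (fun q => q * r)%g => q; rewrite ?mulgVK ?mulgK.
rewrite (fsbig_gsupp (Q := rowsupp Q s)) => [|q /(gker_rows x fQ) h].
  apply: eq_bigr => q _; rewrite /gker -actionM mulgVK.
  by rewrite (_ : s / r / (q / r) = s / q)%g // mulgKA.
by rewrite -actionM mulgVK mulgKA [X in X * _]h mul0r.
Qed.

Lemma eq_redbound f g (M : R) : f =1 g -> redbound f M -> redbound g M.
Proof. by move=> fg h x; apply: eq_kbound (h x) => s r; exact: fg. Qed.

Lemma redbound_le f (M M' : R) : M <= M' -> redbound f M -> redbound f M'.
Proof. by move=> MM' h x; exact: kbound_le MM' (h x). Qed.

Lemma redboundD f g (M M' : R) : redbound f M -> redbound g M' ->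
  redbound (f + g) (M + M').
Proof. by move=> h h' x; exact: kboundD (h x) (h' x). Qed.

Lemma redboundB f g (M M' : R) : redbound f M -> redbound g M' ->
  redbound (f - g) (M + M').
Proof. by move=> h h' x; exact: kboundB (h x) (h' x). Qed.

Lemma redboundZ (z : R[i]) f (M : R) : 0 <= M -> redbound f M ->
  redbound (z *: f) (cmod z * M).
Proof. by move=> M0 h x; exact: kboundZ M0 (h x). Qed.

Lemma redbound0 : redbound 0 0.
Proof. by move=> x; exact: kbound0. Qed.

(** The inclusion of the reduced algebra into C_0(G) is norm-decreasing. *)
Lemma redbound_entry f (M : R) gam : redbound f M -> cmod (f gam) <= M.
Proof.
move=> /(_ (src gam)) h; have := @kbound_entry _ _ _ _ (coc gam) 1%g h.
by rewrite /gker divg1 action1 arrow_eta.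
Qed.

Definition restr t f : G -> R[i]^o := fun gam => if coc gam == t then f gam else 0.

Definition gmult (u : Gam -> R[i]^o) f : G -> R[i]^o := fun gam => u (coc gam) * f gam.

(** On a single cocycle value the reduced norm is the supremum norm. *)
Lemma redbound_restr t f (M : R) : 0 <= M ->
  (forall x, cmod (f (mk t x)) <= M) -> redbound (restr t f) M.
Proof.
move=> M0 fM x; apply: (kbound_perm (phi := fun s => t^-1 * s)%g) => //.
- exact: mulgI.
- move=> s r; rewrite /gker /restr /coc /=; case: ifP => [/eqP <- _|_]; last by rewrite eqxx.
  by rewrite invgM invgK -mulgA mulVg mulg1.
- move=> s r; rewrite /gker /restr; case: eqP => [e|_]; last by rewrite cmod0.
  by rewrite (_ : (s / r)%g = t).
Qed.

Lemma redbound_sum (I : Type) (l : seq I) (F : I -> G -> R[i]^o) (M : I -> R) :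
  (forall i, redbound (F i) (M i)) ->
  redbound (\sum_(i <- l) F i) (\sum_(i <- l) M i).
Proof.
move=> h; elim: l => [|i l IH]; first by rewrite !big_nil; exact: redbound0.
by rewrite !big_cons; exact: redboundD.
Qed.

Lemma restr_sum Q f : gsupp Q f -> f = \sum_(t <- Q) restr t f.
Proof.
move=> fQ; apply/funext => gam; rewrite fct_sumE -{1}(arrow_eta gam).
have [cQ|cQ] := boolP (coc gam \in Q); last first.
  rewrite fQ // big_seq big1 // => t tQ; rewrite /restr; case: eqP => // ct.
  by rewrite ct tQ in cQ.
rewrite (big_fsetD1 (coc gam)) //= big_seq big1 ?addr0.
  by rewrite /restr eqxx arrow_eta.
move=> t; rewrite !inE => /andP[/negPf tc _].
by rewrite /restr eq_sym tc.
Qed.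

(** A crude bound, which suffices for finitely many coordinates *)
Lemma redbound_gsupp Q f (M : R) : 0 <= M -> gsupp Q f ->
  (forall gam, cmod (f gam) <= M) -> redbound f (M *+ #|` Q|).
Proof.
move=> M0 fQ fM; rewrite {1}(restr_sum fQ).
have -> : M *+ #|` Q| = \sum_(t <- Q) M.
  by rewrite big_const_seq count_predT iter_addr_0.
by apply: redbound_sum => t; exact: redbound_restr.
Qed.

(** Pointwise limits of functions of norm at most [M] have norm at most [M]. *)
Lemma redbound_limit f (M : R) :
  (forall (S : {fset G}) (e : R), 0 < e -> exists2 f', redbound f' M &
     forall gam, gam \in S -> cmod (f gam - f' gam) <= e) ->
  redbound f M.
Proof.
move=> h x; apply: kbound_limit => E F e e0.
have [f' f'M ff'] := h [fset mk (s / r)%g (beta r x) | s in E, r in F]%fset e e0.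
exists (gker x f') => [|s r sE rF]; first exact: f'M.
by apply: ff'; apply/imfset2P; exists s => //; exists r.
Qed.

(** Characters act by conjugation with a diagonal unitary. *)
Lemma redbound_character (chi : Gam -> R[i]^o) f (M : R) : 0 <= M -> character chi ->
  redbound f M -> redbound (gmult chi f) M.
Proof.
move=> M0 [chiM chi1] fM x; rewrite -[M]mul1r.
apply: (eq_kbound (k := fun s r => chi s * gker x f s r * chi r^-1%g)).
  by move=> s r; rewrite /gker /gmult /= -[coc _]/(s / r)%g chiM mulrAC.
by apply: kbound_diag => // [s|r]; rewrite /cmod chi1.
Qed.

End Groupoid.

(** * Compactly supported functions on the space and on the groupoid *)

Section ComplexTopology.
Variable R : realType.

Lemma cmod_dist (z w : R[i]) : `|cmod z - cmod w| <= cmod (z - w).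
Proof.
have := cmodD (w - z) z; have := cmodD (z - w) w.
rewrite !subrK [cmod (w - z)]cmod_distC ler_norml => *; apply/andP; split; lra.
Qed.

Lemma cvg_cmodP (T : Type) (F : set_system T) (FF : Filter F) (f : T -> R[i]^o)
    (l : R[i]^o) :
  f @ F --> l <-> forall e : R, 0 < e -> \forall t \near F, cmod (l - f t) < e.
Proof.
rewrite cvgrPdist_lt; split=> h e e0.
  have /h : 0 < e%:C by rewrite ltcR.
  by apply: filterS => t; rewrite [X in X < _]cmod_norm ltcR.
case: e e0 => a b; rewrite ltcE /= => /andP[/eqP -> a0].
move: (h a a0); apply: filterS => t ht.
by rewrite [X in X < _]cmod_norm -[_ +i* 0]/(a%:C) ltcR.
Qed.

Lemma continuous_cmodP (X : topologicalType) (h : X -> R[i]^o) :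
  continuous h <-> forall x (e : R), 0 < e -> \forall y \near x, cmod (h x - h y) < e.
Proof.
by split => [hc x|hc x]; [apply/cvg_cmodP; exact: hc | apply/cvg_cmodP; exact: hc].
Qed.

Lemma continuous_cmod (X : topologicalType) (f : X -> R[i]^o) : continuous f ->
  continuous (fun x => cmod (f x)).
Proof.
move=> fc x; apply/cvgrPdist_lt => e e0.
move/continuous_cmodP: fc => /(_ x e e0); apply: filterS => y; apply: le_lt_trans.
exact: cmod_dist.
Qed.

Lemma maxr_dist (e a b : R) : `|Num.max a e - Num.max b e| <= `|a - b|.
Proof.
case: (leP a e) => ae; case: (leP b e) => be //; first by rewrite subrr normr0.
  by rewrite !ltr0_norm ?subr_lt0 ?(le_lt_trans ae) //; lra.
by rewrite !gtr0_norm ?subr_gt0 ?(le_lt_trans be) //; lra.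
Qed.

Lemma continuous_maxr (X : topologicalType) (f : X -> R) (e : R) : continuous f ->
  continuous (fun x => Num.max (f x) e).
Proof.
move=> fc x; apply/cvgrPdist_lt => d d0.
have /cvgrPdist_lt /(_ d d0) := fc x; apply: filterS => y.
exact: le_lt_trans (maxr_dist _ _ _).
Qed.

Lemma continuous_real_complex (X : topologicalType) (f : X -> R) : continuous f ->
  continuous (fun x => (f x)%:C : R[i]^o).
Proof.
move=> fc; apply/continuous_cmodP => x e e0.
have /cvgrPdist_lt /(_ e e0) := fc x; apply: filterS => y.
by rewrite -rmorphB /= cmod_real.
Qed.

Lemma continuous_conj (X : topologicalType) (f : X -> R[i]^o) : continuous f ->
  continuous (fun x => (f x)^*%C : R[i]^o).
Proof.
move=> fc; apply/continuous_cmodP => x e e0.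
move/continuous_cmodP: fc => /(_ x e e0); apply: filterS => y.
by rewrite -rmorphB /= cmod_conj.
Qed.

Lemma continuousMC (X : topologicalType) (f g : X -> R[i]^o) :
  continuous f -> continuous g -> continuous (fun x => f x * g x : R[i]^o).
Proof. by move=> fc gc x; apply: cvgM; [exact: fc|exact: gc]. Qed.

Lemma continuousDC (X : topologicalType) (f g : X -> R[i]^o) :
  continuous f -> continuous g -> continuous (fun x => f x + g x : R[i]^o).
Proof. by move=> fc gc x; apply: cvgD; [exact: fc|exact: gc]. Qed.

(** Compactness as an induction principle: the complements in [K] of the sets
    satisfying [P] would otherwise generate a proper filter without cluster
    point. *)
Lemma compact_ind (X : topologicalType) (K : set X) (P : set X -> Prop) :
  compact K -> P set0 -> (forall A B, A `<=` B -> P B -> P A) ->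
  (forall A B, P A -> P B -> P (A `|` B)) ->
  (forall x, K x -> exists2 V, nbhs x V & P V) -> P K.
Proof.
move=> cK P0 PS PU PV; apply: contrapT => nPK.
pose F : set_system X := [set A | exists2 B, P B & K `\` B `<=` A].
have FP : ProperFilter F.
  split; first by move=> [B PB KB]; apply: nPK; apply: PS PB => x Kx;
    apply: contrapT => nBx; exact: (KB x).
  split=> [|A A' [B PB BA] [B' PB' BA']|A A' AA' [B PB BA]].
  - by exists set0.
  - exists (B `|` B'); first exact: PU.
    by move=> x [Kx /not_orP[nB nB']]; split; [exact: BA|exact: BA'].
  - by exists B => //; exact: subset_trans AA'.
have FK : F K by exists set0 => //; exact: subDsetl.
have [x [Kx]] := cK F FP FK.
have [V Vx PVV] := PV x Kx.
have FV : F (K `\` V) by exists V.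
by move=> /(_ _ _ FV Vx) [y [[_ nV] Vy]].
Qed.

Definition Ccpt (X : topologicalType) (h : X -> R[i]^o) : Prop :=
  continuous h /\ compact (closure [set x | h x != 0]).

Section Ccpt.
Variable X : topologicalType.
Implicit Types (h g : X -> R[i]^o) (e : R).

Lemma Ccpt_sub h (K : set X) : continuous h -> compact K -> closed K ->
  (forall x, ~ K x -> h x = 0) -> Ccpt h.
Proof.
move=> hc cK clK hK; split=> //.
apply: (@subclosed_compact _ _ K) => //; first exact: closed_closure.
rewrite ((closure_id _).1 clK); apply: closureS => x /= /eqP hx.
by apply: contrapT => /hK.
Qed.

Lemma Ccpt0 : Ccpt (fun _ : X => 0 : R[i]^o).
Proof.
apply: (@Ccpt_sub _ set0); [|exact: compact0|exact: closed0|by []].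
by move=> x; exact: cvg_cst.
Qed.

Lemma CcptD h g : Ccpt h -> Ccpt g -> Ccpt (fun x => h x + g x).
Proof.
move=> [hc hK] [gc gK]; apply: (@Ccpt_sub _ (closure [set x | h x != 0] `|` closure [set x | g x != 0])).
- exact: continuousDC.
- exact: compactU.
- by apply: closedU; exact: closed_closure.
- move=> x /not_orP[nh ng].
  rewrite (_ : h x = 0) ?add0r; last by apply: contrapT => /eqP hx; apply: nh; exact: subset_closure.
  by apply: contrapT => /eqP hx; apply: ng; exact: subset_closure.
Qed.

Lemma CcptMl h g : continuous g -> Ccpt h -> Ccpt (fun x => g x * h x).
Proof.
move=> gc [hc hK]; apply: (Ccpt_sub _ hK).
- exact: continuousMC.
- exact: closed_closure.
- move=> x nh; rewrite (_ : h x = 0) ?mulr0 //.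
  by apply: contrapT => /eqP hx; apply: nh; exact: subset_closure.
Qed.

Lemma Ccpt_sum (I : Type) (l : seq I) (h : I -> X -> R[i]^o) :
  (forall i, Ccpt (h i)) -> Ccpt (fun x => \sum_(i <- l) h i x).
Proof.
move=> hc; elim: l => [|i l IH].
  by under eq_fun do rewrite big_nil; exact: Ccpt0.
by under eq_fun do rewrite big_cons; exact: CcptD.
Qed.

Lemma Ccpt_bounded h : Ccpt h -> exists2 M : R, 0 <= M & forall x, cmod (h x) <= M.
Proof.
move=> [/continuous_cmodP hc hK].
pose P (A : set X) := exists2 M : R, 0 <= M & forall x, A x -> cmod (h x) <= M.
have [||A B [M M0 AM] [M' M0' BM]|x _|M M0 KM] := @compact_ind _ _ P hK.
- by exists 0.
- by move=> A B AB [M M0 BM]; exists M => // x /AB /BM.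
- exists (M + M'); rewrite ?addr_ge0 // => x [/AM|/BM] xM; apply: le_trans xM _.
    by rewrite lerDl.
  by rewrite lerDr.
- exists [set y | cmod (h x - h y) < 1]; first exact: hc.
  exists (cmod (h x) + 1); first by rewrite addr_ge0 ?cmod_ge0.
  move=> y /ltW xy; rewrite -[h y](subKr (h x)).
  by apply: le_trans (cmodB _ _) _; rewrite lerD2l.
exists M => // x; have [->|hx] := eqVneq (h x) 0; first by rewrite cmod0.
by apply: KM; exact: subset_closure.
Qed.

(** Subtracting [e] from the modulus of [h], without changing its argument: this
    replaces a cutoff function where [h] is only small, not zero, outside of a
    compact set. *)
Definition trunc_weight (e : R) h x : R[i]^o := (1 - e / Num.max (cmod (h x)) e)%:C.

Definition trunc (e : R) h x : R[i]^o := trunc_weight e h x * h x.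

Lemma max_gt0 (e : R) (a : R) : 0 < e -> 0 < Num.max a e.
Proof. by move=> e0; rewrite lt_max e0 orbT. Qed.

Lemma continuous_trunc_weight e h : 0 < e -> continuous h ->
  continuous (trunc_weight e h).
Proof.
move=> e0 hc; apply: continuous_real_complex => x.
apply: cvgB; first exact: cvg_cst.
apply: cvgM; first exact: cvg_cst.
apply: cvgV; first by rewrite gt_eqF // max_gt0.
exact: continuous_maxr (continuous_cmod hc) _.
Qed.

Lemma trunc_weight_eq0 e h x : 0 < e -> cmod (h x) <= e -> trunc_weight e h x = 0.
Proof.
by move=> e0 he; rewrite /trunc_weight max_r // divff ?gt_eqF // subrr.
Qed.

Lemma trunc_dist e h x : 0 < e -> cmod (h x - trunc e h x) <= e.
Proof.
move=> e0; have m0 := max_gt0 (cmod (h x)) e0.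
rewrite /trunc /trunc_weight -{1}[h x]mul1r -mulrBl rmorphB /= opprB addrCA subrr addr0.
rewrite cmodM cmod_real ger0_norm ?divr_ge0 ?(ltW e0) ?(ltW m0) // mulrAC ler_pdivrMr //.
by rewrite ler_wpM2l ?(ltW e0) // le_max lexx.
Qed.

Lemma closed_cmod_ge e h : continuous h -> closed [set x | e <= cmod (h x)].
Proof.
move=> hc; apply: (@preimage_closed _ _ (fun x => cmod (h x)) [set y | e <= y]).
  by move=> x _; exact: continuous_cmod.
exact: closed_ge.
Qed.

Lemma Ccpt_trunc_weight e h : 0 < e -> continuous h -> compact [set x | e <= cmod (h x)] ->
  Ccpt (trunc_weight e h).
Proof.
move=> e0 hc hK; apply: (Ccpt_sub _ hK).
- exact: continuous_trunc_weight.
- exact: closed_cmod_ge.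
- by move=> x /= /negP; rewrite -ltNge => /ltW; exact: trunc_weight_eq0.
Qed.

Lemma Ccpt_trunc e h : 0 < e -> continuous h -> compact [set x | e <= cmod (h x)] ->
  Ccpt (trunc e h).
Proof.
move=> e0 hc hK; apply: (Ccpt_sub _ hK).
- by apply: continuousMC => //; exact: continuous_trunc_weight.
- exact: closed_cmod_ge.
- move=> x /= /negP; rewrite -ltNge => /ltW.
  by rewrite /trunc => /(trunc_weight_eq0 e0) ->; rewrite mul0r.
Qed.

Lemma compact_ge_Ccpt e h : 0 < e -> Ccpt h -> compact [set x | e <= cmod (h x)].
Proof.
move=> e0 [hc hK]; apply: (@subclosed_compact _ _ (closure [set x | h x != 0])) => //.
  exact: closed_cmod_ge.
move=> x /= ehx; apply: subset_closure => /=; apply/eqP => h0.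
by move: ehx; rewrite h0 cmod0 leNgt e0.
Qed.

End Ccpt.
End ComplexTopology.

Section GroupoidTopology.
Variables (R : realType) (Gam : groupType) (X : topologicalType).
Variable beta : Gam -> X -> X.
Hypothesis beta_action : is_action_by_homeos beta.
Hypothesis X_hausdorff : hausdorff_space X.
Local Notation G := (arrow beta).
Local Notation mk := (mkarrow beta).
Implicit Types (f g : G -> R[i]^o) (x : X) (s r t : Gam).

Let tri : Type := (X * discrete_topology Gam * X)%type.

Lemma continuous_mkarrow t : continuous (mk t).
Proof.
apply: continuous_comp_initial => x /=.
pose t' : discrete_topology Gam := t.
have h1 : (fun _ : X => t') @ x --> t' by exact: cvg_cst.
have h2 : (fun y => (beta t y, t')) @ x --> (nbhs (beta t x), nbhs t').
  exact: cvg_pair (action_continuous beta_action (t:=t) (x:=x)) h1.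
have h3 : (fun y => ((beta t y, t'), y)) @ x --> ((nbhs (beta t x), nbhs t'), nbhs x).
  exact: cvg_pair h2 cvg_id.
exact: h3.
Qed.

Let continuous_val : continuous (fun gam : G => sval gam : tri) := @initial_continuous _ _ _.

Lemma continuous_src : continuous (@src _ _ beta).
Proof.
by move=> gam; apply: cvg_comp (continuous_val (x:=gam)) _; exact: cvg_snd.
Qed.

Lemma nbhs_coc (gam : G) : \forall gam' \near gam, coc gam' = coc gam.
Proof.
pose D := discrete_topology Gam.
have h1 : (fun p : X * D * X => p.1) @ (sval gam : X * D * X) --> (sval gam).1.
  exact: cvg_fst.
have h2 : (fun p : X * D => p.2) @ ((sval gam).1 : X * D) --> (sval gam).1.2.
  exact: cvg_snd.
have h0 : (fun g : G => sval g : tri) @ gam --> (sval gam : tri) by exact: continuous_val.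
exact: (h0 _ (h1 _ (h2 _ (discrete_set1 ((sval gam).1.2 : D))))).
Qed.

Lemma closed_coc t : closed [set gam : G | coc gam = t].
Proof.
move=> gam /(_ _ (nbhs_coc gam)) [gam' /= [<- ->]] //.
Qed.

Lemma continuous_arrow f : (forall t, continuous (f \o mk t)) -> continuous f.
Proof.
move=> fc gam A hA.
have {}hA : nbhs ((f \o mk (coc gam)) (src gam)) A by rewrite /= arrow_eta.
have := @continuous_src gam _ (fc (coc gam) (src gam) _ hA).
apply: filterS2 (nbhs_coc gam) => gam' /= <-; by rewrite arrow_eta.
Qed.

Lemma Cc_gsupp f : Cc f -> exists Q, gsupp Q f.
Proof.
move=> [fc fK].
pose P (A : set G) := exists Q : {fset Gam}, forall gam, A gam -> coc gam \in Q.
have [||A B [Q AQ] [Q' BQ]|gam _|Q KQ] := @compact_ind _ _ P fK.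
- by exists fset0.
- by move=> A B AB [Q BQ]; exists Q => x /AB /BQ.
- by exists (Q `|` Q')%fset => x; rewrite inE => -[/AQ ->|/BQ ->]; rewrite ?orbT.
- exists [set gam' | coc gam' = coc gam]; first exact: nbhs_coc.
  by exists [fset coc gam]%fset => x /= ->; rewrite inE.
exists Q => t x; apply: contraNeq => fx.
by apply: (KQ (mk t x)); exact: subset_closure.
Qed.

Lemma Cc_piece f t : Cc f -> Ccpt (f \o mk t).
Proof.
move=> [fc fK].
have sK : compact (@src _ _ beta @` supp f).
  by apply: continuous_compact fK; apply: continuous_subspaceT; exact: continuous_src.
apply: (Ccpt_sub _ sK).
- by move=> x; apply: continuous_comp; [exact: continuous_mkarrow|exact: fc].
- exact: compact_closed.
- move=> x nx; apply: contrapT => /eqP fx; apply: nx.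
  by exists (mk t x) => //; exact: subset_closure.
Qed.

(** As the cocycle is locally constant, a function in C_c(G) is a finite family of
    functions in C_c(X), indexed by the cocycle values. *)
Lemma Cc_of_pieces Q f : gsupp Q f -> (forall t, Ccpt (f \o mk t)) -> Cc f.
Proof.
move=> fQ fp.
pose K t : set G := mk t @` closure [set x | (f \o mk t) x != 0].
have KE t : K t = [set gam | coc gam = t] `&`
                  @src _ _ beta @^-1` closure [set x | (f \o mk t) x != 0].
  apply/seteqP; split=> [_ [x xK <-] //|gam [/= <- sK]].
  by exists (src gam) => //; rewrite arrow_eta.
apply: (@Ccpt_sub _ _ _ (\big[setU/set0]_(t <- Q) K t)).
- by apply: continuous_arrow => t; case: (fp t).
- apply: bigsetU_compact => t _; apply: continuous_compact; last by case: (fp t).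
  by apply: continuous_subspaceT; exact: continuous_mkarrow.
- apply: closed_bigsetU => t _; rewrite KE; apply: closedI; first exact: closed_coc.
  apply: preimage_closed; last exact: closed_closure.
  by move=> gam' _; exact: continuous_src.
- move=> gam nK; rewrite -(arrow_eta gam).
  have [tQ|/fQ //] := boolP (coc gam \in Q).
  apply: contrapT => /eqP fx; apply: nK; rewrite -bigcup_seq /=.
  exists (coc gam) => //; exists (src gam); last exact: arrow_eta.
  exact: subset_closure.
Qed.

Lemma CcP f : Cc f <-> (exists Q, gsupp Q f) /\ forall t, Ccpt (f \o mk t).
Proof.
split=> [fc|[[Q fQ] fp]]; last exact: Cc_of_pieces fQ fp.
by split; [exact: Cc_gsupp|move=> t; exact: Cc_piece].
Qed.

Lemma Cc_bounded f : Cc f -> exists2 M : R, 0 <= M & forall gam, cmod (f gam) <= M.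
Proof. exact: (@Ccpt_bounded R G f). Qed.

Lemma Cc_redbound f : Cc f -> exists2 M : R, 0 <= M & redbound f M.
Proof.
move=> fc; have [M M0 fM] := Cc_bounded fc; have [Q fQ] := Cc_gsupp fc.
exists (M *+ #|` Q|); first exact: mulrn_wge0.
exact: redbound_gsupp.
Qed.

Lemma Cc0 : Cc (0 : G -> R[i]^o). Proof. exact: Ccpt0. Qed.

Lemma CcD f g : Cc f -> Cc g -> Cc (f + g). Proof. exact: CcptD. Qed.

Lemma CcZ (z : R[i]) f : Cc f -> Cc (z *: f).
Proof.
have zc : continuous (fun _ : G => z : R[i]^o) by exact: cst_continuous.
exact: CcptMl zc.
Qed.

Lemma CcB f g : Cc f -> Cc g -> Cc (f - g).
Proof. by move=> fc gc; rewrite -scaleN1r; apply: CcD => //; exact: CcZ. Qed.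

Lemma Cc_gmult (u : Gam -> R[i]^o) f : Cc f -> Cc (gmult u f).
Proof.
move=> /CcP[[Q fQ] fp]; apply/CcP; split.
  by exists Q => t x tQ; rewrite /gmult fQ ?mulr0.
move=> t; have uc : continuous (fun _ : X => u t : R[i]^o) by exact: cst_continuous.
exact: CcptMl uc (fp t).
Qed.

Lemma restr_gmult t f : restr t f = gmult (fun s => if s == t then 1 else 0) f.
Proof.
by apply/funext => gam; rewrite /restr /gmult; case: ifP; rewrite ?mul1r ?mul0r.
Qed.

Lemma Cc_restr t f : Cc f -> Cc (restr t f).
Proof. by rewrite restr_gmult; exact: Cc_gmult. Qed.

Lemma Ccpt_action t (h : X -> R[i]^o) : Ccpt h -> Ccpt (h \o beta t).
Proof.
move=> [hc hK].
have iK : compact (beta t^-1%g @` closure [set x | h x != 0]).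
  apply: continuous_compact hK; apply: continuous_subspaceT; exact: action_continuous.
apply: (Ccpt_sub _ iK).
- by move=> x; apply: continuous_comp; [exact: action_continuous|exact: hc].
- exact: compact_closed.
- move=> x nx; apply: contrapT => /eqP /= hx; apply: nx.
  exists (beta t x); [exact: subset_closure|exact: actionK].
Qed.

Lemma Cc_convol f g : Cc f -> Cc g -> Cc (convol f g).
Proof.
move=> /CcP[[Q fQ] fp] /CcP[[Q' gQ] gp]; apply/CcP; split.
  by exists [fset (q * q')%g | q in Q, q' in Q']%fset; exact: gsupp_convol.
move=> t; rewrite (_ : _ \o _ = fun x => \sum_(q <- Q')
    (f \o mk (t / q)%g) (beta q x) * (g \o mk q) x); last first.
  by apply/funext => x /=; rewrite (convol_gsuppr _ _ _ gQ).
apply: Ccpt_sum => q; apply: CcptMl; last exact: gp.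
by case: (@Ccpt_action q _ (fp (t / q)%g)).
Qed.

(** In crossed product notation, this is the function [h] times the canonical
    unitary of [t]. *)
Definition single t (h : X -> R[i]^o) : G -> R[i]^o :=
  fun gam => if coc gam == t then h (src gam) else 0.

Lemma single_mk t h s x : single t h (mk s x) = if s == t then h x else 0.
Proof. by []. Qed.

Lemma Cc_single t h : Ccpt h -> Cc (single t h).
Proof.
move=> hc; apply/CcP; split.
  by exists [fset t]%fset => s x; rewrite inE single_mk => /negPf ->.
move=> s; rewrite (_ : _ \o _ = if s == t then h else fun=> 0); last first.
  by apply/funext => x /=; rewrite single_mk; case: ifP.
by case: ifP => // _; exact: Ccpt0.
Qed.

Lemma gsupp_single t h : gsupp [fset t]%fset (single t h).
Proof. by move=> s x; rewrite inE single_mk => /negPf ->. Qed.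

Lemma restrE t f : restr t f = single t (f \o mk t).
Proof.
apply/funext => gam; rewrite /restr /single /=; case: eqP => // <-.
by rewrite arrow_eta.
Qed.

Lemma redbound_single t h (M : R) : 0 <= M -> (forall x, cmod (h x) <= M) ->
  redbound (single t h) M.
Proof.
move=> M0 hM; rewrite (_ : single t h = restr t (single t h)).
  by apply: redbound_restr => // x; rewrite single_mk eqxx.
by apply/funext => gam; rewrite /restr /single; case: ifP.
Qed.

Lemma convol_single t t' h h' :
  convol (single t h) (single t' h') =
  single (t * t')%g (fun x => h (beta t' x) * h' x) :> (G -> R[i]^o).
Proof.
apply/funext => gam; rewrite -(arrow_eta gam).
move: (coc gam) (src gam) => s x.
have gQ : gsupp [fset t']%fset (single t' h' : G -> R[i]^o) by exact: gsupp_single.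
rewrite (convol_gsuppr _ _ _ gQ) big_seq_fset1.
rewrite !single_mk eqxx divg_eq; case: ifP => //; by rewrite mul0r.
Qed.

Lemma singleB t h h' : single t h - single t h' = single t (h - h') :> (G -> R[i]^o).
Proof.
apply/funext => gam; rewrite /single [LHS]/GRing.add /= /GRing.opp /=.
by case: ifP => // _; rewrite subr0.
Qed.

End GroupoidTopology.

(** * Completions in terms of norm bounds *)

Section Completion.
Variables (R : realType) (V : lmodType R[i]) (D : set V) (N : V -> \bar R).
(** [nb v M] stands for [N v <= M], and may hold for [v] outside of [D].  The
    alternative [N_pos] accounts for suprema over an empty index set. *)
Variable nb : V -> R -> Prop.
Hypotheses (DB : forall v w, D v -> D w -> D (v - w))
  (N_nb : forall v (M : R), D v -> 0 <= M -> (N v <= M%:E)%E <-> nb v M)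
  (nbD : forall v w M M', nb v M -> nb w M' -> nb (v + w) (M + M'))
  (nbN : forall v M, nb v M -> nb (- v) M)
  (nb_fin : forall v, D v -> exists2 M : R, 0 <= M & nb v M)
  (N_pos : (forall v, D v -> (0 <= N v)%E) \/ (forall v, D v -> N v = -oo%E)).
Implicit Types (a b : nat -> V) (M : set (nat -> V)).

Lemma completion_mem a n : completion D N a -> D (a n).
Proof. by case. Qed.

Lemma completion_cauchy a (e : R) : completion D N a -> 0 < e ->
  \forall m \near \oo, \forall n \near \oo, nb (a n - a m) e.
Proof.
move=> [aD /(_ e)] + e0 => /(_ e0)[n0 h].
exists n0 => // m /= mn; exists n0 => // n /= nn.
by apply/N_nb; [exact: DB|exact: ltW|apply: ltW; exact: h].
Qed.

Lemma completion_intro a : (forall n, D (a n)) ->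
  (forall e : R, 0 < e -> exists v, \forall n \near \oo, nb (a n - v) e) ->
  completion D N a.
Proof.
move=> aD h; split=> // e e0; have e4 : 0 < e / 4 by rewrite divr_gt0.
have [v [n0 _ hv]] := h _ e4; exists n0 => m n mn nn.
apply: (@le_lt_trans _ _ (e / 4 + e / 4)%:E); last by rewrite lte_fin; lra.
apply/N_nb; [exact: DB|lra|].
rewrite (_ : a m - a n = (a m - v) + - (a n - v)); last first.
  by rewrite opprB addrA subrK.
by apply: nbD; [exact: hv|apply: nbN; exact: hv].
Qed.

Lemma completionB a b : completion D N a -> completion D N b ->
  completion D N (a - b).
Proof.
move=> ca cb; apply: completion_intro => [n|e e0].
  by apply: DB; exact: completion_mem.
have e2 : 0 < e / 2 by rewrite divr_gt0.
have [m [ham hbm]] : exists m, (\forall n \near \oo, nb (a n - a m) (e / 2)) /\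
    \forall n \near \oo, nb (b n - b m) (e / 2).
  near \oo => m; exists m; split; near: m; exact: completion_cauchy.
exists (a m - b m); apply: filterS2 ham hbm => n han hbn.
rewrite [e]splitr (_ : _ - _ = (a n - a m) + - (b n - b m)).
  by apply: nbD => //; exact: nbN.
by rewrite -[(a - b) n]/(a n - b n) !opprD !opprK addrACA.
Unshelve. all: by end_near.
Qed.

Lemma completion_bounded a : completion D N a ->
  exists2 M : R, 0 <= M & \forall n \near \oo, nb (a n) M.
Proof.
move=> ca; have [m hm] : exists m, \forall n \near \oo, nb (a n - a m) 1.
  by near \oo => m; exists m; near: m; exact: completion_cauchy.
have [M M0 aM] := nb_fin (completion_mem m ca).
exists (1 + M); first by rewrite addr_ge0.
by apply: filterS hm => n hn; rewrite -[a n](subrK (a m)); exact: nbD.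
Unshelve. all: by end_near.
Qed.

(** The limit defining the norm of the completion exists, by the reverse triangle
    inequality. *)
Lemma completion_norm_cvg a : (forall v, D v -> (0 <= N v)%E) ->
  completion D N a -> exists u : R^nat, [/\ N \o a = EFin \o u, cvgn u
    & completion_norm N a = (limn u)%:E].
Proof.
move=> N0 ca; have aD n := completion_mem n ca.
pose u n : R := fine (N (a n)).
have uE n : N (a n) = (u n)%:E.
  rewrite fineK // fin_numE; have [M M0 aM] := nb_fin (aD n).
  have := (N_nb (aD n) M0).2 aM; have := N0 _ (aD n).
  by case: (N (a n)).
have u0 n : 0 <= u n by rewrite -lee_fin -uE N0.
have uC : cvgn u.
  apply: cauchy_cvg; apply: cauchy_exP => e e0.
  have e2 : 0 < e / 2 by rewrite divr_gt0.
  have [m [n0 _ hm]] : exists m, \forall n \near \oo, nb (a n - a m) (e / 2).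
    by near \oo => m; exists m; near: m; exact: completion_cauchy.
  exists (u m); exists n0 => // n /hm /= anm.
  have nb_u k : nb (a k) (u k) by apply/(N_nb (aD k) (u0 k)); rewrite uE.
  have s0 k : 0 <= e / 2 + u k by rewrite addr_ge0 // ltW.
  have h1 : u n <= e / 2 + u m.
    rewrite -lee_fin -uE; apply/(N_nb (aD n) (s0 m)).
    by rewrite -[a n](subrK (a m)); exact: nbD.
  have h2 : u m <= e / 2 + u n.
    rewrite -lee_fin -uE; apply/(N_nb (aD m) (s0 n)).
    by rewrite -[a m](subrK (a n)) -(opprB (a n)); apply: nbD => //; exact: nbN.
  rewrite /ball /= ltr_norml; apply/andP; split; lra.
exists u; split=> //; first by apply/funext => n; exact: uE.
rewrite /completion_norm (_ : (fun n => N (a n)) = EFin \o u) ?EFin_lim //.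
by apply/funext => n; exact: uE.
Unshelve. all: by end_near.
Qed.

Lemma completion_norm_lt a (e : R) : 0 < e -> completion D N a ->
  (completion_norm N a < e%:E)%E -> \forall n \near \oo, nb (a n) e.
Proof.
move=> e0 ca; have aD n := completion_mem n ca.
case: N_pos => [N0|Noo]; last first.
  by move=> _; exists 0 => // n _ /=; apply/(N_nb (aD n) (ltW e0)); rewrite Noo ?leNye.
have [u [uE uC ->]] := completion_norm_cvg N0 ca; rewrite lte_fin => ue.
have hn : \forall n \near \oo, u n < e by exact: (cvgr_lt (limn u) uC).
apply: filterS hn => n une.
apply/(N_nb (aD n) (ltW e0)).
by rewrite -[N _]/((N \o a) n) uE lee_fin ltW.
Qed.

Lemma completion_norm_le a (M : R) : 0 <= M -> completion D N a ->
  (\forall n \near \oo, nb (a n) M) -> (completion_norm N a <= M%:E)%E.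
Proof.
move=> M0 ca; have aD n := completion_mem n ca.
case: N_pos => [N0|Noo]; last first.
  move=> _; rewrite /completion_norm (_ : (fun n => N (a n)) = cst -oo%E).
    by rewrite lim_cst ?leNye.
  by apply/funext => n; rewrite Noo.
have [u [uE uC ->]] := completion_norm_cvg N0 ca => h; rewrite lee_fin.
apply: limr_le => //; apply: filterS h => n /(N_nb (aD n) M0).
by rewrite -[N _]/((N \o a) n) uE lee_fin.
Qed.

(** Distances in the completion are tested on the tails of sequences. *)
Lemma completion_closureP M a : M `<=` completion D N ->
  completion_closure D N M a <-> completion D N a /\
    forall e : R, 0 < e -> exists2 b, M b & \forall n \near \oo, nb (a n - b n) e.
Proof.
move=> MC; split=> [[ca h]|[ca h]]; split=> // e e0.
  have [b Mb hb] := h e e0; exists b => //.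
  exact: completion_norm_lt (completionB ca (MC _ Mb)) hb.
have e2 : 0 < e / 2 by rewrite divr_gt0.
have [b Mb hb] := h _ e2; exists b => //.
apply: (@le_lt_trans _ _ (e / 2)%:E); last by rewrite lte_fin; lra.
by apply: completion_norm_le (completionB ca (MC _ Mb)) hb; exact: ltW.
Qed.

Section ClosedSubspace.
Variable M : set (nat -> V).
Hypothesis M_closed : closed_subspace D N M.

Lemma closed_subspace_mem a : M a -> completion D N a.
Proof. by case: M_closed => h _ _ _; exact: h. Qed.

Lemma closed_subspace0 : M 0. Proof. by case: M_closed. Qed.

Lemma closed_subspaceD a b : M a -> M b -> M (a + b).
Proof. by case: M_closed => _ _ h _ Ma Mb; rewrite -[a]scale1r; exact: h. Qed.

Lemma closed_subspaceZ (z : R[i]) a : M a -> M (z *: a).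
Proof.
by case: M_closed => _ M0 h _ Ma; rewrite -[z *: a]addr0; exact: h.
Qed.

Lemma closed_subspace_sum (I : Type) (l : seq I) (a : I -> nat -> V) :
  (forall i, M (a i)) -> M (\sum_(i <- l) a i).
Proof.
move=> Ma; elim: l => [|i l IH]; first by rewrite big_nil; exact: closed_subspace0.
by rewrite big_cons; exact: closed_subspaceD.
Qed.

Lemma closed_subspace_approx a : completion D N a ->
  (forall e : R, 0 < e -> exists2 b, M b & \forall n \near \oo, nb (a n - b n) e) ->
  M a.
Proof.
move=> ca h; case: (M_closed) => MC _ _; apply.
exact/completion_closureP.
Qed.

End ClosedSubspace.

Lemma closure_closed_subspace M : M `<=` completion D N -> M 0 ->
  (forall (z : R[i]) a b, M a -> M b -> M (z *: a + b)) ->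
  (forall (z : R[i]) v (e : R), 0 <= e -> nb v e -> nb (z *: v) (cmod z * e)) ->
  (forall v (z : R[i]), D v -> D (z *: v)) ->
  (forall v w, D v -> D w -> D (v + w)) ->
  nb 0 0 -> (forall v e e', e <= e' -> nb v e -> nb v e') ->
  closed_subspace D N (completion_closure D N M).
Proof.
move=> MC M0 ML nbZ DZ DD nb0 nb_le.
have cl a := completion_closureP a MC.
have clC a : completion_closure D N M a -> completion D N a by case.
split=> [a /clC //|||a].
- apply/cl; split; first exact: MC.
  move=> e e0; exists 0 => //; exists 0 => // n _ /=.
  by rewrite subrr; apply: nb_le nb0; exact: ltW.
- move=> z a b /cl[ca ha] /cl[cb hb].
  have z1 : 0 < cmod z + 1 by rewrite ltr_wpDl ?cmod_ge0.
  have key (e : R) : 0 < e -> forall (v v' w w' : V), nb (v - v') (e / 2 / (cmod z + 1)) ->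
      nb (w - w') (e / 2) -> nb ((z *: v + w) - (z *: v' + w')) e.
    move=> e0 v v' w w' hv hw.
    rewrite opprD addrACA -scalerBr [e]splitr; apply: nbD => //.
    apply: nb_le (nbZ _ _ _ _ hv); last by rewrite !divr_ge0 ?(ltW e0) ?(ltW z1).
    rewrite mulrA ler_pdivrMr // [leLHS]mulrC ler_wpM2l ?divr_ge0 ?(ltW e0) //.
    by rewrite lerDl.
  have eM (e : R) : 0 < e -> 0 < e / 2 / (cmod z + 1) by move=> e0; rewrite !divr_gt0.
  apply/cl; split.
    apply: completion_intro => [n|e e0].
      by apply: DD; [apply: DZ|]; exact: completion_mem.
    have [m [ham hbm]] : exists m,
        (\forall n \near \oo, nb (a n - a m) (e / 2 / (cmod z + 1))) /\
        \forall n \near \oo, nb (b n - b m) (e / 2).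
      near \oo => m; exists m; split; near: m; apply: completion_cauchy => //.
        exact: eM.
      by rewrite divr_gt0.
    exists (z *: a m + b m); apply: filterS2 ham hbm => n; exact: key.
  move=> e e0; have [a' Ma' ha'] := ha _ (eM e e0).
  have [b' Mb' hb'] := hb (e / 2) ltac:(by rewrite divr_gt0).
  exists (z *: a' + b'); first exact: ML.
  by apply: filterS2 ha' hb' => n; exact: key.
- move=> /(completion_closureP _ clC)[ca ha]; apply/cl; split=> // e e0.
  have e2 : 0 < e / 2 by rewrite divr_gt0.
  have [b /cl[cb hb] hab] := ha _ e2; have [c Mc hc] := hb _ e2.
  exists c => //; apply: filterS2 hab hc => n hab hc.
  by rewrite [e]splitr -(subrK (b n) (a n)) -addrA; exact: nbD.
Unshelve. all: by end_near.
Qed.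

End Completion.

(** * The reduced groupoid algebra *)

Section ReducedAlgebra.
Variables (R : realType) (Gam : groupType) (X : topologicalType).
Variable beta : Gam -> X -> X.
Hypothesis beta_action : is_action_by_homeos beta.
Hypothesis X_hausdorff : hausdorff_space X.
Local Notation G := (arrow beta).
Local Notation mk := (mkarrow beta).
Local Notation Cc := (@Cc R Gam X beta).
Local Notation Cstar := (@Cstar R Gam X beta).
Local Notation rednorm := (@rednorm R Gam X beta).
Implicit Types (f g : G -> R[i]^o) (x : X) (s r t : Gam) (U : set X).
Implicit Types (a b : nat -> G -> R[i]^o) (I M : set (nat -> G -> R[i]^o)).

Lemma rednormP f (M : R) : Cc f -> 0 <= M -> (rednorm f <= M%:E)%E <-> redbound f M.
Proof.
by move=> /Cc_gsupp[Q fQ] M0; exact: (rednorm_le M0 fQ).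
Qed.

(** On the empty space the supremum defining the reduced norm is empty. *)
Lemma rednorm_pos : (forall f, Cc f -> (0 <= rednorm f)%E) \/
  (forall f, Cc f -> rednorm f = -oo%E).
Proof.
have [[x _]|nx] := pselect (exists x : X, True); [left|right] => f _.
  apply: le_trans (ereal_sup_ubound _); last by exists x.
  exact: (opnorm_ge0 (@mkarrow_inj _ _ beta x) (src_fiberE beta x)).
rewrite /rednorm (_ : [set _ | _ in _] = set0) ?ereal_sup0 //.
by apply/seteqP; split => // y [x _ _]; apply: nx; exists x.
Qed.

Lemma redboundN f (M : R) : redbound f M -> redbound (- f) M.
Proof. by move=> h x; exact: kboundN (h x). Qed.

(* the hypotheses of the lemmas on completions, for the reduced norm *)
Let DB := @CcB R Gam X beta.
Let NP := rednormP.
Let nbD := @redboundD R Gam X beta.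
Let nbN := redboundN.
Let nbf := @Cc_redbound R Gam X beta.

Lemma Cstar_mem a n : Cstar a -> Cc (a n).
Proof. exact: completion_mem. Qed.

Lemma Cstar_cauchy a (e : R) : Cstar a -> 0 < e ->
  \forall m \near \oo, \forall n \near \oo, redbound (a n - a m) e.
Proof. exact: (completion_cauchy DB NP). Qed.

Lemma Cstar_intro a : (forall n, Cc (a n)) ->
  (forall e : R, 0 < e -> exists v, \forall n \near \oo, redbound (a n - v) e) ->
  Cstar a.
Proof. exact: (completion_intro DB NP nbD nbN). Qed.

Lemma CstarB a b : Cstar a -> Cstar b -> Cstar (a - b).
Proof. exact: (completionB DB NP nbD nbN). Qed.

Lemma Cstar_bounded a : Cstar a ->
  exists2 M : R, 0 <= M & \forall n \near \oo, redbound (a n) M.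
Proof. exact: (completion_bounded DB NP nbD nbf). Qed.

Lemma Cstar_const f : Cc f -> Cstar (fun=> f).
Proof.
move=> fc; apply: Cstar_intro => // e e0; exists f; exists 0 => // n _ /=.
by rewrite subrr; apply: redbound_le (@redbound0 R Gam X beta); exact: ltW.
Qed.

Lemma Cstar_approx a : (forall n, Cc (a n)) ->
  (forall e : R, 0 < e -> exists2 b, Cstar b & \forall n \near \oo, redbound (a n - b n) e) ->
  Cstar a.
Proof.
move=> ac h; apply: Cstar_intro => // e e0; have e2 : 0 < e / 2 by rewrite divr_gt0.
have [b cb ab] := h _ e2.
have [m bm] : exists m, \forall n \near \oo, redbound (b n - b m) (e / 2).
  by near \oo => m; exists m; near: m; exact: (Cstar_cauchy cb).
exists (b m); apply: filterS2 ab bm => n h1 h2.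
by rewrite [e]splitr -(subrK (b n) (a n)) -addrA; exact: redboundD.
Unshelve. all: by end_near.
Qed.

Lemma Cstar_closureP M a : M `<=` Cstar ->
  completion_closure Cc rednorm M a <-> Cstar a /\
    forall e : R, 0 < e -> exists2 b, M b & \forall n \near \oo, redbound (a n - b n) e.
Proof. exact: (completion_closureP DB NP nbD nbN nbf rednorm_pos). Qed.

Lemma closed_approx M a : closed_subspace Cc rednorm M -> Cstar a ->
  (forall e : R, 0 < e -> exists2 b, M b & \forall n \near \oo, redbound (a n - b n) e) ->
  M a.
Proof. by move=> M_cl; exact: (closed_subspace_approx DB NP nbD nbN nbf rednorm_pos M_cl). Qed.

(** Closed subspaces do not see the beginning of a Cauchy sequence. *)
Lemma closed_near M a b : closed_subspace Cc rednorm M -> Cstar a -> M b ->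
  (\forall n \near \oo, a n = b n) -> M a.
Proof.
move=> M_cl ca Mb ab; apply: closed_approx => // e e0; exists b => //.
apply: filterS ab => n ->; rewrite subrr.
by apply: redbound_le (@redbound0 R Gam X beta); exact: ltW.
Qed.

Lemma Cstar_gmult (u : Gam -> R[i]^o) (c : R) a : 0 <= c ->
  (forall f (M : R), 0 <= M -> redbound f M -> redbound (gmult u f) (c * M)) ->
  Cstar a -> Cstar (fun n => gmult u (a n)).
Proof.
move=> c0 hu ca; apply: Cstar_intro => [n|e e0].
  by apply: Cc_gmult => //; exact: Cstar_mem.
have c1 : 0 < c + 1 by rewrite ltr_wpDl.
near \oo => m; exists (gmult u (a m)).
have : \forall n \near \oo, redbound (a n - a m) (e / (c + 1)).
  by near: m; apply: Cstar_cauchy => //; rewrite divr_gt0.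
apply: filterS => n /hu -/(_ ltac:(by rewrite divr_ge0 // ltW)).
rewrite (_ : gmult u _ = gmult u (a n) - gmult u (a m)); last first.
  by apply/funext => gam; rewrite /gmult mulrBr.
apply: redbound_le; rewrite mulrA ler_pdivrMr // mulrC ler_wpM2l ?(ltW e0) //.
by rewrite lerDl.
Unshelve. all: by end_near.
Qed.

(** The Fourier coefficient of [a] at [t], as an element of the algebra *)
Definition coef t a : nat -> G -> R[i]^o := fun n => restr t (a n).

Lemma redbound_restrW t f (M : R) : 0 <= M -> redbound f M -> redbound (restr t f) M.
Proof.
move=> M0 fM; apply: redbound_restr => // x; exact: redbound_entry fM.
Qed.

Lemma Cstar_coef t a : Cstar a -> Cstar (coef t a).
Proof.
move=> ca; rewrite /coef; under eq_fun do rewrite restr_gmult.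
apply: (@Cstar_gmult _ 1) => // f M M0 fM.
by rewrite -restr_gmult mul1r; exact: redbound_restrW.
Qed.

Lemma restrB t f g : restr t (f - g) = restr t f - restr t g.
Proof.
apply/funext => gam; rewrite /restr -[RHS]/((if _ then _ else _) - (if _ then _ else _)).
by case: ifP => // _; rewrite subr0.
Qed.

Lemma convolBl f f' g : Cc g -> convol (f - f') g = convol f g - convol f' g.
Proof.
move=> /Cc_gsupp[Q gQ]; apply/funext => gam; rewrite -(arrow_eta gam).
rewrite -[RHS]/(convol f g _ - convol f' g _) !(convol_gsuppr _ _ _ gQ) -sumrB.
by apply: eq_bigr => q _; rewrite mulrBl.
Qed.

Lemma convolBr f g g' : Cc g -> Cc g' -> convol f (g - g') = convol f g - convol f g'.
Proof.
move=> /Cc_gsupp[Q gQ] /Cc_gsupp[Q' gQ'].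
have sQ (h : G -> R[i]^o) (P P' : {fset Gam}) : (P `<=` P')%fset -> gsupp P h -> gsupp P' h.
  by move=> PP hP t x tP; apply: hP; apply: contra tP; exact: (fsubsetP PP).
have g1 := sQ g _ _ (fsubsetUl Q Q') gQ.
have g2 := sQ g' _ _ (fsubsetUr Q Q') gQ'.
have g3 : gsupp (Q `|` Q')%fset (g - g').
  by move=> t x tQ; rewrite -[LHS]/(g _ - g' _) g1 // g2 // subr0.
apply/funext => gam; rewrite -(arrow_eta gam).
rewrite -[RHS]/(convol f g _ - convol f g' _).
rewrite (convol_gsuppr _ _ _ g1) (convol_gsuppr _ _ _ g2) (convol_gsuppr _ _ _ g3).
by rewrite -sumrB; apply: eq_bigr => q _; rewrite mulrBr.
Qed.

Lemma redbound_mul f g (M M' : R) : 0 <= M -> Cc f -> Cc g ->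
  redbound f M -> redbound g M' -> redbound (convol f g) (M * M').
Proof.
move=> M0 /Cc_gsupp[Q fQ] /Cc_gsupp[Q' gQ].
exact: redbound_convol M0 fQ gQ.
Qed.

(** Continuity of the product, in the form [f g - f' g' = f (g - g') + (f - f') g'];
    the increments [+ 1] keep the denominators positive. *)
Lemma mul_close f f' g g' (M M' e : R) : 0 <= M -> 0 <= M' -> 0 < e ->
  Cc f -> Cc f' -> Cc g -> Cc g' ->
  redbound f M -> redbound g' M' ->
  redbound (f - f') (e / 2 / (M' + 1)) -> redbound (g - g') (e / 2 / (M + 1)) ->
  redbound (convol f g - convol f' g') e.
Proof.
move=> M0 M0' e0 fc fc' gc gc' fM gM ff gg.
have e1 (c : R) : 0 <= c -> 0 <= e / 2 / (c + 1).
  by move=> c0; rewrite !divr_ge0 ?addr_ge0 // ltW.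
have e2 (c : R) : 0 <= c -> c * (e / 2 / (c + 1)) <= e / 2.
  move=> c0; rewrite mulrA ler_pdivrMr ?ltr_wpDl // mulrC ler_wpM2l ?divr_ge0 ?(ltW e0) //.
  by rewrite lerDl.
rewrite (_ : _ - _ = convol f (g - g') + convol (f - f') g'); last first.
  by rewrite convolBr // convolBl // addrA subrK.
rewrite [e]splitr; apply: redboundD.
  apply: redbound_le (e2 _ M0) _; apply: redbound_mul => //; exact: CcB.
apply: redbound_le (e2 _ M0') _; rewrite mulrC; apply: redbound_mul => //.
  exact: e1.
exact: CcB.
Qed.

Lemma Cstar_mulP a b : Cstar a -> Cstar b -> Cstar (Cstar_mul a b).
Proof.
move=> ca cb; apply: Cstar_intro => [n|e e0].
  by apply: Cc_convol => //; exact: Cstar_mem.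
have [M M0 hM] := Cstar_bounded ca; have [M' M0' hM'] := Cstar_bounded cb.
have d0 (c : R) : 0 <= c -> 0 < e / 2 / (c + 1).
  by move=> c0; rewrite !divr_gt0 // ltr_wpDl.
near \oo => m; exists (convol (a m) (b m)).
have ham : \forall n \near \oo, redbound (a n - a m) (e / 2 / (M' + 1)).
  by near: m; apply: Cstar_cauchy => //; exact: d0.
have hbm : \forall n \near \oo, redbound (b n - b m) (e / 2 / (M + 1)).
  by near: m; apply: Cstar_cauchy => //; exact: d0.
have hm : redbound (b m) M' by near: m.
near=> n; apply: (@mul_close _ _ _ _ M M') => //; try exact: Cstar_mem; by near: n.
Unshelve. all: by end_near.
Qed.

Lemma invariantP U : Defs.invariant beta U <-> forall t x, U x -> U (beta t x).
Proof.
split=> [-> t x [gam sU xE]|h].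
  exists (mk (t * coc gam)%g (src gam)); first exact: sU.
  rewrite /rng /= actionM // -xE; congr (beta t _).
  by rewrite -[in RHS](arrow_eta gam).
apply/seteqP; split=> [x Ux|_ [gam sU <-]].
  by exists (mk 1%g x) => //; exact: action1.
by rewrite -(arrow_eta gam); exact: h.
Qed.

Lemma image_invariantP U : (forall t, beta t @` U = U) <-> forall t x, U x -> U (beta t x).
Proof.
split=> [h t x Ux|h t]; first by rewrite -(h t); exists x.
apply/seteqP; split=> [_ [x Ux <-]|x Ux]; first exact: h.
by exists (beta t^-1%g x); [exact: h|exact: actionVK].
Qed.

Definition vanish_off U f : Prop := forall gam, ~ U (src gam) -> f gam = 0.

Lemma trunc_redbound (e : R) f Q : 0 < e -> gsupp Q f ->
  redbound (f - trunc e f) (e *+ #|` Q|).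
Proof.
move=> e0 fQ; apply: redbound_gsupp; first exact: ltW.
  move=> t x tQ; rewrite -[LHS]/(f _ - trunc e f _) /trunc fQ // mulr0 subr0 //.
by move=> gam; exact: (trunc_dist f).
Qed.

(** An element of C_c(G) vanishing outside of [U] is a limit of elements whose
    support lies in the reduction to [U]: truncate it. *)
Lemma Cstar_restrP U a : (forall t x, U x -> U (beta t x)) ->
  Cstar_restr U a <-> Cstar a /\ forall e : R, 0 < e ->
    exists f, [/\ Cc f, vanish_off U f & \forall n \near \oo, redbound (a n - f) e].
Proof.
move=> Uinv; rewrite /Cstar_restr.
have MC : [set b | exists2 f, Cc f /\ supp f `<=` reduction beta U & b = fun=> f] `<=` Cstar.
  by move=> _ [f [fc _] ->]; exact: Cstar_const.
split=> [/(Cstar_closureP _ MC)[ca h]|[ca h]].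
  split=> // e e0; have [_ [f [fc fU] ->] hf] := h e e0; exists f; split=> //.
  move=> gam nU; apply: contrapT => /eqP fgam; apply: nU.
  have sg : supp f gam by exact: subset_closure.
  by have [] := fU gam sg.
apply/(Cstar_closureP _ MC); split=> // e e0.
have e2 : 0 < e / 2 by rewrite divr_gt0.
have [f [fc fU hf]] := h _ e2.
have [Q fQ] := Cc_gsupp fc.
pose d : R := e / 2 / (#|` Q|.+1)%:R.
have d0 : 0 < d by rewrite divr_gt0 // ltr0n.
have [fcont fK] := fc.
have tc : Cc (trunc d f) by apply: Ccpt_trunc => //; exact: compact_ge_Ccpt.
exists (fun=> trunc d f).
  exists (trunc d f) => //; split=> // gam gamS.
  have /= fgam : d <= cmod (f gam).
    have cl : closed [set g : G | d <= cmod (f g)] by exact: closed_cmod_ge.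
    apply: (cl gam); move: gam gamS; apply: closureS => g /= /eqP tg.
    rewrite leNgt; apply/negP => /ltW gd.
    by apply: tg; rewrite /trunc (trunc_weight_eq0 d0 gd) mul0r.
  have sU : U (src gam).
    by apply: contrapT => /fU f0; move: fgam; rewrite f0 cmod0 leNgt d0.
  by split=> //=; rewrite -(arrow_eta gam); exact: Uinv.
apply: filterS hf => n hn; rewrite [e]splitr -(subrK f (a n)) -addrA.
apply: redboundD => //; apply: redbound_le (trunc_redbound d0 fQ).
by rewrite -[d *+ _]mulr_natr /d mulrAC ler_pdivrMr ?ltr0n // ler_wpM2l ?(ltW e2) // ler_nat.
Qed.

Lemma Cstar_restr_closed_subspace U : closed_subspace Cc rednorm (Cstar_restr U).
Proof.
apply: (closure_closed_subspace DB NP nbD nbN nbf rednorm_pos).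
- by move=> _ [f [fc _] ->]; exact: Cstar_const.
- exists 0 => //; split; first exact: Cc0.
  by rewrite /supp (_ : [set _ | _] = set0) ?closure0 //; apply/seteqP; split => // g /=; rewrite eqxx.
- move=> z _ _ [f [fc fU] ->] [g [gc gU] ->]; exists (z *: f + g) => //.
  split; first by apply: CcD => //; exact: CcZ.
  have : supp (z *: f + g) `<=` supp f `|` supp g.
    rewrite -closureU; apply: closureS => gam /=.
    apply: contraNP => /not_orP[/= /negP]; rewrite negbK => /eqP f0 /negP.
    rewrite negbK => /eqP g0; apply/eqP.
    by rewrite -[LHS]/(z * f gam + g gam) f0 g0 mulr0 addr0.
  by move=> /subset_trans; apply => gam [/fU|/gU].
- by move=> z f e; exact: redboundZ.
- by move=> f z; exact: CcZ.
- by move=> f g; exact: CcD.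
- exact: redbound0.
- by move=> f e e'; exact: redbound_le.
Qed.

Lemma vanish_convoll U f g : Cc g -> vanish_off U g -> vanish_off U (convol f g).
Proof.
move=> /Cc_gsupp[Q gQ] gU gam nU; rewrite -(arrow_eta gam).
by rewrite (convol_gsuppr _ _ _ gQ) big1 // => q _; rewrite gU ?mulr0.
Qed.

Lemma vanish_convolr U f g : (forall t x, U x -> U (beta t x)) ->
  Cc g -> vanish_off U f -> vanish_off U (convol f g).
Proof.
move=> Uinv /Cc_gsupp[Q gQ] fU gam nU; rewrite -(arrow_eta gam).
rewrite (convol_gsuppr _ _ _ gQ) big1 // => q _; rewrite fU ?mul0r //= => /(Uinv q^-1%g).
by rewrite actionK.
Qed.

(** Functions vanishing outside of an invariant set form an ideal of C_c(G), and
    [Cstar_restr U] is its closure. *)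
Lemma Cstar_restr_ideal U : (forall t x, U x -> U (beta t x)) ->
  closed_ideal (@Cstar_restr R Gam X beta U).
Proof.
move=> Uinv; split; first exact: Cstar_restr_closed_subspace.
move=> c a cc /(Cstar_restrP _ Uinv)[ca ha].
have [Mc Mc0 hMc] := Cstar_bounded cc; have [Ma Ma0 hMa] := Cstar_bounded ca.
have d0 (e M : R) : 0 < e -> 0 <= M -> 0 < e / 2 / (M + 1).
  by move=> e0 M0; rewrite !divr_gt0 // ltr_wpDl.
split; apply/(Cstar_restrP _ Uinv); split; try exact: Cstar_mulP; move=> e e0;
  have [f [fc fU hf]] := ha _ (d0 e _ e0 Mc0).
- have [Mf Mf0 hMf] := Cc_redbound fc.
  near \oo => m; exists (convol (c m) f); split.
  + by apply: Cc_convol => //; exact: Cstar_mem.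
  + exact: vanish_convoll.
  + have hc : \forall n \near \oo, redbound (c n - c m) (e / 2 / (Mf + 1)).
      by near: m; apply: Cstar_cauchy => //; exact: d0.
    near=> n; apply: (@mul_close _ _ _ _ Mc Mf) => //; try exact: Cstar_mem; by near: n.
- near \oo => m; exists (convol f (c m)); split.
  + by apply: Cc_convol => //; exact: Cstar_mem.
  + by apply: vanish_convolr => //; exact: Cstar_mem.
  + have hc : \forall n \near \oo, redbound (c n - c m) (e / 2 / (Ma + 1)).
      by near: m; apply: Cstar_cauchy => //; exact: d0.
    have hm : redbound (c m) Mc by near: m.
    near=> n; apply: (@mul_close _ _ _ _ Ma Mc) => //; try exact: Cstar_mem; by near: n.
Unshelve. all: by end_near.
Qed.

End ReducedAlgebra.

(** * Ideals generated by functions on the unit space *)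

Section UnitSpaceIdeals.
Variables (R : realType) (Gam : groupType) (X : topologicalType).
Variable beta : Gam -> X -> X.
Hypothesis beta_action : is_action_by_homeos beta.
Hypothesis X_hausdorff : hausdorff_space X.
Local Notation G := (arrow beta).
Local Notation mk := (mkarrow beta).
Local Notation Cc := (@Cc R Gam X beta).
Local Notation Cstar := (@Cstar R Gam X beta).
Local Notation rednorm := (@rednorm R Gam X beta).
Implicit Types (f : G -> R[i]^o) (g h : X -> R[i]^o) (x y : X) (s r t : Gam) (U : set X).
Implicit Types (a b c : nat -> G -> R[i]^o) (I J M : set (nat -> G -> R[i]^o)).

Let stable U := forall t x, U x -> U (beta t x).

Lemma near_fset (T : choiceType) (S : {fset T}) (P : T -> nat -> Prop) :
  (forall i, \forall n \near \oo, P i n) ->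
  \forall n \near \oo, forall i, i \in S -> P i n.
Proof.
move=> h; have : \forall n \near \oo, forall i, i \in (S : seq T) -> P i n.
  elim: (S : seq T) => [|i s IH]; first by exists 0.
  apply: filterS2 (h i) IH => n hi hs j; rewrite inE => /orP[/eqP -> //|]; exact: hs.
by [].
Qed.

(** By lower semicontinuity of the norm, an element of C_0(U) is the limit of
    the truncations of its associated function. *)
Lemma C0_approx U a (e : R) : C0 beta U a -> 0 < e ->
  exists h (K : set X), [/\ Ccpt h, compact K /\ K `<=` U, forall x, ~ K x -> h x = 0
    & \forall n \near \oo, redbound (a n - single 1%g h) e].
Proof.
move=> [ca [h0 [h0c h0U h0K] ah]] e0; have e2 : 0 < e / 2 by rewrite divr_gt0.
exists (trunc (e / 2) h0), [set x | e / 2 <= cmod (h0 x)]; split.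
- by apply: Ccpt_trunc => //; exact: h0K.
- split; first exact: h0K.
  move=> x /= hx; apply: contrapT => /h0U h0x.
  by move: hx; rewrite h0x cmod0 leNgt e2.
- move=> x /negP; rewrite -ltNge => /ltW hx.
  by rewrite /trunc trunc_weight_eq0 ?mul0r //.
near=> n.
rewrite [X in redbound _ X]splitr -(subrK (single 1%g h0) (a n)) -addrA; apply: redboundD; last first.
  rewrite singleB; apply: redbound_single; first exact: ltW.
  move=> x; rewrite -[(h0 - _) x]/(h0 x - trunc (e / 2) h0 x).
  exact: trunc_dist.
have an : \forall m \near \oo, redbound (a m - a n) (e / 2).
  by near: n; exact: Cstar_cauchy.
apply: redbound_limit => S d d0.
have hm : \forall m \near \oo, forall gam, gam \in S ->
    cmod (single 1%g h0 gam - a m gam) < d.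
  apply: near_fset => gam.
  have /cvg_cmodP /(_ d d0) := ah gam; apply: filterS => m.
  rewrite /single (_ : (gam == unit_arrow beta (src gam)) = (coc gam == 1%g)) //.
  apply/eqP/eqP => [->//|c1]; by rewrite -[LHS]arrow_eta c1.
have [m [am Sm]] : exists m, redbound (a m - a n) (e / 2) /\
    forall gam, gam \in S -> cmod (single 1%g h0 gam - a m gam) < d.
  near \oo => m; exists m; split; by near: m.
exists (a n - a m); first by rewrite -opprB; exact: redboundN.
move=> gam gS; rewrite cmod_distC.
rewrite (_ : _ - _ = single 1%g h0 gam - a m gam); first exact/ltW/Sm.
rewrite -[(a n - a m) gam]/(a n gam - a m gam).
rewrite -[(a n - single _ _) gam]/(a n gam - single 1%g h0 gam).
by rewrite opprB addrC addrA subrK.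
Unshelve. all: by end_near.
Qed.

Lemma C0_single U h : Ccpt h -> (forall x, ~ U x -> h x = 0) ->
  C0 beta U (fun=> single 1%g h).
Proof.
move=> hc hU; split; first by apply: Cstar_const => //; exact: Cc_single.
exists h; first by split => // [|e e0]; [case: hc|exact: compact_ge_Ccpt].
move=> gam; rewrite (_ : (gam == unit_arrow beta (src gam)) = (coc gam == 1%g)).
  exact: cvg_cst.
by apply/eqP/eqP => [->//|c1]; rewrite -[LHS]arrow_eta c1.
Qed.

(** Up to [e], the function [g] is a product of itself with a function in C_0(U). *)
Lemma single_approx U J t g (e : R) : closed_ideal J -> C0 beta U `<=` J -> 0 < e ->
  Ccpt g -> (forall x, e < cmod (g x) -> U x) ->
  exists f, [/\ Cc f, J (fun=> f) & redbound (single t g - f) e].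
Proof.
move=> [J_cl J_id] UJ e0 gc gU; have [gcont _] := gc.
have wc : Ccpt (trunc_weight e g) by apply: Ccpt_trunc_weight => //; exact: compact_ge_Ccpt.
have w0 x : ~ U x -> trunc_weight e g x = 0.
  move=> nU; apply: trunc_weight_eq0 => //; rewrite leNgt; apply/negP => /gU; exact: nU.
pose f := convol (single t g) (single 1%g (trunc_weight e g)) : G -> R[i]^o.
exists f; split.
- by apply: Cc_convol => //; exact: Cc_single.
- have Jw := UJ _ (C0_single wc w0).
  have [] := J_id (fun=> single t g) _ _ Jw => //.
  by apply: Cstar_const => //; exact: Cc_single.
- rewrite /f convol_single mulg1 singleB; apply: redbound_single; first exact: ltW.
  move=> x; rewrite -[_ x]/(g x - g (beta 1%g x) * trunc_weight e g x) action1 // mulrC.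
  exact: trunc_dist.
Qed.

Lemma single_mem U J t g : closed_ideal J -> C0 beta U `<=` J -> Ccpt g ->
  (forall x, ~ U x -> g x = 0) -> J (fun=> single t g).
Proof.
move=> J_id UJ gc gU; have [J_cl _] := J_id.
apply: closed_approx => //; first by apply: Cstar_const => //; exact: Cc_single.
move=> e e0.
have [|f [fc Jf gf]] := single_approx t J_id UJ e0 gc.
  move=> x gx; apply: contrapT => /gU g0.
  by move: gx; rewrite g0 cmod0 ltNge (ltW e0).
by exists (fun=> f) => //; exists 0.
Qed.

(** Both sides are closures of the functions in C_c(G) that vanish outside of [U]. *)
Lemma ideal_generated_C0 U : stable U ->
  ideal_generated (C0 beta U) = Cstar_restr U :> set (nat -> G -> R[i]^o).
Proof.
move=> Uinv; apply/seteqP; split=> a.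
  apply; split; first exact: Cstar_restr_ideal.
  move=> b bU; apply/Cstar_restrP => //; split; first by case: bU.
  move=> e e0; have [h [K [hc [_ KU] hK bh]]] := C0_approx bU e0.
  exists (single 1%g h); split=> //; first exact: Cc_single.
  move=> gam nU; rewrite /single; case: ifP => // _; apply: hK => /KU; exact: nU.
move=> /(Cstar_restrP _ Uinv)[] // ca ha J [J_id UJ]; have [J_cl _] := J_id.
apply: closed_approx => // e e0; have [f [fc fU hf]] := ha e e0.
exists (fun=> f) => //; have [Q fQ] := Cc_gsupp fc.
rewrite (restr_sum fQ) (_ : (fun=> _) = \sum_(t <- Q) (fun _ : nat => restr t f)); last first.
  by rewrite (fct_sumE _ _ (fun t (_ : nat) => restr t f)).
apply: (closed_subspace_sum J_cl) => t; rewrite restrE; apply: (single_mem (U := U)) => //.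
  exact: Cc_piece.
by move=> x nU; exact: fU.
Qed.

(** The product of the adjoint of [coef t a] with [coef t a] is the function
    mapping [x] to the squared modulus of [a] at the arrow [mk t x]. *)
Lemma coef_square_mem I t a : closed_ideal I -> Cstar a -> I (coef t a) ->
  I (fun n => single 1%g (fun x => (cmod (a n (mk t x)) ^+ 2)%:C : R[i]^o)).
Proof.
move=> [_ I_id] ca Ia.
pose astar n : G -> R[i]^o :=
  single t^-1%g (fun x => (a n (mk t (beta t^-1%g x)))^*%C : R[i]^o).
have cstar : Cstar astar.
  have pc n := Cc_piece beta_action X_hausdorff t (Cstar_mem n ca).
  apply: Cstar_intro => // [n|e e0].
    apply: Cc_single => //.
    have [pcont pK] := Ccpt_action beta_action X_hausdorff t^-1%g (pc n).
    split; first exact: continuous_conj pcont.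
    rewrite (_ : [set x | _ != 0] = [set x | ((a n \o mk t) \o beta t^-1%g) x != 0]) //.
    apply/seteqP; split=> x /=; apply: contra_neq => h; first by rewrite h rmorph0.
    by rewrite -[LHS]conjcK h rmorph0.
  near \oo => m; exists (astar m).
  have : \forall n \near \oo, redbound (a n - a m) e by near: m; exact: Cstar_cauchy.
  apply: filterS => n anm; rewrite singleB; apply: redbound_single; first exact: ltW.
  move=> x; rewrite -[_ x]/(_ - _) -rmorphB /= cmod_conj.
  exact: (redbound_entry beta_action _ anm).
have [+ _] := I_id astar _ cstar Ia.
rewrite (_ : Cstar_mul _ _ = fun n => single 1%g (fun x =>
    (cmod (a n (mk t x)) ^+ 2)%:C : R[i]^o)) //.
apply/funext => n; rewrite /Cstar_mul /coef restrE convol_single mulVg.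
by congr (single 1%g _); apply/funext => x /=; rewrite actionK // conj_mulE.
Unshelve. all: by end_near.
Qed.

(** The sources of the arrows at which some element of the ideal does not vanish.
    The value of [a] at an arrow is the limit of the numerical sequence [a n];
    it is nonzero when this sequence is eventually bounded below. *)
Definition ideal_support I : set X := [set x | exists a t (d : R),
  [/\ I a, 0 < d & \forall n \near \oo, d <= cmod (a n (mk t x))]].

Lemma ideal_support_nbhs a t x (d : R) : Cstar a -> 0 < d ->
  (\forall n \near \oo, d <= cmod (a n (mk t x))) ->
  exists2 V, nbhs x V & \forall n \near \oo, forall y, V y -> d / 4 <= cmod (a n (mk t y)).
Proof.
move=> ca d0 hd; have d4 : 0 < d / 4 by rewrite divr_gt0.
have [m [dm am]] : exists m, d <= cmod (a m (mk t x)) /\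
    \forall n \near \oo, redbound (a n - a m) (d / 4).
  near \oo => m; exists m; split; near: m => //; exact: Cstar_cauchy.
have [/continuous_cmodP pc _] := Cc_piece beta_action X_hausdorff t (Cstar_mem m ca).
exists [set y | cmod ((a m \o mk t) x - (a m \o mk t) y) < d / 4]; first exact: pc.
apply: filterS am => n anm y /= /ltW yx.
have h1 : cmod (a n (mk t y) - a m (mk t y)) <= d / 4.
  exact: (redbound_entry beta_action (mk t y) anm).
have h2 := cmodD (a m (mk t x) - a m (mk t y)) (a m (mk t y)).
have h3 := cmodD (a m (mk t y) - a n (mk t y)) (a n (mk t y)).
rewrite subrK in h2; rewrite subrK [cmod (a m _ - _)]cmod_distC in h3.
by rewrite /= in yx; lra.
Unshelve. all: by end_near.
Qed.

Lemma ideal_support_open I : I `<=` Cstar -> open (ideal_support I).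
Proof.
move=> IC; rewrite openE => x [a [t [d [Ia d0 hd]]]].
have [V Vx hV] := ideal_support_nbhs (IC _ Ia) d0 hd.
apply: filterS Vx => y Vy; exists a, t, (d / 4); split; rewrite ?divr_gt0 //.
by apply: filterS hV => n; exact.
Qed.

(** If [a] does not vanish at [mk s x], then multiplying [a] by a function carried
    by the cocycle value [t^-1] moves the source of this arrow to [beta t x]. *)
Lemma ideal_support_invariant I : closed_ideal I -> stable (ideal_support I).
Proof.
move=> [I_cl I_id] t x [a [s [d [Ia d0 hd]]]].
have ca := closed_subspace_mem I_cl Ia.
have [m dm] : exists m, d <= cmod (a m (mk s x)) by near \oo => m; exists m; near: m.
(* [k] takes the nonzero value [a m (mk s x)] at [mk t^-1 (beta t x)] *)
pose k : G -> R[i]^o := single t^-1%g ((a m \o mk s) \o beta t^-1%g).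
have kc : Cc k.
  apply: Cc_single => //; apply: Ccpt_action => //; apply: Cc_piece => //.
  exact: Cstar_mem.
have [_ Iak] := I_id (fun=> k) a (Cstar_const kc) Ia.
exists (Cstar_mul a (fun=> k)), (s / t)%g, (d * d); split; rewrite ?mulr_gt0 //.
apply: filterS hd => n dn; rewrite /Cstar_mul (convol_gsuppr _ _ _ (gsupp_single _ _)).
rewrite big_seq_fset1 /k single_mk eqxx /= actionK // invgK mulgVK cmodM.
by rewrite ler_pM // ltW.
Unshelve. all: by end_near.
Qed.

Section IdealWithCoefficients.
Variable I : set (nat -> G -> R[i]^o).
Hypotheses (I_ideal : closed_ideal I) (I_coef : forall t a, I a -> I (coef t a)).

Let I_cl : closed_subspace Cc rednorm I := proj1 I_ideal.
Let IC a : I a -> Cstar a := closed_subspace_mem I_cl (a := a).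

(** On a compact part of its support, the ideal contains a positive function on
    the unit space that is bounded below. *)
Lemma positive_on_compact (K : set X) : compact K -> K `<=` ideal_support I ->
  exists (g : nat -> X -> R) (d : R),
    [/\ I (fun n => single 1%g (fun x => (g n x)%:C : R[i]^o)), forall n x, 0 <= g n x,
        0 < d & \forall n \near \oo, forall x, K x -> d <= g n x].
Proof.
move=> cK KI; pose P (A : set X) := exists (g : nat -> X -> R) (d : R),
  [/\ I (fun n => single 1%g (fun x => (g n x)%:C : R[i]^o)), forall n x, 0 <= g n x,
      0 < d & \forall n \near \oo, forall x, A x -> d <= g n x].
apply: (@compact_ind _ K P) => //.
- exists (fun _ _ => 0), 1; split=> //; last by exists 0.
  rewrite (_ : (fun n => _) = 0); first exact: closed_subspace0 I_cl.
  by apply/funext => n; apply/funext => gam; rewrite /single; case: ifP.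
- move=> A B AB [g [d [Ig g0 d0 hg]]]; exists g, d; split=> //.
  by apply: filterS hg => n hn x /AB; exact: hn.
- move=> A B [g [d [Ig g0 d0 hg]]] [g' [d' [Ig' g0' d0' hg']]].
  exists (fun n x => g n x + g' n x), (Num.min d d'); split.
  + have := closed_subspaceD I_cl Ig Ig'; congr I.
    apply/funext => n; apply/funext => gam.
    rewrite -[LHS]/(single _ _ gam + single _ _ gam) /single; case: ifP; rewrite ?addr0 //.
    by rewrite rmorphD.
  + by move=> n x; rewrite addr_ge0.
  + by rewrite lt_min d0 d0'.
  + apply: filterS2 hg hg' => n hn hn' x [/hn|/hn'] h; rewrite ge_min.
      by rewrite (le_trans h) // lerDl.
    by rewrite orbC (le_trans h) // lerDr.
- move=> x /KI[a [t [d [Ia d0 hd]]]]; have ca := IC Ia.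
  have [V Vx hV] := ideal_support_nbhs ca d0 hd.
  exists V => //; exists (fun n y => cmod (a n (mk t y)) ^+ 2), ((d / 4) ^+ 2); split.
  + exact: (coef_square_mem I_ideal ca (I_coef t Ia)).
  + by move=> n y; exact: sqr_ge0.
  + by rewrite exprn_gt0 // divr_gt0.
  + apply: filterS hV => n hn y /hn h.
    by rewrite ler_pXn2r ?nnegrE ?cmod_ge0 // divr_ge0 ?(ltW d0).
Qed.

Lemma inv_max_dist (d p q : R) : 0 < d ->
  `|(Num.max p d)^-1 - (Num.max q d)^-1| <= `|p - q| / d ^+ 2.
Proof.
move=> d0; have p0 := max_gt0 p d0; have q0 := max_gt0 q d0.
have pd : d <= Num.max p d by rewrite le_max lexx orbT.
have qd : d <= Num.max q d by rewrite le_max lexx orbT.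
have -> : (Num.max p d)^-1 - (Num.max q d)^-1 =
    (Num.max q d - Num.max p d) / (Num.max p d * Num.max q d).
  by field; rewrite !gt_eqF.
rewrite normrM normfV [X in _ / X]gtr0_norm ?mulr_gt0 //.
rewrite distrC; apply: ler_pM => //; first by rewrite invr_ge0 mulr_ge0 // ltW.
  exact: maxr_dist.
by rewrite lef_pV2 ?posrE ?mulr_gt0 ?exprn_gt0 // expr2 ler_pM // ltW.
Qed.

(** A function [h] vanishing outside of a compact part [K] of the support is the
    product of the quotient [h / g] with the element [g] of the ideal that is
    bounded below on [K]. *)
Lemma C0_ideal_support : C0 beta (ideal_support I) `<=` I.
Proof.
move=> a aU; have ca : Cstar a by case: aU.
apply: closed_approx => // e e0.
have [h [K [hc [cK KU] hK ah]]] := C0_approx aU e0.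
exists (fun=> single 1%g h) => //.
have [g [d [Ig g0 d0 hg]]] := positive_on_compact cK KU.
have cg := IC Ig.
have [B B0 hB] := Ccpt_bounded hc.
have gdist n m (e' : R) : redbound ((single 1%g (fun x => (g n x)%:C : R[i]^o) : G -> R[i]^o)
      - single 1%g (fun x => (g m x)%:C : R[i]^o)) e' -> forall x, `|g n x - g m x| <= e'.
  move=> gnm x; have := redbound_entry beta_action (mk 1%g x) gnm.
  rewrite -[X in cmod X]/(single 1%g _ (mk 1%g x) - single 1%g _ (mk 1%g x)) !single_mk eqxx.
  by rewrite -rmorphB /= cmod_real.
have gcont n : continuous (g n).
  move=> x; apply/cvgrPdist_lt => e' e0'.
  have [/continuous_cmodP /(_ x e' e0')] :=
    Cc_piece beta_action X_hausdorff 1%g (Cstar_mem n cg).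
  move=> + _; apply: filterS => y /=; rewrite !single_mk eqxx.
  by rewrite -rmorphB /= cmod_real.
(* on [K] this is the inverse of [g n], for [n] large *)
pose w n x : R[i]^o := ((Num.max (g n x) d)^-1)%:C.
have wcont n : continuous (w n).
  apply: continuous_real_complex => x; apply: cvgV; last exact: continuous_maxr.
  by rewrite gt_eqF // max_gt0.
pose k n : G -> R[i]^o := single 1%g (fun x => w n x * h x).
have ck : Cstar k.
  apply: Cstar_intro => // [n|e' e0'].
    by apply: Cc_single => //; exact: CcptMl.
  have B1 : 0 < B + 1 by rewrite ltr_wpDl.
  near \oo => m; exists (k m).
  have : \forall n \near \oo, redbound ((single 1%g (fun x => (g n x)%:C : R[i]^o) : G -> R[i]^o)
      - single 1%g (fun x => (g m x)%:C : R[i]^o)) (e' * d ^+ 2 / (B + 1)).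
    near: m; apply: (Cstar_cauchy cg).
    by rewrite divr_gt0 // mulr_gt0 // exprn_gt0.
  apply: filterS => n /gdist gnm; rewrite /k singleB.
  apply: redbound_single; first exact: ltW.
  move=> x; rewrite -[_ x]/(w n x * h x - w m x * h x) -mulrBl cmodM -rmorphB /= cmod_real.
  apply: le_trans (_ : (`|g n x - g m x| / d ^+ 2) * (B + 1) <= _).
    apply: ler_pM; rewrite ?cmod_ge0 //; first exact: inv_max_dist.
    by rewrite (le_trans (hB x)) // lerDl.
  have := gnm x; rewrite ler_pdivlMr // => gx.
  by rewrite mulrAC ler_pdivrMr // exprn_gt0.
have [_ I_id] := I_ideal; have [Ikg _] := I_id _ _ ck Ig.
have ch : Cstar (fun=> single 1%g h) by apply: Cstar_const => //; exact: Cc_single.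
apply: (closed_near I_cl ch Ikg).
apply: filterS hg => n hn; rewrite /Cstar_mul convol_single mulg1.
congr (single _ _); apply/funext => x; rewrite action1 //.
have [Kx|nK] := pselect (K x); last by rewrite hK // mulr0 mul0r.
have gx := hn x Kx; rewrite /w max_l // mulrAC -rmorphM /= mulVf ?mul1r //.
by rewrite gt_eqF // (lt_le_trans d0).
Unshelve. all: by end_near.
Qed.

(** [coef t a] is uniformly close to [coef t (a m)], which is small outside of the
    support of the ideal. *)
Lemma coef_mem_generated J t a : closed_ideal J -> C0 beta (ideal_support I) `<=` J ->
  I a -> J (coef t a).
Proof.
move=> J_id UJ Ia; have [J_cl _] := J_id; have ca := IC Ia.
apply: (closed_approx J_cl (Cstar_coef beta_action X_hausdorff t ca)).
move=> e e0; have e4 : 0 < e / 4 by rewrite divr_gt0.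
have e2 : 0 < e / 2 by rewrite divr_gt0.
have [m am] : exists m, \forall n \near \oo, redbound (a n - a m) (e / 4).
  by near \oo => m; exists m; near: m; exact: Cstar_cauchy.
have pc := Cc_piece beta_action X_hausdorff t (Cstar_mem m ca).
have [|f [fc Jf tf]] := single_approx t J_id UJ e2 pc.
  move=> x /= ax; exists a, t, (e / 4); split=> //.
  apply: filterS am => n anm.
  have h1 : cmod (a n (mk t x) - a m (mk t x)) <= e / 4.
    exact: (redbound_entry beta_action (mk t x) anm).
  have := cmodD (a m (mk t x) - a n (mk t x)) (a n (mk t x)).
  by rewrite subrK [cmod (a m _ - _)]cmod_distC; lra.
exists (fun=> f) => //; apply: filterS am => n anm.
apply: (@redbound_le _ _ _ _ _ (e / 4 + e / 2)); first lra.
rewrite -(subrK (restr t (a m)) (coef t a n)) -addrA; apply: redboundD.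
  by rewrite -restrB; apply: redbound_restrW => //; exact: ltW.
by rewrite restrE.
Unshelve. all: by end_near.
Qed.

End IdealWithCoefficients.

Lemma dual_invariant_restr U : stable U -> dual_invariant (@Cstar_restr R Gam X beta U).
Proof.
move=> Uinv chi hchi a aU; have [ca ha] := (Cstar_restrP a Uinv).1 aU.
apply: (Cstar_restrP _ Uinv).2; split.
  apply: (Cstar_gmult beta_action X_hausdorff ler01 _ ca) => f M M0 fM.
  by rewrite mul1r; exact: redbound_character.
move=> e e0; have [f [fc fU hf]] := ha e e0; exists (gmult chi f); split.
- exact: Cc_gmult.
- by move=> gam nU; rewrite /gmult fU ?mulr0.
apply: filterS hf => n hf.
rewrite (_ : _ - _ = gmult chi (a n - f)); first exact: redbound_character (ltW e0) hchi hf.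
by apply/funext => gam; rewrite /gmult mulrBr.
Qed.

End UnitSpaceIdeals.

(** * Zorn's lemma above a given set *)

Lemma Zorn_above (T : Type) (P : set (set T)) (A0 : set T) : P A0 ->
  (forall F : set (set T), F !=set0 -> F `<=` P -> total_on F subset ->
     P (\bigcup_(A in F) A)) ->
  exists B, [/\ P B, A0 `<=` B & forall C, P C -> B `<=` C -> C `<=` B].
Proof.
move=> PA0 Pchain.
have [|A [PA maxA]] := @Zorn_bigcup T (fun A => P (A `|` A0)).
  move=> F FP Ftot; have [[A FA]|F0] := pselect (F !=set0); last first.
    rewrite (_ : \bigcup_(A in F) A = set0) ?set0U //.
    by apply/seteqP; split=> // x [A FA _]; apply: F0; exists A.
  pose F' := [set A `|` A0 | A in F].
  have -> : \bigcup_(A in F) A `|` A0 = \bigcup_(A in F') A.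
    apply/seteqP; split=> [x [[B FB Bx]|A0x]|x [_ [B FB <-] [Bx|A0x]]].
    - by exists (B `|` A0); [exists B|left].
    - by exists (A `|` A0); [exists A|right].
    - by left; exists B.
    - by right.
  apply: Pchain => [|_ [B FB <-]|_ _ [B FB <-] [C FC <-]]; first by exists (A `|` A0), A.
    exact: FP.
  by have [BC|CB] := Ftot B C FB FC; [left|right]; exact: setSU.
exists (A `|` A0); split=> // C PC AC x Cx; left; apply: contrapT => nAx.
have A0C : A0 `<=` C by move=> y A0y; apply: AC; right.
apply: (maxA C); last by move/setUidPl: A0C => ->.
by split=> [y Ay|CA]; [apply: AC; left|apply: nAx; exact: CA].
Qed.

Lemma chain_pair (T : Type) (F : set (set T)) p p' : total_on F subset ->
  (\bigcup_(A in F) A) p -> (\bigcup_(A in F) A) p' -> exists A, [/\ F A, A p & A p'].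
Proof.
move=> Ftot [A FA Ap] [B FB Bp'].
by have [AB|BA] := Ftot A B FA FB; [exists B; split=> //; exact: AB|exists A; split=> //; exact: BA].
Qed.

(** * The Hahn-Banach theorem for a gauge on a subspace *)

Section HahnBanach.
Variables (R : realType) (V : lmodType R[i]) (D : set V) (q : V -> R -> Prop).
Hypotheses (DD : forall x y, D x -> D y -> D (x + y))
  (DZ : forall (c : R) x, D x -> D (c%:C *: x))
  (q_ge0 : forall x (M : R), q x M -> 0 <= M)
  (qD : forall x y M M', q x M -> q y M' -> q (x + y) (M + M'))
  (qZ : forall (c : R) x (M : R), 0 <= c -> q x M -> q (c%:C *: x) (c * M))
  (q_fin : forall x, D x -> exists M, q x M).
Implicit Types (A B : set (V * R)).

(** Graphs of real linear functionals on subspaces of [D] dominated by [q] *)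
Let dominated A : Prop :=
  [/\ forall x r y s, A (x, r) -> A (y, s) -> A (x + y, r + s),
      forall c x r, A (x, r) -> A (c%:C *: x, c * r),
      forall x r, A (x, r) -> D x
    & forall x r M, A (x, r) -> q x M -> r <= M].

Let realZA (c c' : R) (x : V) : c%:C *: (c'%:C *: x) = (c * c')%:C *: x.
Proof. by rewrite scalerA -rmorphM. Qed.

(** The value [r] at [y] has to lie between the numbers [s - M], for [q (x - y) M],
    and the numbers [M - s], for [q (x + y) M], where [(x, s)] runs over the graph. *)
Lemma dominated_extend A y : dominated A -> A (0, 0) -> D y ->
  exists r, dominated [set p | exists x s (c : R), A (x, s) /\ p = (x + c%:C *: y, s + c * r)].
Proof.
move=> [AD AZ AV Aq] A0 Dy.
have DN x : D x -> D (- x) by move=> /(DZ (-1)); rewrite rmorphN1 scaleN1r.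
pose S : set R := [set z | exists x s M, [/\ A (x, s), q (x - y) M & z = s - M]].
have S_ub x s M : A (x, s) -> q (x + y) M -> ubound S (M - s).
  move=> Axs qM _ [x' [s' [M' [As' qM' ->]]]].
  have h : s + s' <= M + M'.
    apply: Aq (AD _ _ _ _ Axs As') _.
    have -> : x + x' = (x + y) + (x' - y) by rewrite addrACA subrr addr0.
    exact: qD.
  by rewrite lerBrDr; lra.
have S0 : S !=set0.
  have [M qM] := q_fin (DN _ Dy).
  by exists (0 - M), 0, 0, M; split=> //; rewrite sub0r.
have Sb : has_sup S.
  split=> //; have [M qM] := q_fin Dy; exists (M - 0).
  by apply: (S_ub 0); rewrite ?add0r.
have up x s M : A (x, s) -> q (x + y) M -> s + sup S <= M.
  by move=> Axs qM; have := ge_sup S0 (S_ub _ _ _ Axs qM); lra.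
have lo x s M : A (x, s) -> q (x - y) M -> s - sup S <= M.
  move=> Axs qM; have : s - M <= sup S; last lra.
  by apply: ub_le_sup; [case: Sb|exists x, s, M].
exists (sup S); split.
- move=> _ _ _ _ [x [s [c [As [-> ->]]]]] [x' [s' [c' [As' [-> ->]]]]].
  exists (x + x'), (s + s'), (c + c'); split; first exact: AD.
  by rewrite rmorphD scalerDl mulrDl !(addrACA _ (_ *: y)) !(addrACA _ (_ * sup S)).
- move=> c _ _ [x [s [c' [As [-> ->]]]]].
  exists (c%:C *: x), (c * s), (c * c'); split; first exact: AZ.
  by rewrite scalerDr realZA mulrDr mulrA.
- move=> _ _ [x [s [c [As [-> _]]]]]; apply: DD; [exact: AV As|exact: DZ].
- move=> _ _ M [x [s [c [As [-> ->]]]]] qM.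
  have [c0|c0|c0] := ltgtP c 0; last first.
  + rewrite c0 mul0r addr0; apply: Aq As _; by move: qM; rewrite c0 rmorph0 scale0r addr0.
  + have ci : 0 <= c^-1 by rewrite invr_ge0 ltW.
    have qM' : q (c^-1%:C *: x + y) (c^-1 * M).
      by have := qZ ci qM; rewrite scalerDr realZA mulVf ?gt_eqF // rmorph1 scale1r.
    have := up _ _ _ (AZ c^-1 _ _ As) qM'.
    by rewrite ler_pdivlMl // mulrDr mulrA divff ?mul1r // gt_eqF.
  + have c0' : 0 < - c by rewrite oppr_gt0.
    have ci : 0 <= (- c)^-1 by rewrite invr_ge0 ltW.
    have qM' : q ((- c)^-1%:C *: x - y) ((- c)^-1 * M).
      have := qZ ci qM; rewrite scalerDr realZA invrN mulNr mulVf ?lt_eqF //.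
      by rewrite rmorphN1 scaleN1r.
    have := lo _ _ _ (AZ (- c)^-1 _ _ As) qM'.
    by rewrite ler_pdivlMl // mulrBr mulrA divff ?mul1r ?gt_eqF // mulNr opprK.
Qed.

Lemma hahn_banach a (d : R) : D a -> 0 < d -> (forall M, q a M -> d <= M) ->
  exists psi : V -> R, [/\ forall x y, D x -> D y -> psi (x + y) = psi x + psi y,
    forall (c : R) x, D x -> psi (c%:C *: x) = c * psi x,
    forall x M, D x -> q x M -> psi x <= M & psi a = d].
Proof.
move=> Da d0 da.
pose A0 : set (V * R) := [set p | exists c : R, p = (c%:C *: a, c * d)].
have A0_dom : dominated A0.
  split.
  - move=> _ _ _ _ [c [-> ->]] [c' [-> ->]]; exists (c + c').
    by rewrite rmorphD scalerDl mulrDl.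
  - by move=> c _ _ [c' [-> ->]]; exists (c * c'); rewrite realZA mulrA.
  - by move=> _ _ [c [-> _]]; exact: DZ.
  - move=> _ _ M [c [-> ->]] qM; have [c0|c0] := leP c 0.
      by apply: le_trans (q_ge0 qM); rewrite mulr_le0_ge0 // ltW.
    have ci : 0 <= c^-1 by rewrite invr_ge0 ltW.
    have := qZ ci qM; rewrite realZA mulVf ?gt_eqF // rmorph1 scale1r => /da.
    by rewrite ler_pdivlMl.
have chain (F : set (set (V * R))) : F !=set0 -> F `<=` dominated ->
    total_on F subset -> dominated (\bigcup_(A in F) A).
  move=> _ FP Ftot; split.
  - move=> x r y s Fx Fy; have [A [FA Ax Ay]] := chain_pair Ftot Fx Fy.
    by exists A => //; have [h _ _ _] := FP A FA; exact: h.
  - by move=> c x r [A FA Ax]; exists A => //; have [_ h _ _] := FP A FA; exact: h.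
  - by move=> x r [A FA Ax]; have [_ _ h _] := FP A FA; exact: h Ax.
  - by move=> x r M [A FA Ax]; have [_ _ _ h] := FP A FA; exact: h Ax.
have [B [[BD BZ BV Bq] A0B maxB]] := Zorn_above A0_dom chain.
have Ba : B (a, d) by apply: A0B; exists 1; rewrite rmorph1 scale1r mul1r.
have B0 : B (0, 0) by have := BZ 0 _ _ Ba; rewrite rmorph0 scale0r mul0r.
have Bfun x r s : B (x, r) -> B (x, s) -> r = s.
  have key r' s' : B (x, r') -> B (x, s') -> r' <= s'.
    move=> Br Bs; have B0r c : B (0, c * (r' - s')).
      have := BZ c _ _ (BD _ _ _ _ Br (BZ (-1) _ _ Bs)).
      by rewrite rmorphN1 scaleN1r subrr scaler0 mulN1r.
    have [M qM] := q_fin (BV _ _ B0); rewrite leNgt; apply/negP => sr.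
    have rs : 0 < r' - s' by rewrite subr_gt0.
    have := Bq _ _ _ (B0r ((M + 1) / (r' - s'))) qM.
    by rewrite divfK ?gt_eqF //; lra.
  by move=> Br Bs; apply/le_anti/andP; split; exact: key.
have Btot y : D y -> exists r, B (y, r).
  move=> Dy; have [r Cdom] := dominated_extend (And4 BD BZ BV Bq) B0 Dy.
  exists r; apply: (maxB _ Cdom).
    by move=> [x s] Bx; exists x, s, 0; rewrite rmorph0 scale0r mul0r !addr0.
  by exists 0, 0, 1; rewrite rmorph1 scale1r mul1r !add0r.
have /choice[psi hpsi] : forall x, exists r, D x -> B (x, r).
  move=> x; have [Dx|nD] := pselect (D x); last by exists 0.
  by have [r Br] := Btot x Dx; exists r.
exists psi; split.
- by move=> x y Dx Dy; apply: Bfun (hpsi _ (DD Dx Dy)) _; apply: BD; exact: hpsi.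
- by move=> c x Dx; apply: Bfun (hpsi _ (DZ c Dx)) _; apply: BZ; exact: hpsi.
- by move=> x M Dx; apply: Bq; exact: hpsi.
- by apply: Bfun (hpsi _ Da) Ba.
Qed.

End HahnBanach.

(** The norm of the complex functional built on the real one is only estimated up
    to the factor [2]. *)
Lemma hahn_banach_complex (R : realType) (V : lmodType R[i]) (D : set V)
    (q : V -> R -> Prop) (a : V) (d : R) :
  (forall x y, D x -> D y -> D (x + y)) -> (forall (z : R[i]) x, D x -> D (z *: x)) ->
  (forall x M, q x M -> 0 <= M) ->
  (forall x y M M', q x M -> q y M' -> q (x + y) (M + M')) ->
  (forall (z : R[i]) x M, q x M -> q (z *: x) (cmod z * M)) ->
  (forall x, D x -> exists M, q x M) ->
  D a -> 0 < d -> (forall M, q a M -> d <= M) ->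
  exists psi : V -> R[i], [/\ forall x y, D x -> D y -> psi (x + y) = psi x + psi y,
    forall z x, D x -> psi (z *: x) = z * psi x,
    forall x M, D x -> q x M -> cmod (psi x) <= M + M & d <= cmod (psi a)].
Proof.
move=> DD DZ q_ge0 qD qZ q_fin Da d0 da.
have qZr (c : R) x M : 0 <= c -> q x M -> q (c%:C *: x) (c * M).
  by move=> c0 /(qZ c%:C); rewrite cmod_real ger0_norm.
have [phi [phiD phiZ phi_le phia]] :=
  hahn_banach DD (fun c x => DZ c%:C x) q_ge0 qD qZr q_fin Da d0 da.
(* the complex functional with real part [phi] *)
exists (fun x => phi x +i* (- phi ('i *: x))); split.
- move=> x y Dx Dy; have iDx := DZ 'i _ Dx; have iDy := DZ 'i _ Dy.
  rewrite scalerDr !phiD //.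
  by apply/eqP; rewrite eq_complex /= opprD !eqxx.
- case=> r s x Dx; have iDx := DZ 'i _ Dx.
  have zE (y : V) : (r +i* s) *: y = r%:C *: y + s%:C *: ('i *: y).
    rewrite scalerA -scalerDl; congr (_ *: _); apply/eqP; rewrite eq_complex /=.
    by apply/andP; split; apply/eqP; ring.
  have iiE (y : V) : 'i *: ('i *: y) = (-1)%:C *: y.
    rewrite scalerA; congr (_ *: _); apply/eqP; rewrite eq_complex /=.
    by apply/andP; split; apply/eqP; ring.
  have izE : 'i *: ((r +i* s) *: x) = r%:C *: ('i *: x) + s%:C *: ((-1)%:C *: x).
    by rewrite zE scalerDr -iiE !scalerA; congr (_ *: _ + _ *: _); ring.
  have D1 := DZ r%:C _ Dx; have D2 := DZ s%:C _ iDx; have D3 := DZ r%:C _ iDx.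
  have D4 := DZ (-1)%:C _ Dx; have D5 := DZ s%:C _ D4.
  rewrite izE zE !phiD ?phiZ //.
  by apply/eqP; rewrite eq_complex /=; apply/andP; split; apply/eqP; ring.
- have abs_le y M : D y -> q y M -> `|phi y| <= M.
    move=> Dy qM; rewrite ler_norml phi_le // andbT.
    have := qZ (-1)%:C _ _ qM; rewrite cmod_real normrN1 mul1r => /(phi_le _ _ (DZ _ _ Dy)).
    by rewrite phiZ // mulN1r lerNl.
  move=> x M Dx qM; apply: le_trans (cmod_ReIm _) _; rewrite /= normrN lerD //.
    exact: abs_le.
  apply: abs_le; first exact: DZ.
  by have := qZ 'i _ _ qM; rewrite /cmod /= expr0n expr1n add0r sqrtr1 mul1r.
- rewrite -phia; apply: le_trans (ler_norm _) _.
  exact: (Re_cmod (phi a +i* _)).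
Qed.

(** * Herz-Schur multipliers *)

Lemma sum_allpairs_fset (V : nmodType) (A B T : choiceType) (l1 : seq A) (l2 : seq B)
    (h : A -> B -> T) (F : T -> V) : uniq l1 -> uniq l2 ->
  (forall a b a' b', h a b = h a' b' -> a = a' /\ b = b') ->
  \sum_(r <- seq_fset tt [seq h a b | a <- l1, b <- l2]) F r =
  \sum_(a <- l1) \sum_(b <- l2) F (h a b).
Proof.
move=> u1 u2 hI; rewrite (perm_big _ (seq_fset_perm _ _)) /= undup_id.
  by rewrite big_allpairs_dep.
by apply: allpairs_uniq => // -[a b] [a' b'] _ _ /= /hI[-> ->].
Qed.

Lemma eq_divg_mulVg (Gam : groupType) (s r p q : Gam) :
  (s / r == p / q)%g = (s^-1 * p == r^-1 * q)%g.
Proof.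
apply/eqP/eqP => [sr|sp].
  by rewrite -[p](mulgVK q) -sr !mulgA mulVg mul1g.
by apply: (mulIg q); rewrite mulgVK -[p](mulVKg s) sp !mulgA.
Qed.

Section HerzSchur.
Variables (R : realType) (Gam : groupType).
Implicit Types (u : Gam -> R[i]^o) (s r t : Gam).

Lemma mxnorm_kbound n (F : Gam -> 'M[R[i]]_n) (Q : {fset Gam}) (M : R) : 0 <= M ->
  (forall t, t \notin Q -> F t = 0) ->
  (mxnorm F <= M%:E)%E <->
  kbound (fun a b : Gam * 'I_n => F (a.1 / b.1)%g a.2 b.2) M.
Proof.
move=> M0 FQ; apply: (@opnorm_kbound _ _ _ [set: Gam * 'I_n] id) => //.
  by apply/seteqP; split=> // x _; exists x.
move=> [p i]; exists (seq_fset tt [seq ((t^-1 * p)%g, j) | t <- Q, j <- enum 'I_n]).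
  move=> [q j]; rewrite seq_fsetE /= => nin; rewrite FQ ?mxE //.
  apply: contra nin => pq; apply/allpairsP; exists ((p / q)%g, j); split=> //=.
    by rewrite mem_enum.
  by rewrite invgM invgK -mulgA mulVg mulg1.
move=> xi; rewrite /lregmx /= (fsbig_gsupp (Q := Q)) => [|t /FQ ->]; last first.
  by rewrite big1 // => j _; rewrite mxE mul0r.
rewrite sum_allpairs_fset ?fset_uniq ?enum_uniq //.
  apply: eq_bigr => t _; rewrite big_enum /=; apply: eq_bigr => j _.
  by rewrite invgM invgK mulgA mulgV mul1g.
by move=> t j t' j' [/mulIg /invg_inj -> ->].
Qed.

Lemma cbnorm_ge0 u : (0 <= cbnorm u)%E.
Proof.
pose F : Gam -> 'M[R[i]]_0 := fun=> 0.
have FQ : forall t, t \notin (fset0 : {fset Gam}) -> F t = 0 by [].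
apply: le_trans (ereal_sup_ubound _); last by exists 0%N.
apply: le_trans (ereal_sup_ubound _); last first.
  exists F => //; split.
    by rewrite (_ : [set t | _] = set0) //; apply/seteqP; split=> // t /=; rewrite eqxx.
  apply/(mxnorm_kbound ler01 FQ); apply: (kbound_le ler01).
  have h0 := @kbound0 R (Gam * 'I_0)%type.
  by apply: (eq_kbound _ h0) => -[p [i i0]].
apply: (@opnorm_ge0 _ _ _ [set: Gam * 'I_0] id) => //.
by apply/seteqP; split=> // x _; exists x.
Qed.

(** A finite block of [k], on the indices [e i], is unitarily equivalent to the
    element [\sum_(i, j) k (e i) (e j) E_ij (x) lambda_(e i / e j)] of the
    matrices over the group algebra, which the multiplier [u] maps to the block
    with entries [u (e i / e j) * k (e i) (e j)]. *)
Lemma herz_schur u (k : Gam -> Gam -> R[i]) (c M : R) : 0 <= c -> 0 <= M ->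
  (cbnorm u <= c%:E)%E -> kbound k M ->
  kbound (fun s r => u (s / r)%g * k s r) (c * M).
Proof.
move=> c0 M0 uc kM; have [M00|M_neq0] := eqVneq M 0.
  rewrite M00 mulr0; apply: (eq_kbound _ (@kbound0 R Gam)) => s r.
  have := @kbound_entry _ _ _ _ s r kM; rewrite M00 => ksr.
  by rewrite (@cmod_eq0 _ (k s r)) ?mulr0 //; apply/le_anti; rewrite ksr cmod_ge0.
move=> E F xi; pose G := (E `|` F)%fset; pose n := #|` G|.
pose e (i : 'I_n) : Gam := nth 1%g G i.
have eI : injective e.
  by move=> i j /eqP; rewrite nth_uniq ?fset_uniq ?ltn_ord // => /eqP/val_inj.
have eE (A : {fset Gam}) : (A `<=` G)%fset -> (e @` [fset i | i in 'I_n & e i \in A])%fset = A.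
  move=> /fsubsetP AG; apply/fsetP => g; apply/imfsetP/idP => [[j] | gA].
    by rewrite !inE /= => jA ->.
  have gG : (index g G < n)%N by rewrite index_mem; exact: AG.
  have eg : e (Ordinal gG) = g by rewrite /e /= nth_index //; exact: AG.
  by exists (Ordinal gG); rewrite // !inE eg.
(* the completely bounded norm is tested on contractions *)
pose k0 (i j : 'I_n) : R[i] := (M^-1)%:C * k (e i) (e j).
have k0M : kbound k0 1.
  have := kboundZ (M^-1)%:C M0 (kbound_compress eI eI kM).
  by rewrite cmod_real ger0_norm ?mulVf // invr_ge0.
pose Fm t : 'M[R[i]]_n := \matrix_(i, j) (if (e i / e j)%g == t then k0 i j else 0).
pose Q : {fset Gam} := [fset (e i / e j)%g | i in 'I_n, j in 'I_n]%fset.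
have FQ t : t \notin Q -> Fm t = 0.
  move=> tQ; apply/matrixP => i j; rewrite !mxE; case: eqP => // ij.
  by move: tQ; rewrite -ij => /negP[]; apply/imfset2P; exists i => //; exists j.
have F1 : (mxnorm Fm <= 1%:E)%E.
  apply/(mxnorm_kbound ler01 FQ).
  (* [p / q = e i / e j] means that [(p, i)] and [(q, j)] have the same class *)
  apply: (@kbound_blocks _ _ _ _ _ k0 _ (fun a => (e a.2)^-1 * a.1)%g snd
    (fun w i => ((e i * w)%g, i))) => //; first by move=> [p i] /=; rewrite mulVKg.
  by move=> [p i] [q j]; rewrite mxE /= eq_divg_mulVg.
have uF : (mxnorm (fun t => u t *: Fm t) <= c%:E)%E.
  apply: le_trans uc; apply: le_trans (ereal_sup_ubound _); last by exists n.
  apply: ereal_sup_ubound; exists Fm => //; split=> //.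
  apply: (@sub_finite_set _ _ [set` Q]); last exact: finite_fset.
  by move=> t /=; apply: contraNT => /FQ ->.
have uFQ t : t \notin Q -> u t *: Fm t = 0 by move=> /FQ ->; rewrite scaler0.
move/(mxnorm_kbound c0 uFQ): uF => uF.
(* the block that corresponds to the neutral element *)
have pI : injective (fun i : 'I_n => (e i, i)) by move=> i j [].
have := kboundZ M%:C c0 (kbound_compress pI pI uF).
rewrite cmod_real ger0_norm // mulrC.
move=> /(_ [fset i | i in 'I_n & e i \in E]%fset [fset i | i in 'I_n & e i \in F]%fset (xi \o e)).
rewrite -!(l2_imfset _ _ eI) // eE ?fsubsetUr //.
rewrite -[in l2 E _](eE E) ?fsubsetUl // l2_imfset //.
apply: le_trans; rewrite le_eqVlt; apply/orP; left; apply/eqP; apply: eq_l2 => i _ /=.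
rewrite -[in LHS](eE F) ?fsubsetUr // big_imfset /=; last by move=> ? ? _ _; exact: eI.
apply: eq_bigr => j _; congr (_ * _); rewrite !mxE eqxx /k0 mulrCA !mulrA; congr (_ * _).
by rewrite -mulrA -rmorphM /= divff // rmorph1 mulr1.
Qed.

End HerzSchur.

(** * Fejer summability in closed subspaces *)

Section Fejer.
Variables (R : realType) (Gam : groupType) (X : topologicalType).
Variable beta : Gam -> X -> X.
Hypothesis beta_action : is_action_by_homeos beta.
Hypothesis X_hausdorff : hausdorff_space X.
Local Notation G := (arrow beta).
Local Notation mk := (mkarrow beta).
Local Notation Cc := (@Cc R Gam X beta).
Local Notation Cstar := (@Cstar R Gam X beta).
Local Notation rednorm := (@rednorm R Gam X beta).
Implicit Types (f : G -> R[i]^o) (x : X) (s r t : Gam) (u phi : Gam -> R[i]^o).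
Implicit Types (a b c : nat -> G -> R[i]^o) (J : set (nat -> G -> R[i]^o)).

Definition gmults u a : nat -> G -> R[i]^o := fun n => gmult u (a n).

(** Under the isomorphism of [l^2(s^-1(x))] with [l^2(Gam)] the multiplier acts as
    a Schur multiplier. *)
Lemma redbound_gmult u f (c M : R) : 0 <= c -> 0 <= M -> (cbnorm u <= c%:E)%E ->
  redbound f M -> redbound (gmult u f) (c * M).
Proof. by move=> c0 M0 uc fM x; exact: herz_schur uc (fM x). Qed.

Lemma gmultB u f f' : gmult u (f - f') = gmult u f - gmult u f'.
Proof. by apply/funext => gam; rewrite /gmult mulrBr. Qed.

Lemma gmult_gsupp u f (Q : {fset Gam}) : gsupp Q f ->
  gmult u f = \sum_(t <- Q) u t *: restr t f.
Proof.
move=> fQ; rewrite {1}(restr_sum fQ) !fct_sumE; apply/funext => gam.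
rewrite /gmult mulr_sumr; apply: eq_bigr => t _.
rewrite -[RHS]/(u t * restr t f gam) /restr; case: eqP => [->//|_].
by rewrite !mulr0.
Qed.

(** A multiplier that is small at finitely many elements of the group is small on
    [f]. *)
Lemma small_gmult f (e : R) : Cc f -> 0 < e -> exists (Q : {fset Gam}) (eta : R),
  0 < eta /\ forall u, (forall t, t \in Q -> cmod (u t) <= eta) -> redbound (gmult u f) e.
Proof.
move=> fc e0; have [Q fQ] := Cc_gsupp fc; have [B B0 fB] := Cc_bounded fc.
pose N : R := (#|` Q|.+1)%:R; have N0 : 0 < N by rewrite ltr0n.
have B1 : 0 < B + 1 by rewrite ltr_wpDl.
pose eta : R := e / (B + 1) / N.
have eta0 : 0 < eta by rewrite !divr_gt0.
exists Q, eta; split=> // u uQ.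
have uf : gsupp Q (gmult u f) by move=> t x tQ; rewrite /gmult fQ ?mulr0.
apply: redbound_le (redbound_gsupp _ uf (M := eta * (B + 1)) _).
- have -> : eta * (B + 1) = e / N by rewrite /eta mulrAC divfK ?gt_eqF.
  by rewrite -[(_ / N) *+ _]mulr_natr mulrAC ler_pdivrMr // ler_wpM2l ?ler_nat // ltW.
- by rewrite mulr_ge0 // ltW.
- move=> gam; rewrite -(arrow_eta gam) /gmult cmodM /=.
  have [cQ|cQ] := boolP (coc gam \in Q); last first.
    by rewrite fQ // cmod0 mulr0 mulr_ge0 // ltW.
  apply: ler_pM; rewrite ?cmod_ge0 //; first exact: uQ.
  by rewrite (le_trans (fB _)) // lerDl.
Qed.

Section Subspace.
Variable J : set (nat -> G -> R[i]^o).
Hypothesis J_cl : closed_subspace Cc rednorm J.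

Lemma gmults_mem phi a : (forall t, J (coef t a)) -> Defs.finsupp phi -> J (gmults phi a).
Proof.
move=> Ja fin; pose S := fset_set [set t | phi t != 0].
have phiS t : t \notin S -> phi t = 0.
  by rewrite in_fset_set // notin_setE /= => /negP; rewrite negbK => /eqP.
have := closed_subspace_sum J_cl S (fun t => closed_subspaceZ J_cl (phi t) (Ja t)).
congr J; apply/funext => n; rewrite fct_sumE; apply/funext => gam; rewrite fct_sumE.
rewrite /gmults /gmult; have [cS|/phiS c0] := boolP (coc gam \in S); last first.
  rewrite c0 mul0r big_seq big1 // => t tS.
  rewrite -[LHS]/(phi t * restr t (a n) gam) /restr; case: eqP => [<-|_]; last exact: mulr0.
  by rewrite c0 mul0r.
rewrite (big_fsetD1 (coc gam)) //= big_seq big1 ?addr0 => [|t].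
  by rewrite -[LHS]/(phi _ * restr _ (a n) gam) /restr eqxx.
rewrite !inE => /andP[/negPf tc _].
by rewrite -[LHS]/(phi t * restr t (a n) gam) /restr eq_sym tc mulr0.
Qed.

(** The multipliers [phi] are uniformly bounded and converge to the identity on
    C_c(G), hence everywhere. *)
Lemma fejer_weakly_amenable a : weakly_amenable R Gam -> Cstar a ->
  (forall t, J (coef t a)) -> J a.
Proof.
move=> [K [Phi [PhiP PhiK Phi1]]] ca Ja.
(* [K] may be negative *)
pose c : R := Num.max K 0.
have c0 : 0 <= c by rewrite le_max lexx orbT.
have c1 : 0 < c + 1 by rewrite ltr_wpDl.
apply: (closed_approx J_cl ca) => e e0; have e20 : 0 < e / 2 by rewrite divr_gt0.
have [m am] : exists m, \forall n \near \oo, redbound (a n - a m) (e / 2 / (c + 1)).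
  near \oo => m; exists m; near: m; apply: (Cstar_cauchy ca); by rewrite !divr_gt0.
have [Q [eta [eta0 Qeta]]] := small_gmult (Cstar_mem m ca) e20.
have PhiQ : \forall phi \near Phi, forall t, t \in Q -> cmod (1 - phi t) < eta.
  have : \forall phi \near Phi, forall t, t \in (Q : seq Gam) -> cmod (1 - phi t) < eta.
    elim: (Q : seq Gam) => [|s l IH]; first exact: filterE.
    have hs : \forall phi \near Phi, cmod (1 - phi s) < eta.
      by have /cvg_cmodP /(_ _ eta0) := Phi1 s.
    apply: filterS2 hs IH => phi hs hl t; rewrite inE => /orP[/eqP -> //|]; exact: hl.
  by [].
have [phi [[fin phiK] phiQ]] := filter_ex (filterI PhiK PhiQ).
have {}phiK : (cbnorm phi <= c%:E)%E.
  by apply: le_trans phiK _; rewrite lee_fin le_max lexx.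
exists (gmults phi a); first exact: gmults_mem.
have hm : redbound (a m - gmult phi (a m)) (e / 2).
  rewrite (_ : _ - _ = gmult (fun t => 1 - phi t) (a m)).
    by apply: Qeta => t /phiQ /ltW.
  by apply/funext => gam; rewrite /gmult mulrBl mul1r.
apply: filterS am => n anm.
rewrite (_ : _ - _ = (a n - a m) + ((a m - gmult phi (a m)) - gmult phi (a n - a m))).
  apply: (@redbound_le _ _ _ _ _ (e / 2 / (c + 1) + (e / 2 + c * (e / 2 / (c + 1))))).
    rewrite addrCA [e in leRHS]splitr lerD2l -{1}[e / 2 / _]mul1r -mulrDl mulrC [1 + c]addrC.
    by rewrite divfK // gt_eqF.
  apply: redboundD => //; apply: redboundB => //.
  by apply: redbound_gmult => //; rewrite !divr_ge0 // ltW.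
by rewrite gmultB opprB (addrA (a m - _)) subrK addrA subrK.
Unshelve. all: by end_near.
Qed.

Lemma Cstar0 : Cstar 0.
Proof. exact: (Cstar_const (@Cc0 R Gam X beta)). Qed.

Lemma CstarZ (z : R[i]) a : Cstar a -> Cstar (z *: a).
Proof.
move=> ca; apply: (Cstar_gmult beta_action X_hausdorff (cmod_ge0 z) _ ca (u := fun=> z)).
by move=> f M M0 fM; exact: redboundZ.
Qed.

Lemma CstarD a b : Cstar a -> Cstar b -> Cstar (a + b).
Proof.
move=> ca cb; have -> : a + b = a - ((-1) *: b) by rewrite scaleN1r opprK.
exact: CstarB ca (CstarZ _ cb).
Qed.

(** The norm of [b] in the quotient by [J] is at most [M]. *)
Let quot_le b (M : R) : Prop :=
  0 <= M /\ exists2 c, J c & \forall n \near \oo, redbound (b n - c n) M.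

Let quot_leD b b' (M M' : R) : quot_le b M -> quot_le b' M' -> quot_le (b + b') (M + M').
Proof.
move=> [M0 [c Jc bc]] [M0' [c' Jc' bc']]; split; first by rewrite addr_ge0.
exists (c + c'); first exact: (closed_subspaceD J_cl).
apply: filterS2 bc bc' => n h h'.
by rewrite -[(b + b') n]/(b n + b' n) -[(c + c') n]/(c n + c' n) opprD addrACA; exact: redboundD.
Qed.

Let quot_leZ (z : R[i]) b (M : R) : quot_le b M -> quot_le (z *: b) (cmod z * M).
Proof.
move=> [M0 [c Jc bc]]; split; first by rewrite mulr_ge0 ?cmod_ge0.
exists (z *: c); first exact: (closed_subspaceZ J_cl).
apply: filterS bc => n h.
by rewrite -[(z *: b) n]/(z *: b n) -[(z *: c) n]/(z *: c n) -scalerBr; exact: redboundZ.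
Qed.

Let quot_le_redbound b (M : R) : 0 <= M -> (\forall n \near \oo, redbound (b n) M) ->
  quot_le b M.
Proof.
move=> M0 bM; split=> //; exists 0; first exact: (closed_subspace0 J_cl).
by apply: filterS bM => n; rewrite subr0.
Qed.

Let quot_le_mem b : J b -> quot_le b 0.
Proof.
move=> Jb; split=> //; exists b => //; exists 0 => // n _ /=.
rewrite subrr; exact: redbound0.
Qed.

(** Here the convergence [phi -> 1] is only weak*.  For a functional [psi]
    vanishing on [J], the map sending [u] to the value of [psi] at the multiple
    of [a] by [u] lies in the predual of the completely bounded multipliers,
    since [a] is a limit of elements of C_c(G); so it takes the same value at [1]
    as at finitely supported multipliers, which is zero.  By the Hahn-Banach
    theorem [a] lies in [J]. *)
Lemma fejer_approximation a : approximation_property R Gam -> Cstar a ->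
  (forall t, J (coef t a)) -> J a.
Proof.
move=> [Phi [PhiP Phifin Phi1]] ca Ja; apply: contrapT => nJa.
have [d d0 da] : exists2 d : R, 0 < d & forall M, quot_le a M -> d <= M.
  apply: contrapT => nd; apply: nJa; apply: (closed_approx J_cl ca) => e e0.
  apply: contrapT => nc; apply: nd; exists e => // M [M0 [c Jc ac]].
  rewrite leNgt; apply/negP => Me; apply: nc; exists c => //.
  by apply: filterS ac => n; apply: redbound_le; exact: ltW.
have quot_fin b : Cstar b -> exists M, quot_le b M.
  by move=> cb; have [M M0 bM] := Cstar_bounded cb; exists M; exact: quot_le_redbound.
have [Psi [PsiD PsiZ Psi_le Psia]] := hahn_banach_complex CstarD CstarZ
  (fun b M (h : quot_le b M) => proj1 h) quot_leD quot_leZ quot_fin ca d0 da.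
pose omega (u : Gam -> R[i]^o) : R[i]^o := Psi (gmults u a).
have omega_pre : predual omega.
  move=> e e0; have e2 : 0 < e / 2 by rewrite divr_gt0.
  have [m am] : exists m, \forall n \near \oo, redbound (a n - a m) (e / 2).
    by near \oo => m; exists m; near: m; exact: (Cstar_cauchy ca).
  have cm := Cstar_mem m ca; have [Q aQ] := Cc_gsupp cm.
  have crt t : Cstar (fun=> restr t (a m)) by apply: Cstar_const => //; exact: Cc_restr.
  pose f t : R[i]^o := if t \in Q then Psi (fun=> restr t (a m)) else 0.
  have fQ t : t \notin Q -> f t = 0 by rewrite /f => /negPf ->.
  exists f.
    apply: (@sub_finite_set _ _ [set` Q]); last exact: finite_fset.
    by move=> t /=; apply: contraNT => /fQ ->.
  move=> u u_fin; have [c c0 uc] : exists2 c : R, 0 <= c & cbnorm u = c%:E.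
    have := cbnorm_ge0 u; case: (cbnorm u) u_fin => // c _ c0; exists c => //.
  have sumE : \sum_(t \in [set: Gam]) f t * u t = Psi (fun=> gmult u (a m)).
    rewrite (fsbig_gsupp (Q := Q)) => [|t /fQ ->]; last by rewrite mul0r.
    rewrite (gmult_gsupp u aQ) (_ : (fun=> _) =
      \sum_(t <- Q) u t *: (fun _ : nat => restr t (a m))); last first.
      by rewrite (fct_sumE _ _ (fun t => u t *: (fun _ : nat => restr t (a m)))).
    have Psi_sum (l : seq Gam) : Cstar (\sum_(t <- l) u t *: (fun _ : nat => restr t (a m))) /\
        Psi (\sum_(t <- l) u t *: (fun _ : nat => restr t (a m))) =
        \sum_(t <- l) Psi (fun=> restr t (a m)) * u t.
      elim: l => [|t l [IHc IH]].
        rewrite !big_nil; split; first exact: Cstar0.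
        by rewrite -(scale0r 0) (PsiZ 0 _ Cstar0) mul0r.
      rewrite !big_cons; split; first exact: CstarD (CstarZ _ (crt t)) IHc.
      by rewrite (PsiD _ _ (CstarZ _ (crt t)) IHc) (PsiZ _ _ (crt t)) IH mulrC.
    rewrite (Psi_sum Q).2; apply: eq_big_seq => t tQ; by rewrite /f tQ.
  have cua : Cstar (gmults u a).
    apply: (Cstar_gmult beta_action X_hausdorff c0 _ ca) => g M M0.
    by apply: redbound_gmult => //; rewrite uc.
  have cum : Cstar (fun=> gmult u (a m)) by apply: Cstar_const; exact: Cc_gmult.
  have -> : omega u - \sum_(t \in [set: Gam]) f t * u t =
      Psi (gmults u a - (fun=> gmult u (a m))).
    have -> : gmults u a - (fun=> gmult u (a m)) = gmults u a + (-1) *: (fun=> gmult u (a m)).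
      by rewrite scaleN1r.
    rewrite (PsiD _ _ cua (CstarZ (-1) cum)) (PsiZ (-1) _ cum) mulN1r.
    by rewrite sumE.
  rewrite uc -EFinM lee_fin [e]splitr mulrDl; apply: Psi_le; first exact: CstarB cua cum.
  apply: quot_le_redbound; first by rewrite mulr_ge0 // ltW.
  apply: filterS am => n anm.
  rewrite -[X in redbound X]/(gmult u (a n) - gmult u (a m)) -gmultB mulrC.
  by apply: redbound_gmult => //; rewrite ?uc // ltW.
have /cvg_cmodP /(_ d d0) := Phi1 _ omega_pre.
move=> /(filterI Phifin)/filter_ex[phi [fin]].
have Jphi := gmults_mem Ja fin.
have -> : omega phi = 0.
  apply: cmod_eq0; apply/le_anti; rewrite cmod_ge0 andbT -[0]addr0.
  by apply: Psi_le; [exact: (closed_subspace_mem J_cl Jphi)|exact: quot_le_mem].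
rewrite subr0 (_ : omega _ = Psi a); last first.
  by congr Psi; apply/funext => n; apply/funext => gam; rewrite /gmults /gmult mul1r.
by rewrite ltNge Psia.
Unshelve. all: by end_near.
Qed.

End Subspace.
End Fejer.

(** * Characters of abelian groups *)

Section Characters.
Variables (R : realType) (Gam : groupType).
Hypothesis Gam_abelian : abelian_group Gam.
Implicit Types (A B : set (Gam * R[i])) (s t y : Gam) (z w : R[i]).

(** Graphs of circle-valued characters on subgroups *)
Let partial_char A : Prop :=
  [/\ forall s z t w, A (s, z) -> A (t, w) -> A ((s * t)%g, z * w),
      forall s z, A (s, z) -> A (s^-1%g, z^-1),
      forall s z, A (s, z) -> cmod z = 1
    & forall z, A (1%g, z) -> z = 1].

Let unit_neq0 z : cmod z = 1 -> z != 0.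
Proof.
by move=> z1; apply/eqP => z0; move: z1; rewrite z0 cmod0 => /esym/eqP; rewrite oner_eq0.
Qed.

Lemma partial_char_pow A y z k : partial_char A -> A (1%g, 1) -> A (y, z) ->
  A ((y ^+ k)%g, z ^+ k).
Proof.
move=> [AM _ _ _] A1 Ayz; elim: k => [|k IH]; first by rewrite expg0 expr0.
by rewrite expgS exprS; exact: AM.
Qed.

Lemma partial_char_fun A y z w : partial_char A -> A (y, z) -> A (y, w) -> z = w.
Proof.
move=> [AM AV Anorm A1] Az Aw; have := AM _ _ _ _ Az (AV _ _ Aw).
rewrite mulgV => /A1 zw; have w0 := unit_neq0 (Anorm _ _ Aw).
by rewrite -[z](mulfVK w0) zw mul1r.
Qed.

(** A partial character extends to [y] by the value [z] as soon as [z] is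
    compatible with its values at the powers of [y]. *)
Lemma partial_char_extend A y z : partial_char A -> A (1%g, 1) -> cmod z = 1 ->
  (forall k w, A ((y ^+ k)%g, w) -> w = z ^+ k) ->
  exists B, [/\ partial_char B, A `<=` B & B (y, z)].
Proof.
move=> Achar A1 z1 hz; have [AM AV Anorm AF] := Achar.
have z0 := unit_neq0 z1; have zk0 k : z ^+ k != 0 by rewrite expf_neq0.
have comm (s t : Gam) := Gam_abelian s t.
have ACA (g1 g2 g3 g4 : Gam) : (g1 * g2 * (g3 * g4) = g1 * g3 * (g2 * g4))%g.
  by rewrite -!mulgA (mulgA g2) (comm g2 g3) -mulgA.
exists [set p | exists h w k l, A (h, w) /\
  p = ((h * (y ^+ k / y ^+ l))%g, w * (z ^+ k / z ^+ l))]; split; last 1 first.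
- exists 1%g, 1, 1%N, 0%N; split=> //.
  by rewrite expg0 expg1 expr0 expr1 invg1 mulg1 mul1g invr1 mulr1 mul1r.
- split.
  + move=> _ _ _ _ [h [w [k [l [Ah [-> ->]]]]]] [h' [w' [k' [l' [Ah' [-> ->]]]]]].
    exists (h * h')%g, (w * w'), (k + k')%N, (l + l')%N; split; first exact: AM.
    congr (_, _); last by rewrite !exprD; field; rewrite !zk0.
    by rewrite !expgnDr invgM (comm (_^-1)%g) (ACA (y ^+ k)%g) (ACA h).
  + move=> _ _ [h [w [k [l [Ah [-> ->]]]]]].
    exists h^-1%g, w^-1, l, k; split; first exact: AV.
    have w0 := unit_neq0 (Anorm _ _ Ah).
    congr (_, _); last by rewrite invfM invf_div.
    by rewrite invgM invgF comm.
  + move=> _ _ [h [w [k [l [Ah [_ ->]]]]]].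
    by rewrite !cmodM cmodV !cmodX z1 !expr1n (Anorm _ _ Ah) divr1 mulr1.
  + move=> v [h [w [k [l [Ah [/esym hkl ->]]]]]].
    have hE : h = (y ^+ l / y ^+ k)%g by rewrite -[h]mulg1 -(mulgV (y ^+ k / y ^+ l)%g) mulgA hkl mul1g invgF.
    have [kl|/ltnW lk] := leqP k l.
      have -> : w = z ^+ (l - k).
        by apply: hz; rewrite expgnFr // -hE.
      by rewrite mulrA -exprD subnK // mulfV.
    have w0 := unit_neq0 (Anorm _ _ Ah).
    have wE : w^-1 = z ^+ (k - l).
      by apply: hz; rewrite expgnFr // -invgF -hE; exact: AV.
    by rewrite -(subnK lk) exprD -wE mulfK // mulfV.
- move=> [h w] Ah; exists h, w, 0%N, 0%N; split=> //.
  by rewrite expg0 expr0 invg1 mulg1 mulg1 invr1 mulr1 mulr1.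
Qed.

Lemma unit_root_neq1 n : (1 < n)%N -> exists2 z : R[i], z ^+ n = 1 & z != 1.
Proof.
case: n => [|[|n]] // _.
have [z hz] := @solve_monicpoly R[i] n.+1 (fun=> -1) isT.
have sum0 : \sum_(k < n.+2) z ^+ k = 0.
  rewrite big_ord_recr /= hz -big_split /= big1 // => k _.
  by rewrite mulN1r addrN.
exists z; first by apply/eqP; rewrite -subr_eq0 subrX1 sum0 mulr0.
apply/eqP => z1; move: sum0; rewrite z1; under eq_bigr do rewrite expr1n.
by rewrite sumr_const card_ord => /eqP; rewrite pnatr_eq0.
Qed.

(** The value at [y] is prescribed by the least positive power of [y] in the
    domain of [A]; there is some freedom unless [y] itself belongs to it. *)
Lemma partial_char_value A y : partial_char A -> A (1%g, 1) -> exists z,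
  [/\ cmod z = 1, forall k w, A ((y ^+ k)%g, w) -> w = z ^+ k
    & (forall s w, A (s, w) -> s = 1%g /\ w = 1) -> y != 1%g -> z != 1].
Proof.
move=> Achar A1; have [AM AV Anorm AF] := Achar.
have [ex|no] := pselect (exists n, (0 < n)%N && `[< exists w, A ((y ^+ n)%g, w) >]);
  last first.
  exists (-1); split; first by rewrite cmodN cmod1.
    move=> [|k] w Aw; first by rewrite expr0; apply: AF; rewrite expg0 in Aw.
    by exfalso; apply: no; exists k.+1; apply/asboolP; exists w.
  by move=> _ _; apply/eqP => /eqP; rewrite eq_sym -subr_eq0 opprK (pnatr_eq0 _ 2).
have [n /andP[npos /asboolP[w Aw]] nmin] := ex_minnP ex.
have zfree z : z ^+ n = w -> cmod z = 1 /\ forall k w', A ((y ^+ k)%g, w') -> w' = z ^+ k.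
  move=> zn; split.
    have /eqP : cmod z ^+ n = 1 by rewrite -cmodX zn (Anorm _ _ Aw).
    by rewrite pexpr_eq1 ?cmod_ge0 // => /eqP.
  move=> k w' Aw'; have Awq := partial_char_pow (k %/ n) Achar A1 Aw.
  have r0 : (k %% n = 0)%N.
    apply/eqP; rewrite -leqn0 leqNgt; apply/negP => r0.
    have : (n <= k %% n)%N.
      apply: nmin; rewrite r0; apply/asboolP; exists (w' * (w ^+ (k %/ n))^-1).
      have -> : (y ^+ (k %% n) = y ^+ k * (y ^+ n ^+ (k %/ n))^-1)%g.
        by rewrite {2}(divn_eq k n) -expgnA mulnC addnC expgnDr mulgK.
      by apply: AM => //; exact: AV.
    by rewrite leqNgt ltn_pmod.
  have kE : k = (n * (k %/ n))%N by rewrite {1}(divn_eq k n) r0 addn0 mulnC.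
  rewrite -expgnA -kE in Awq; rewrite (partial_char_fun Achar Aw' Awq).
  by rewrite -zn -exprM -kE.
have [trivA|ntrivA] := pselect ((forall s w, A (s, w) -> s = 1%g /\ w = 1) /\ y != 1%g).
  have [tA y1] := trivA; have [yn w1] := tA _ _ Aw.
  have n1 : (1 < n)%N.
    case: n npos yn {nmin Aw zfree} => [|[|n]] // _; rewrite expg1 => /eqP y1'.
    by rewrite y1' in y1.
  have [z zn z1] := unit_root_neq1 n1.
  have [zz zA] := zfree z (etrans zn (esym w1)).
  by exists z.
have [z hz] := @solve_monicpoly R[i] n (fun k => if k == 0%N then w else 0) npos.
have zn : z ^+ n = w.
  rewrite hz; case: n npos {nmin Aw zfree hz} => // n _.
  by rewrite big_ord_recl /= expr0 mulr1 big1 ?addr0 // => k _; rewrite mul0r.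
have [zz zA] := zfree z zn; exists z; split=> // tA y1.
by exfalso; apply: ntrivA.
Qed.

Lemma separating_character s : s != 1%g -> exists2 chi : Gam -> R[i]^o,
  character chi & chi s != 1.
Proof.
move=> s1.
pose triv : set (Gam * R[i]) := [set (1%g, 1)].
have trivP : partial_char triv.
  split.
  - by move=> _ _ _ _ [-> ->] [-> ->]; rewrite /triv /= mulg1 mulr1.
  - by move=> _ _ [-> ->]; rewrite /triv /= invg1 invr1.
  - by move=> _ _ [_ ->]; exact: cmod1.
  - by move=> _ [->].
have [z [z1 zs zn1]] := @partial_char_value triv s trivP (erefl _).
have [A0 [A0P trivA A0s]] := partial_char_extend trivP (erefl _) z1 zs.
have chain (F : set (set (Gam * R[i]))) : F !=set0 -> F `<=` partial_char ->
    total_on F subset -> partial_char (\bigcup_(A in F) A).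
  move=> _ FP Ftot; split.
  - move=> t w t' w' Ft Ft'; have [A [FA At At']] := chain_pair Ftot Ft Ft'.
    by exists A => //; have [h _ _ _] := FP A FA; exact: h.
  - by move=> t w [A FA At]; exists A => //; have [_ h _ _] := FP A FA; exact: h.
  - by move=> t w [A FA At]; have [_ _ h _] := FP A FA; exact: h At.
  - by move=> w [A FA At]; have [_ _ _ h] := FP A FA; exact: h At.
have [B [BP A0B maxB]] := Zorn_above A0P chain.
have B1 : B (1%g, 1) by apply: A0B; exact: trivA.
have /choice[chi hchi] : forall t, exists w, B (t, w).
  move=> t; have [w [w1 tw _]] := partial_char_value t BP B1.
  have [C [CP BC Ct]] := partial_char_extend BP B1 w1 tw.
  by exists w; exact: (maxB C CP BC).
have [BM BV Bnorm _] := BP; exists chi.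
  split=> [t t'|t]; last exact: (Bnorm _ _ (hchi t)).
  exact: (partial_char_fun BP (hchi _) (BM _ _ _ _ (hchi t) (hchi t'))).
rewrite (partial_char_fun BP (hchi s) (A0B _ A0s)); apply: zn1 => //.
by move=> t w [-> ->].
Qed.

End Characters.

(** * Fourier coefficients of elements of a dually invariant ideal *)

Section DualInvariant.
Variables (R : realType) (Gam : groupType) (X : topologicalType).
Variable beta : Gam -> X -> X.
Hypothesis beta_action : is_action_by_homeos beta.
Hypothesis X_hausdorff : hausdorff_space X.
Hypothesis Gam_abelian : abelian_group Gam.
Local Notation G := (arrow beta).
Local Notation Cc := (@Cc R Gam X beta).
Local Notation Cstar := (@Cstar R Gam X beta).
Local Notation rednorm := (@rednorm R Gam X beta).
Implicit Types (f : G -> R[i]^o) (s r t : Gam) (u m : Gam -> R[i]^o).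
Implicit Types (a b c : nat -> G -> R[i]^o).

Variable I : set (nat -> G -> R[i]^o).
Hypotheses (I_cl : closed_subspace Cc rednorm I) (I_dual : dual_invariant I).

(** These multipliers are stable under products and means, and contain the
    translates of characters. *)
Let contractive m : Prop :=
  [/\ forall a, I a -> I (gmults m a), forall t, cmod (m t) <= 1
    & forall f (M : R), 0 <= M -> redbound f M -> redbound (gmult m f) M].

Let contractive1 : contractive (fun=> 1).
Proof.
have E f : gmult (fun=> 1) f = f by apply/funext => gam; rewrite /gmult mul1r.
split=> [a|t|f M _]; rewrite ?cmod1 ?E //.
by rewrite /gmults (_ : (fun n => _) = a) //; apply/funext => n; rewrite E.
Qed.

Let contractiveM m m' : contractive m -> contractive m' ->
  contractive (fun t => m t * m' t).
Proof.
move=> [mI m1 mb] [mI' m1' mb'].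
have E f : gmult (fun t => m t * m' t) f = gmult m (gmult m' f).
  by apply/funext => gam; rewrite /gmult mulrA.
split=> [a|t|f M M0].
- rewrite (_ : gmults _ a = gmults m (gmults m' a)); last by apply/funext => n; exact: E.
  by move=> /mI'; exact: mI.
- by rewrite cmodM mulr_ile1 ?cmod_ge0.
- by rewrite E => /(mb' _ _ M0); exact: mb.
Qed.

Let contractiveX m k : contractive m -> contractive (fun t => m t ^+ k).
Proof.
move=> mc; elim: k => [|k IH]; first exact: contractive1.
rewrite (_ : (fun t => _) = fun t => m t * m t ^+ k).
  exact: contractiveM mc IH.
by apply/funext => t; rewrite exprS.
Qed.

Let contractive_char chi t : character chi -> contractive (fun s => chi (s / t)%g).
Proof.
move=> hchi; have [chiM chi1] := hchi.
have E f : gmult (fun s => chi (s / t)%g) f = chi t^-1%g *: gmult chi f.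
  apply/funext => gam.
  by rewrite -[RHS]/(chi t^-1%g * (chi (coc gam) * f gam)) /gmult chiM mulrCA mulrA.
split=> [a Ia|s|f M M0 fM]; last 1 first.
- rewrite E -[M]mul1r -[1](chi1 t^-1%g); apply: redboundZ => //.
  exact: redbound_character.
- rewrite (_ : gmults _ a = chi t^-1%g *: gmults chi a).
    by apply: (closed_subspaceZ I_cl); exact: I_dual.
  by apply/funext => n; exact: E.
- by rewrite /cmod chi1.
Qed.

Let contractive_mean (m : nat -> Gam -> R[i]^o) N : (0 < N)%N ->
  (forall k, contractive (m k)) ->
  contractive (fun t => N%:R^-1 * \sum_(k < N) m k t).
Proof.
move=> N0 mc.
have NR : cmod (N%:R^-1 : R[i]) = N%:R^-1.
  by rewrite cmodV -[N%:R]/(N%:R) -(rmorph_nat (real_complex R)) cmod_real ger0_norm.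
have NN : (N%:R : R) != 0 by rewrite pnatr_eq0 -lt0n.
have E f : gmult (fun t => N%:R^-1 * \sum_(k < N) m k t) f =
           N%:R^-1 *: \sum_(k < N) gmult (m k) f.
  apply/funext => gam; rewrite -[RHS]/(N%:R^-1 * (\sum_(k < N) gmult (m k) f) gam).
  by rewrite fct_sumE /gmult -mulrA mulr_suml.
split=> [a Ia|t|f M M0 fM].
- rewrite (_ : gmults _ a = N%:R^-1 *: \sum_(k < N) gmults (m k) a).
    apply: (closed_subspaceZ I_cl); apply: (closed_subspace_sum I_cl) => k.
    by case: (mc k) => h _ _; exact: h.
  apply/funext => n; rewrite -[RHS]/(N%:R^-1 *: (\sum_(k < N) gmults (m k) a) n).
  by rewrite fct_sumE; exact: E.
- rewrite cmodM NR ler_pdivrMl ?ltr0n // mulr1; apply: le_trans (cmod_sum _ _ _) _.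
  apply: le_trans (_ : \sum_(k < N) 1 <= _); last by rewrite sumr_const card_ord.
  by apply: ler_sum => k _; case: (mc k).
- rewrite E.
  have -> : M = cmod (N%:R^-1 : R[i]) * \sum_(k < N) M.
    by rewrite NR sumr_const card_ord -[M *+ _]mulr_natl mulKf.
  apply: redboundZ; first by rewrite sumr_ge0.
  by apply: redbound_sum => k; case: (mc k) => _ _; apply.
Qed.

(** A geometric mean of the powers of a character separating [s] from [t]: it
    is small at [s]. *)
Let contractive_kill s t (e : R) : 0 < e -> s != t ->
  exists m, [/\ contractive m, m t = 1 & cmod (m s) <= e].
Proof.
move=> e0 st.
have [chi hchi chist] : exists2 chi : Gam -> R[i]^o, character chi & chi (s / t)%g != 1.
  by apply: separating_character => //; rewrite divg_eq1.
have [chiM chi1] := hchi; pose z := chi (s / t)%g.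
have z1 : 0 < cmod (z - 1).
  rewrite lt_neqAle cmod_ge0 andbT eq_sym; apply/eqP => /cmod_eq0/eqP.
  by rewrite subr_eq0; apply/negP.
have chi11 : chi 1%g = 1.
  have c0 : chi 1%g != 0.
    by apply/eqP => c0; have := chi1 1%g; rewrite c0 normc0 => /esym/eqP; rewrite oner_eq0.
  by apply: (mulIf c0); rewrite mul1r -chiM mulg1.
(* the mean of [N] powers of [z] is [(z ^+ N - 1) / (N * (z - 1))] *)
pose x : R := 2 / (e * cmod (z - 1)).
have x0 : 0 <= x by rewrite divr_ge0 // mulr_ge0 // ltW.
pose N := (Num.bound x).+1.
have xN : x < N%:R by apply: lt_le_trans (archi_boundP x0) _; rewrite ler_nat.
exists (fun g => N%:R^-1 * \sum_(k < N) chi (g / t)%g ^+ k); split.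
- apply: (contractive_mean (m := fun k g => chi (g / t)%g ^+ k)) => // k.
  by apply: contractiveX; exact: contractive_char.
- rewrite mulgV chi11; under eq_bigr do rewrite expr1n.
  by rewrite sumr_const card_ord mulVf // pnatr_eq0.
- have -> : \sum_(k < N) chi (s / t)%g ^+ k = (z ^+ N - 1) / (z - 1).
    by rewrite subrX1 mulrAC divff ?mul1r // subr_eq0.
  rewrite !cmodM !cmodV -[X in cmod X](rmorph_nat (real_complex R)) cmod_real ger0_norm //.
  rewrite mulrC; apply: le_trans (_ : 2 / cmod (z - 1) / N%:R <= _).
    rewrite ler_wpM2r ?invr_ge0 // ler_wpM2r ?invr_ge0 ?cmod_ge0 //.
    apply: le_trans (cmodB _ _) _; rewrite cmodX /cmod chi1 expr1n normc1; lra.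
  rewrite ler_pdivrMr ?ltr0n // ler_pdivrMr //.
  by move: xN; rewrite /x ltr_pdivrMr ?mulr_gt0 // => /ltW; rewrite mulrCA mulrA.
Qed.

Let contractive_delta t (Q : seq Gam) (e : R) : 0 < e -> exists m,
  [/\ contractive m, m t = 1 & forall s, s \in Q -> s != t -> cmod (m s) <= e].
Proof.
move=> e0; elim: Q => [|s Q [m [mc mt mQ]]].
  by exists (fun=> 1); split=> //; exact: contractive1.
have [->|st] := eqVneq s t.
  exists m; split=> // s'; rewrite inE => /orP[/eqP -> /eqP //|]; exact: mQ.
have [m' [mc' mt' ms']] := contractive_kill e0 st.
exists (fun g => m g * m' g); split; first exact: contractiveM.
  by rewrite mt mt' mulr1.
have [_ m1 _] := mc; have [_ m1' _] := mc'.
move=> s'; rewrite inE => /orP[/eqP -> _|s'Q s't]; rewrite cmodM -[e]mul1r.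
  by apply: ler_pM => //; exact: cmod_ge0.
by rewrite mulrC; apply: ler_pM => //; rewrite ?cmod_ge0 //; exact: mQ.
Qed.

(** The coefficient of [a] at [t] is the integral over the dual group of the
    translates of [a], weighted by the conjugate character of [t]; finite means
    of characters approximate it. *)
Lemma dual_invariant_coef t a : I a -> I (coef t a).
Proof.
move=> Ia; have ca := closed_subspace_mem I_cl Ia.
apply: (closed_approx I_cl (Cstar_coef beta_action X_hausdorff t ca)) => e e0.
have e4 : 0 < e / 4 by rewrite divr_gt0.
have e2 : 0 < e / 2 by rewrite divr_gt0.
have [k ak] : exists k, \forall n \near \oo, redbound (a n - a k) (e / 4).
  by near \oo => k; exists k; near: k; exact: (Cstar_cauchy ca).
have [Q [eta [eta0 Qeta]]] := small_gmult (Cstar_mem k ca) e2.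
have [m [mc mt mQ]] := contractive_delta t (Q : seq Gam) eta0.
have [mI _ mb] := mc; exists (gmults m a); first exact: mI.
have hk : redbound (restr t (a k) - gmult m (a k)) (e / 2).
  rewrite restr_gmult (_ : _ - _ =
      gmult (fun s => (if s == t then 1 else 0) - m s) (a k)); last first.
    by apply/funext => gam; rewrite /gmult mulrBl.
  apply: Qeta => s sQ; case: eqVneq => [->|st]; first by rewrite mt subrr cmod0 ltW.
  by rewrite sub0r cmodN; exact: mQ.
apply: filterS ak => n ank.
rewrite (_ : _ - _ = restr t (a n - a k) +
    ((restr t (a k) - gmult m (a k)) - gmult m (a n - a k))); last first.
  by rewrite gmultB opprB (addrA (restr t (a k) - _)) subrK restrB addrA subrK.
apply: (@redbound_le _ _ _ _ _ (e / 4 + (e / 2 + e / 4))); first lra.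
apply: redboundD; first by apply: redbound_restrW => //; exact: ltW.
by apply: redboundB => //; apply: mb => //; exact: ltW.
Unshelve. all: by end_near.
Qed.

End DualInvariant.

(** * The minimal tensor product and the coaction *)

Section LinearSpan.
Variables (R : realType) (V : lmodType R[i]) (S : set V).

Lemma lspan_sub : S `<=` lspan S.
Proof.
move=> v Sv; exists 1%N, (fun=> 1), (fun=> v); split=> //.
by rewrite big_ord1 scale1r.
Qed.

Lemma lspan0 : lspan S 0.
Proof.
by exists 0%N, (fun=> 0), (fun=> 0); split=> [[]//|]; rewrite big_ord0.
Qed.

Lemma lspanZ (z : R[i]) v : lspan S v -> lspan S (z *: v).
Proof.
move=> [k [c [w [Sw ->]]]]; exists k, (fun i => z * c i), w; split=> //.
by rewrite scaler_sumr; apply: eq_bigr => i _; rewrite scalerA.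
Qed.

Lemma lspanD v w : lspan S v -> lspan S w -> lspan S (v + w).
Proof.
move=> [k [c [p [Sp ->]]]] [l [d [q [Sq ->]]]].
exists (k + l)%N, (fun i => match fintype.split i with inl j => c j | inr j => d j end),
  (fun i => match fintype.split i with inl j => p j | inr j => q j end); split.
  by move=> i; case: (fintype.split i).
rewrite big_split_ord /=; congr (_ + _); apply: eq_bigr => i _.
  by rewrite -[lshift _ i]/(unsplit (inl i)) unsplitK.
by rewrite -[rshift _ i]/(unsplit (inr i)) unsplitK.
Qed.

Lemma lspan_sum (J : Type) (l : seq J) (F : J -> V) :
  (forall j, lspan S (F j)) -> lspan S (\sum_(j <- l) F j).
Proof.
move=> h; elim: l => [|j l IH]; first by rewrite big_nil; exact: lspan0.
by rewrite big_cons; exact: lspanD.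
Qed.

Lemma lspan_ind (P : V -> Prop) : P 0 -> (forall v, S v -> P v) ->
  (forall z v, P v -> P (z *: v)) -> (forall v w, P v -> P w -> P (v + w)) ->
  forall v, lspan S v -> P v.
Proof.
move=> P0 PS PZ PD _ [k [c [w [Sw ->]]]].
by elim/big_rec: _ => // i v _ Pv; apply: PD => //; apply: PZ; exact: PS.
Qed.

End LinearSpan.

Section GroupAlgebra.
Variables (R : realType) (Gam : groupType).
Implicit Types (g : Gam -> R[i]^o) (s r t : Gam).

Definition grpbound g (M : R) : Prop := kbound (fun s r => g (s / r)%g) M.

Lemma finsupp_fset g : Defs.finsupp g -> exists Q : {fset Gam}, forall t, t \notin Q -> g t = 0.
Proof.
move=> fin; exists (fset_set [set t | g t != 0]) => t.
by rewrite in_fset_set // notin_setE /= => /negP; rewrite negbK => /eqP.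
Qed.

Lemma fset_finsupp g (Q : {fset Gam}) : (forall t, t \notin Q -> g t = 0) -> Defs.finsupp g.
Proof.
move=> gQ; apply: (@sub_finite_set _ _ [set` Q]); last exact: finite_fset.
by move=> t /=; apply: contraNT => /gQ ->.
Qed.

Lemma grpnorm_le g (M : R) : 0 <= M -> Defs.finsupp g ->
  (grpnorm g <= M%:E)%E <-> grpbound g M.
Proof.
move=> M0 /finsupp_fset[Q gQ].
apply: (@opnorm_kbound _ _ _ [set: Gam] id) => //.
  by apply/seteqP; split=> // x _; exists x.
move=> s; exists (rowsupp Q s) => [r /notin_rowsupp /gQ //|xi].
rewrite /lreg (reindex_fsbigT (fun r => s / r)%g) /=; last first.
  by exists (fun r => r^-1 * s)%g => r; rewrite ?invgM ?invgK ?mulgA ?mulgVK ?mulgV ?mul1g // mulgK.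
rewrite (fsbig_gsupp (Q := rowsupp Q s)) => [|r /notin_rowsupp /gQ ->].
  by apply: eq_bigr => r _; rewrite invgM invgK mulgVK.
by rewrite mul0r.
Qed.

Lemma grpbound_finsupp g : Defs.finsupp g -> exists2 M : R, 0 <= M & grpbound g M.
Proof.
move=> /finsupp_fset[Q gQ]; exists (\sum_(t <- Q) cmod (g t)).
  by apply: sumr_ge0 => t _; exact: cmod_ge0.
have h t : kbound (fun s r => if (s / r)%g == t then g t else 0) (cmod (g t)).
  apply: (kbound_perm (phi := fun s => t^-1 * s)%g); rewrite ?cmod_ge0 //.
  - exact: mulgI.
  - move=> s r; case: ifP => [/eqP <- _|_]; last by rewrite eqxx.
    by rewrite invgM invgK mulgVK.
  - by move=> s r; case: ifP; rewrite ?cmod0 ?cmod_ge0.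
apply: eq_kbound (kbound_sum Q h) => s r.
have [sQ|sQ] := boolP ((s / r)%g \in Q).
  rewrite (big_fsetD1 (s / r)%g) //= eqxx big_seq big1 ?addr0 // => t.
  by rewrite !inE eq_sym => /andP[/negPf ->].
rewrite gQ // big_seq big1 // => t tQ; case: eqP => // st.
by rewrite st tQ in sQ.
Qed.

Lemma finsuppZD (z : R[i]) g h : Defs.finsupp g -> Defs.finsupp h -> Defs.finsupp (z *: g + h).
Proof.
move=> /finsupp_fset[Q gQ] /finsupp_fset[Q' hQ]; apply: (@fset_finsupp _ (Q `|` Q')%fset) => t.
rewrite inE negb_or => /andP[tQ tQ'].
by rewrite -[LHS]/(z * g t + h t) gQ // hQ // mulr0 addr0.
Qed.

End GroupAlgebra.

Section Coaction.
Variables (R : realType) (Gam : groupType) (X : topologicalType).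
Variable beta : Gam -> X -> X.
Hypothesis beta_action : is_action_by_homeos beta.
Hypothesis X_hausdorff : hausdorff_space X.
Local Notation G := (arrow beta).
Local Notation mk := (mkarrow beta).
Local Notation Cc := (@Cc R Gam X beta).
Local Notation Cstar := (@Cstar R Gam X beta).
Local Notation rednorm := (@rednorm R Gam X beta).
Local Notation algtens := (@algtens R Gam X beta).
Local Notation minnorm := (@minnorm R Gam X beta).
Implicit Types (f : G -> R[i]^o) (g : Gam -> R[i]^o) (x : X) (s r t p : Gam).
Implicit Types (b : nat -> Gam -> R[i]^o).
Implicit Types (F : G * Gam -> R[i]^o) (a : nat -> G -> R[i]^o) (U : set X).

(** The matrix of [Indlreg x F] on l^2(Gam x Gam) *)
Definition mker x F (q q' : Gam * Gam) : R[i] :=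
  F (mk (q.1 / q'.1)%g (beta q'.1 x), (q.2 / q'.2)%g).

Definition minbound F (M : R) : Prop := forall x, kbound (mker x F) M.

Definition gsupp2 (Q Q' : {fset Gam}) F : Prop :=
  forall t x p, ~~ ((t \in Q) && (p \in Q')) -> F (mk t x, p) = 0.

Lemma minnorm_le Q Q' F (M : R) : 0 <= M -> gsupp2 Q Q' F ->
  (minnorm F <= M%:E)%E <-> minbound F M.
Proof.
move=> M0 FQ.
pose e x (q : Gam * Gam) : G * Gam := (mk q.1 x, q.2).
have eI x : injective (e x).
  move=> [s p] [r q] sr; congr (_, _); last exact: (congr1 snd sr).
  exact: (mkarrow_inj (congr1 fst sr)).
have eE x : src_fiber beta x `*` [set: Gam] = range (e x).
  apply/seteqP; split=> [[gam p] [/= + _]|_ [[s p] _ <-]]; last by split.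
  by rewrite src_fiberE => -[s _ <-]; exists (s, p).
have key x : (opnorm (src_fiber beta x `*` [set: Gam]) (Indlreg x F) <= M%:E)%E <->
    kbound (mker x F) M.
  apply: (opnorm_kbound (eI x) (eE x)) => // -[s p].
  pose P := (rowsupp Q s `*` rowsupp Q' p)%fset.
  have PF r q : (r, q) \notin P -> mker x F (s, p) (r, q) = 0.
    move=> nP; apply: FQ; apply: contra nP => /andP[/= sr pq].
    rewrite in_fsetM /=; apply/andP.
    by split; [apply: contraLR sr|apply: contraLR pq]; exact: notin_rowsupp.
  exists P => [[r q]|xi]; first exact: PF.
  pose h (q : Gam * Gam) : G * Gam := (mk q.1 x, (p / q.2)%g).
  have hbij : set_bij [set: Gam * Gam] (src_fiber beta x `*` [set: Gam]) h.
    split=> // [[r q] [r' q'] _ _ rr|[gam q]].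
      congr (_, _); first exact: (mkarrow_inj (congr1 fst rr)).
      by have /mulgI/invg_inj := congr1 snd rr.
    move=> [/= + _]; rewrite src_fiberE => -[r _ <-].
    by exists (r, q^-1 * p)%g => //; rewrite /h /= invgM invgK mulgA mulgV mul1g.
  rewrite /Indlreg (reindex_fsbig _ _ _ _ hbij) /h /=.
  rewrite (fsbigTE P) => [|[r q] /PF h0 /=]; last by rewrite [X in X * _]h0 mul0r.
  by apply: eq_bigr => -[r q] _ /=; rewrite invgM invgK mulgVK.
split=> [h x|h].
  by apply/key; apply: le_trans h; apply: ereal_sup_ubound; exists x.
by apply: ge_ereal_sup => _ [x _ <-]; apply/key.
Qed.

Lemma minboundD F F' (M M' : R) : minbound F M -> minbound F' M' -> minbound (F + F') (M + M').
Proof. by move=> h h' x; exact: kboundD (h x) (h' x). Qed.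

Lemma minboundN F (M : R) : minbound F M -> minbound (- F) M.
Proof. by move=> h x; exact: kboundN (h x). Qed.

Lemma minboundZ (z : R[i]) F (M : R) : 0 <= M -> minbound F M -> minbound (z *: F) (cmod z * M).
Proof. by move=> M0 h x; exact: kboundZ M0 (h x). Qed.

Lemma minbound0 : minbound 0 0.
Proof. by move=> x; exact: kbound0. Qed.

Lemma minbound_le F (M M' : R) : M <= M' -> minbound F M -> minbound F M'.
Proof. by move=> MM' h x; exact: kbound_le MM' (h x). Qed.

(** The matrix of [f (x) g] is the product of two block diagonal matrices. *)
Lemma minbound_tens Q f g (M M' : R) : 0 <= M -> 0 <= M' -> gsupp Q f ->
  redbound f M -> grpbound g M' -> minbound (tens f g) (M * M').
Proof.
move=> M0 M0' fQ fM gM x.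
pose k (q q' : Gam * Gam) : R[i] := if q.2 == q'.2 then gker x f q.1 q'.1 else 0.
pose k' (q q' : Gam * Gam) : R[i] := if q.1 == q'.1 then g (q.2 / q'.2)%g else 0.
apply: (@kbound_comp _ _ k k') => //.
- move=> [s p]; exists [fset (r, p) | r in rowsupp Q s]%fset.
    move=> [r q] nin; rewrite /k /=; case: eqP => // pq; apply: gker_rows fQ _.
    by apply: contra nin => rs; apply/imfsetP; exists r; rewrite // pq.
  move=> [r q]; rewrite big_imfset /=; last by move=> ? ? _ _ [].
  rewrite /k /k' /= eqxx.
  have [rs|rs] := boolP (r \in rowsupp Q s).
    rewrite (big_fsetD1 r) //= eqxx big_seq big1 ?addr0 // => r'.
    by rewrite !inE => /andP[/negPf -> _]; rewrite mulr0.
  rewrite /mker /tens /= -[X in X * _]/(gker x f s r) (gker_rows _ fQ rs) mul0r.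
  rewrite big_seq big1 // => r' r's; case: eqP => [r'E|_]; last by rewrite mulr0.
  by rewrite -r'E r's in rs.
- apply: (kbound_blocks (cl := snd) (pr := fst) (bk := fun w s => (s, w))) (fM x) => //.
  by case.
- apply: (kbound_blocks (cl := fst) (pr := snd) (bk := fun w s => (w, s))) gM => //.
  by case.
Qed.

Lemma algtens_fin F : algtens F -> (exists Q Q', gsupp2 Q Q' F) /\
  exists2 M : R, 0 <= M & minbound F M.
Proof.
move: F; apply: lspan_ind.
- split; first by exists fset0, fset0.
  by exists 0 => //; exact: minbound0.
- move=> _ [f [g [fc gfin ->]]].
  have [Q fQ] := Cc_gsupp fc; have [Q' gQ] := finsupp_fset gfin.
  have [M M0 fM] := Cc_redbound fc; have [M' M0' gM] := grpbound_finsupp gfin.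
  split; last by exists (M * M'); [exact: mulr_ge0|exact: minbound_tens fQ fM gM].
  exists Q, Q' => t x p; rewrite negb_and => /orP[tQ|pQ]; rewrite /tens /=.
    by rewrite fQ ?mul0r.
  by rewrite gQ ?mulr0.
- move=> z F [[Q [Q' FQ]] [M M0 FM]]; split.
    by exists Q, Q' => t x p tp; rewrite -[LHS]/(z * F (mk t x, p)) FQ ?mulr0.
  by exists (cmod z * M); [rewrite mulr_ge0 ?cmod_ge0|exact: minboundZ].
- move=> F F' [[Q [Q' FQ]] [M M0 FM]] [[P [P' FP]] [M' M0' FM']]; split.
    exists (Q `|` P)%fset, (Q' `|` P')%fset => t x p; rewrite !inE => tp.
    rewrite -[LHS]/(F (mk t x, p) + F' (mk t x, p)) FQ ?FP ?addr0 //.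
      by apply: contra tp => /andP[-> ->]; rewrite !orbT.
    by apply: contra tp => /andP[-> ->].
  by exists (M + M'); [exact: addr_ge0|exact: minboundD].
Qed.

(* the hypotheses of the lemmas on completions, for the minimal norm *)
Let DB F F' : algtens F -> algtens F' -> algtens (F - F').
Proof. by move=> hF hF'; rewrite -scaleN1r; apply: lspanD => //; exact: lspanZ. Qed.

Let NP F (M : R) : algtens F -> 0 <= M -> (minnorm F <= M%:E)%E <-> minbound F M.
Proof. by move=> /algtens_fin[[Q [Q' FQ]] _] M0; exact: minnorm_le FQ. Qed.

Let nbf F : algtens F -> exists2 M : R, 0 <= M & minbound F M.
Proof. by case/algtens_fin. Qed.

Let minnorm_pos : (forall F, algtens F -> (0 <= minnorm F)%E) \/
  (forall F, algtens F -> minnorm F = -oo%E).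
Proof.
have [[x _]|nx] := pselect (exists x : X, True); [left|right] => F _.
  apply: le_trans (ereal_sup_ubound _); last by exists x.
  pose e (q : Gam * Gam) : G * Gam := (mk q.1 x, q.2).
  apply: (@opnorm_ge0 _ _ _ _ e).
    move=> [s p] [r q] sr; congr (_, _); last exact: (congr1 snd sr).
    exact: (mkarrow_inj (congr1 fst sr)).
  apply/seteqP; split=> [[gam p] [/= + _]|_ [[s p] _ <-]]; last by split.
  by rewrite src_fiberE => -[s _ <-]; exists (s, p).
rewrite /minnorm (_ : [set _ | _ in _] = set0) ?ereal_sup0 //.
by apply/seteqP; split => // y [x _ _]; apply: nx; exists x.
Qed.

Lemma coactionE f gam p : coaction_fun f (gam, p) = if coc gam == p then f gam else 0.
Proof.
rewrite /coaction_fun (fsbigTE [fset p]%fset) => [|t].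
  by rewrite big_seq_fset1 /tens /= eqxx mulr1.
by rewrite inE eq_sym /tens /= => /negPf ->; rewrite mulr0.
Qed.

Lemma coactionB f f' : coaction_fun (f - f') = coaction_fun f - coaction_fun f'.
Proof.
apply/funext => -[gam p]; rewrite -[RHS]/(coaction_fun f _ - coaction_fun f' _) !coactionE.
by case: ifP; rewrite ?subr0.
Qed.

(** Fell's absorption principle: the matrix of [coaction_fun f] is block diagonal,
    and all its blocks are copies of the matrix of [f]. *)
Lemma minbound_coaction f (M : R) : 0 <= M -> redbound f M -> minbound (coaction_fun f) M.
Proof.
move=> M0 fM x; apply: (@kbound_blocks _ _ _ _ _ (gker x f) _ (fun q => q.1^-1 * q.2)%g fst
  (fun w s => (s, (s * w)%g))) => //; first by move=> [s p] /=; rewrite mulVKg.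
by move=> [s p] [r q]; rewrite /mker coactionE -[coc _]/(s / r)%g eq_divg_mulVg.
Qed.

Definition dirac t : Gam -> R[i]^o := fun s => if s == t then 1 else 0.

Lemma finsupp_dirac t : Defs.finsupp (dirac t).
Proof.
by apply: (@fset_finsupp _ _ _ [fset t]%fset) => s; rewrite inE /dirac => /negPf ->.
Qed.

Lemma coaction_sum Q f : gsupp Q f -> coaction_fun f = \sum_(t <- Q) tens (restr t f) (dirac t).
Proof.
move=> fQ; apply/funext => -[gam p]; rewrite coactionE fct_sumE.
rewrite -{2}(arrow_eta gam); have [cQ|cQ] := boolP (coc gam \in Q); last first.
  rewrite fQ // if_same big_seq big1 // => t tQ; rewrite /tens /restr /=.
  by case: eqP => [ct|_]; rewrite ?mul0r //; rewrite ct tQ in cQ.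
rewrite (big_fsetD1 (coc gam)) //= big_seq big1 ?addr0 => [|t].
  by rewrite /tens /restr /dirac /= eqxx arrow_eta eq_sym; case: ifP; rewrite ?mulr1 ?mulr0.
by rewrite !inE eq_sym /tens /restr /= => /andP[/negPf -> _]; rewrite mul0r.
Qed.

Lemma coaction_algtens f : Cc f -> algtens (coaction_fun f).
Proof.
move=> fc; have [Q fQ] := Cc_gsupp fc; rewrite (coaction_sum fQ).
apply: lspan_sum => t; apply: lspan_sub; exists (restr t f), (dirac t); split=> //.
  exact: Cc_restr.
exact: finsupp_dirac.
Qed.

Lemma completion_coaction a : Cstar a -> completion algtens minnorm (coaction a).
Proof.
move=> ca; apply: (completion_intro DB NP minboundD minboundN) => [n|e e0].
  exact: (coaction_algtens (Cstar_mem n ca)).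
near \oo => m; exists (coaction_fun (a m)).
have : \forall n \near \oo, redbound (a n - a m) e.
  by near: m; exact: (Cstar_cauchy ca).
apply: filterS => n h; rewrite /coaction -coactionB.
by apply: minbound_coaction => //; exact: ltW.
Unshelve. all: by end_near.
Qed.

Lemma Cstar_grp_const g : Defs.finsupp g -> Cstar_grp (fun=> g).
Proof.
move=> gfin; split=> // e e0; exists 0%N => m n _ _; rewrite subrr.
apply: (@le_lt_trans _ _ 0%:E); last by rewrite lte_fin.
apply/grpnorm_le => //; last by apply: eq_kbound (@kbound0 R Gam).
by apply: (@fset_finsupp _ _ _ fset0).
Qed.

Lemma Cstar_grp_cauchy b (e : R) : Cstar_grp b -> 0 < e ->
  \forall m \near \oo, \forall n \near \oo, grpbound (b n - b m) e.
Proof.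
move=> [bfin /(_ e)] + e0 => /(_ e0)[n0 h].
exists n0 => // m /= mn; exists n0 => // n /= nn.
apply/grpnorm_le; rewrite ?(ltW e0) //; last exact/ltW/h.
have := finsuppZD (-1) (bfin m) (bfin n); congr Defs.finsupp.
by rewrite scaleN1r addrC.
Qed.

(** An elementary tensor of elements of the completions is Cauchy because the
    minimal norm is a cross norm. *)
Lemma completion_tens a b : Cstar a -> Cstar_grp b ->
  completion algtens minnorm (fun n => tens (a n) (b n)).
Proof.
move=> ca cb; apply: (completion_intro DB NP minboundD minboundN) => [n|e e0].
  apply: lspan_sub; exists (a n), (b n); split=> //; first exact: (Cstar_mem n ca).
  by case: cb.
have [M M0 aM] := Cstar_bounded ca.
have e2 : 0 < e / 2 by rewrite divr_gt0.
have M1 : 0 < M + 1 by rewrite ltr_wpDl.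
have [m bm] : exists m, \forall n \near \oo, grpbound (b n - b m) (e / 2 / (M + 1)).
  near \oo => m; exists m; near: m; apply: (Cstar_grp_cauchy cb).
  by rewrite divr_gt0.
have [B B0 bB] := grpbound_finsupp (proj1 cb m); have B1 : 0 < B + 1 by rewrite ltr_wpDl.
have [k ak] : exists k, \forall n \near \oo, redbound (a n - a k) (e / 2 / (B + 1)).
  near \oo => k; exists k; near: k; apply: (Cstar_cauchy ca).
  by rewrite divr_gt0.
exists (tens (a k) (b m)).
have le2 (c : R) : 0 <= c -> c * (e / 2 / (c + 1)) <= e / 2.
  move=> c0; rewrite mulrA ler_pdivrMr ?ltr_wpDl // mulrC ler_wpM2l ?(ltW e2) //.
  by rewrite lerDl.
near=> n.
have an : Cc (a n) := Cstar_mem n ca; have akc : Cc (a k) := Cstar_mem k ca.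
have [Q anQ] := Cc_gsupp an; have [Q' adQ] := Cc_gsupp (CcB an akc).
have -> : tens (a n) (b n) - tens (a k) (b m) =
    tens (a n) (b n - b m) + tens (a n - a k) (b m).
  apply/funext => -[gam p].
  rewrite -[LHS]/(a n gam * b n p - a k gam * b m p).
  rewrite -[RHS]/(a n gam * (b n p - b m p) + (a n gam - a k gam) * b m p).
  by rewrite mulrBr mulrBl addrA subrK.
rewrite [e]splitr; apply: minboundD.
  apply: minbound_le (le2 _ M0) _; apply: (minbound_tens _ _ anQ) => //.
  - by rewrite divr_ge0 ?(ltW e2) ?(ltW M1).
  - by near: n.
  - by near: n.
apply: minbound_le (le2 _ B0) _; rewrite mulrC; apply: (minbound_tens _ _ adQ) => //.
- by rewrite divr_ge0 ?(ltW e2) ?(ltW B1).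
- by near: n.
Unshelve. all: by end_near.
Qed.

Definition tens_span (I : set (nat -> G -> R[i]^o)) : set (nat -> G * Gam -> R[i]^o) :=
  lspan [set F | exists a (b : nat -> Gam -> R[i]^o),
       [/\ I a, Cstar_grp b & F = fun n => tens (a n) (b n)]].

Lemma completion_minZ (z : R[i]) (F : nat -> G * Gam -> R[i]^o) : completion algtens minnorm F ->
  completion algtens minnorm (z *: F).
Proof.
move=> cF; apply: (completion_intro DB NP minboundD minboundN) => [n|e e0].
  by apply: lspanZ; exact: (completion_mem n cF).
have z1 : 0 < cmod z + 1 by rewrite ltr_wpDl ?cmod_ge0.
have [m Fm] : exists m, \forall n \near \oo, minbound (F n - F m) (e / (cmod z + 1)).
  near \oo => m; exists m; near: m; apply: (completion_cauchy DB NP cF).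
  by rewrite divr_gt0.
exists (z *: F m); apply: filterS Fm => n h.
rewrite -[(z *: F) n]/(z *: F n) -scalerBr.
apply: minbound_le (minboundZ z _ h); last by rewrite divr_ge0 ?(ltW e0) ?(ltW z1).
by rewrite mulrA ler_pdivrMr // mulrC ler_wpM2l ?(ltW e0) // lerDl.
Unshelve. all: by end_near.
Qed.

Lemma tens_span_completion I : I `<=` Cstar -> tens_span I `<=` completion algtens minnorm.
Proof.
move=> IC; apply: lspan_ind.
- split; first by move=> n; exact: lspan0.
  move=> e e0; exists 0%N => m n _ _; rewrite subrr.
  apply: (@le_lt_trans _ _ 0%:E); last by rewrite lte_fin.
  by apply/NP => //; [exact: lspan0|exact: minbound0].
- by move=> _ [a [b [Ia cb ->]]]; exact: completion_tens (IC _ Ia) cb.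
- by move=> z F; exact: completion_minZ.
- move=> F F' cF cF'; have -> : F + F' = F - ((-1) *: F') by rewrite scaleN1r opprK.
  exact: (completionB DB NP minboundD minboundN cF (completion_minZ (-1) cF')).
Qed.

Lemma coaction_closureP I a : I `<=` Cstar -> Cstar a ->
  completion_closure algtens minnorm (tens_span I) (coaction a) <->
  forall e : R, 0 < e -> exists2 F, tens_span I F &
    \forall n \near \oo, minbound (coaction_fun (a n) - F n) e.
Proof.
move=> IC ca.
have H := completion_closureP DB NP minboundD minboundN nbf minnorm_pos (coaction a)
  (tens_span_completion IC).
split=> [/(iffLR H)[_ h] //|h].
by apply: (iffRL H); split=> //; exact: completion_coaction.
Qed.

Lemma coaction_invariant_restr U : (forall t x, U x -> U (beta t x)) ->
  coaction_invariant (@Cstar_restr R Gam X beta U).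
Proof.
move=> Uinv _ [a aU <-].
have IC : Cstar_restr U `<=` Cstar by move=> b; case.
have [ca ha] := (Cstar_restrP a Uinv).1 aU.
apply: (iffRL (coaction_closureP IC ca)) => e e0.
have [f [fc fU hf]] := ha e e0; have [Q fQ] := Cc_gsupp fc.
exists (\sum_(t <- Q) (fun _ : nat => tens (restr t f) (dirac t))).
  apply: lspan_sum => t; apply: lspan_sub.
  have rc : Cc (restr t f) by exact: Cc_restr.
  exists (fun=> restr t f), (fun=> dirac t); split; last 1 first.
  - by [].
  - apply: (Cstar_restrP _ Uinv).2; split; first exact: Cstar_const rc.
    move=> d d0; exists (restr t f); split; first exact: rc.
      by move=> gam nU; rewrite /restr fU // if_same.
    exists 0%N => // n _ /=; rewrite subrr.
    by apply: redbound_le (@redbound0 R Gam X beta); exact: ltW.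
  - by apply: Cstar_grp_const; exact: finsupp_dirac.
apply: filterS hf => n hn; rewrite fct_sumE -(coaction_sum fQ) -coactionB.
by apply: minbound_coaction => //; exact: ltW.
Qed.

(** The slice by the coefficient functional at [t] of the group algebra *)
Definition slice t (F : nat -> G * Gam -> R[i]^o) : nat -> G -> R[i]^o :=
  fun n gam => F n (gam, t).

(** The slice is a compression to the rows [(s, t)] and the columns [(r, 1)]. *)
Lemma redbound_slice t F (M : R) : minbound F M -> redbound (fun gam => F (gam, t)) M.
Proof.
move=> FM x.
have pI : injective (fun s : Gam => (s, t)) by move=> s r [].
have qI : injective (fun s : Gam => (s, 1%g : Gam)) by move=> s r [].
apply: eq_kbound (kbound_compress pI qI (FM x)) => s r.
by rewrite /mker /gker /= divg1.
Qed.

Section Slices.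
Variable I : set (nat -> G -> R[i]^o).
Hypothesis I_cl : closed_subspace Cc rednorm I.

(** The scalars [b n t] converge, so that the slice of [a (x) b] is the limit of
    multiples of [a]. *)
Lemma slice_mem t (F : nat -> G * Gam -> R[i]^o) : tens_span I F -> I (slice t F).
Proof.
move: F; apply: lspan_ind.
- exact: (closed_subspace0 I_cl).
- move=> _ [a [b [Ia cb ->]]]; have ca := closed_subspace_mem I_cl Ia.
  have [M M0 aM] := Cstar_bounded ca; have M1 : 0 < M + 1 by rewrite ltr_wpDl.
  have approx (e : R) : 0 < e -> exists2 c, I c & \forall n \near \oo,
      redbound (slice t (fun n => tens (a n) (b n)) n - c n) e.
    move=> e0; have e1 : 0 < e / (M + 1) by rewrite divr_gt0.
    have [m bm] : exists m, \forall n \near \oo, grpbound (b n - b m) (e / (M + 1)).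
      by near \oo => m; exists m; near: m; exact: (Cstar_grp_cauchy cb).
    exists (b m t *: a); first exact: (closed_subspaceZ I_cl).
    apply: filterS2 aM bm => n anM bnm.
    have -> : slice t (fun n => tens (a n) (b n)) n - (b m t *: a) n = (b n t - b m t) *: a n.
      apply/funext => gam; rewrite -[LHS]/(a n gam * b n t - b m t * a n gam).
      by rewrite -[RHS]/((b n t - b m t) * a n gam) mulrBl [a n gam * _]mulrC.
    have h : cmod (b n t - b m t) <= e / (M + 1).
      by have := @kbound_entry _ _ _ _ t 1%g bnm; rewrite divg1.
    apply: redbound_le (redboundZ _ M0 anM).
    apply: le_trans (ler_wpM2r M0 h) _.
    by rewrite mulrAC ler_pdivrMr // ler_wpM2l ?(ltW e0) // lerDl.
  apply: (closed_approx I_cl _ approx); apply: Cstar_approx.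
    move=> n; rewrite (_ : slice _ _ n = b n t *: a n).
      by apply: CcZ; exact: (Cstar_mem n ca).
    by apply/funext => gam; rewrite -[RHS]/(b n t * a n gam) mulrC.
  move=> e e0; have [c Ic hc] := approx e e0.
  by exists c; [exact: (closed_subspace_mem I_cl Ic)|exact: hc].
- by move=> z F IF; exact: (closed_subspaceZ I_cl z IF).
- by move=> F F' IF IF'; exact: (closed_subspaceD I_cl IF IF').
Unshelve. all: by end_near.
Qed.

(** The slice at [t] of [coaction a] is [coef t a]. *)
Lemma coaction_invariant_coef t a : coaction_invariant I -> I a -> I (coef t a).
Proof.
move=> I_inv Ia; have ca := closed_subspace_mem I_cl Ia.
have IC : I `<=` Cstar by move=> b; exact: (closed_subspace_mem I_cl).
have Ia' : (@coaction R Gam X beta @` I) (coaction a) by exists a.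
have ha := iffLR (coaction_closureP IC ca) (I_inv _ Ia').
apply: (closed_approx I_cl (Cstar_coef beta_action X_hausdorff t ca)) => e e0.
have [F IF hF] := ha e e0; exists (slice t F); first exact: slice_mem.
apply: filterS hF => n /(redbound_slice t); apply: eq_redbound => gam.
rewrite -[LHS]/(coaction_fun (a n) (gam, t) - F n (gam, t)) coactionE.
by [].
Qed.

End Slices.
End Coaction.

(** * Characterization of dynamical ideals *)

Lemma fejer (R : realType) (Gam : groupType) (X : topologicalType)
    (beta : Gam -> X -> X) (J : set (nat -> arrow beta -> R[i]^o)) a :
  is_action_by_homeos beta -> hausdorff_space X ->
  weakly_amenable R Gam \/ approximation_property R Gam ->
  closed_subspace (@Cc R Gam X beta) (@rednorm R Gam X beta) J ->
  Cstar a -> (forall t, J (coef t a)) -> J a.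
Proof.
move=> act haus [wa|ap] J_cl ca Ja.
  exact: fejer_weakly_amenable wa ca Ja.
exact: fejer_approximation ap ca Ja.
Qed.

Theorem mainTheorem11 (R : realType) (Gam : groupType) (X : topologicalType)
    (beta : Gam -> X -> X)
    (Gam_countable : countable [set: Gam])
    (Gam_approx : weakly_amenable R Gam \/ approximation_property R Gam)
    (X_second_countable : @second_countable X)
    (X_locally_compact : locally_compact [set: X])
    (X_hausdorff : hausdorff_space X)
    (beta_action : is_action_by_homeos beta)
    (I : set (nat -> arrow beta -> R[i]^o))
    (I_ideal : closed_ideal I) :
  [<-> (* (a) *)
       dynamical_ideal I;
       (* (b) *)
       (abelian_group Gam -> dual_invariant I) /\
       (~ abelian_group Gam -> coaction_invariant I);
       (* (c) *)
       exists U : set X, [/\ open U, forall t : Gam, beta t @` U = U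
                           & I = ideal_generated (C0 beta U)]].
Proof.
have [I_cl _] := I_ideal.
tfae.
- move=> [U [_ /(invariantP beta_action) Uinv ->]]; split=> _.
    exact: dual_invariant_restr.
  exact: coaction_invariant_restr.
- move=> [I_dual I_coact].
  have I_coef t a : I a -> I (coef t a).
    have [ab|nab] := pselect (abelian_group Gam) => Ia.
      exact: (dual_invariant_coef beta_action X_hausdorff ab I_cl (I_dual ab) t Ia).
    exact: (coaction_invariant_coef beta_action X_hausdorff I_cl t (I_coact nab) Ia).
  exists (ideal_support I); split.
  + apply: (ideal_support_open beta_action X_hausdorff) => a.
    exact: (closed_subspace_mem I_cl).
  + apply/(image_invariantP beta_action).
    exact: (ideal_support_invariant beta_action X_hausdorff I_ideal).
  + apply/seteqP; split=> [a Ia J [J_ideal UJ]|a].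
      have [J_cl _] := J_ideal.
      apply: (fejer beta_action X_hausdorff Gam_approx J_cl).
        exact: (closed_subspace_mem I_cl Ia).
      move=> t.
      exact: (coef_mem_generated beta_action X_hausdorff I_ideal t J_ideal UJ Ia).
    apply; split; first exact: I_ideal.
    exact: (C0_ideal_support beta_action X_hausdorff I_ideal I_coef).
- move=> [U [Uopen Uinv IE]].
  move/(image_invariantP beta_action): Uinv => Uinv.
  exists U; split=> //; first by apply/(invariantP beta_action).
  by rewrite IE; exact: (ideal_generated_C0 R beta_action X_hausdorff Uinv).
Qed.
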